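(* Let $\overline{p}(n)$ denote the number of overpartitions of $n$. For every positive integer $n$, \[ \frac{1}{8n}\left(1-\frac{1}{\sqrt n}\right)e^{\pi\sqrt n}\leq \overline{p}(n)\leq \frac{1}{8n}\left(1+\frac{1}{\sqrt n}\right)e^{\pi\sqrt n}. \]
   Context: An overpartition of a nonnegative integer $n$ is a partition of $n$ in which the first occurrence of each distinct part may be overlined; equivalently $\sum_{n\ge0}\overline{p}(n)q^n=\prod_{n\ge1}\frac{1+q^n}{1-q^n}$. *)

(* Defs.v *)
From mathcomp Require Import all_boot.

Set Implicit Arguments.
Unset Strict Implicit.
Unset Printing Implicit Defensive.

(* A part is a pair (size, overlined?). *)
Definition opart := (nat * bool)%type.

(* [opart_next x y]: the part y may immediately follow the part x when parts
   are listed in nonincreasing order.  If x and y have the same size, then y is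
   not the first occurrence of that size and so cannot be overlined. *)
Definition opart_next : rel opart :=
  fun x y => (y.1 <= x.1) && ((y.1 == x.1) ==> ~~ y.2).

Definition is_overpartition (n : nat) (s : seq opart) : bool :=
  [&& sorted opart_next s,
      all (fun x => 0 < x.1) s
    & sumn (unzip1 s) == n].

(* The candidates are the lists of at most n parts of size at most n: by
   [overpartition_in_box] below, this includes every overpartition of n. *)
Definition obox (n : nat) := {bseq n of 'I_n.+1 * bool}.

Definition oparts (n : nat) (s : obox n) : seq opart :=
  [seq (nat_of_ord x.1, x.2) | x <- s].

Definition overpartitions (n : nat) : {set obox n} :=
  [set s | is_overpartition n (oparts s)].

(* The number of overpartitions of n. *)
Definition overp (n : nat) : nat := #|overpartitions n|.

Lemma oparts_inj n : injective (@oparts n).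
Proof.
move=> s t /inj_map e; apply/val_inj/e => -[i b] [j c] /= [ij ->].
by congr pair; apply: val_inj.
Qed.

Lemma overpartition_in_box n (s : seq opart) :
  is_overpartition n s ->
  exists2 t : obox n, t \in overpartitions n & oparts t = s.
Proof.
move=> H; case/and3P: (H) => _ pos /eqP sum_n.
have size_s : size s <= n.
  rewrite -sum_n; elim: (s) pos => //= x u IH /andP[x_gt0 /IH].
  by move=> le_u; rewrite -add1n leq_add.
have le_n : all (fun x => x.1 <= n) s.
  rewrite -sum_n; elim: (s) => //= x u IH; rewrite leq_addr /=.
  by apply: sub_all IH => y /leq_trans; apply; rewrite leq_addl.
pose f (x : opart) : 'I_n.+1 * bool := (inord x.1, x.2).
have size_fs : size (map f s) <= n by rewrite size_map.
have eq_s : oparts (Bseq size_fs : obox n) = s.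
  rewrite /oparts /= -map_comp map_id_in // => -[k b] xs /=.
  by rewrite inordK // ltnS; apply: (allP le_n _ xs).
by exists (Bseq size_fs) => //; rewrite inE eq_s.
Qed.

(* Main.v *)
Require Import Defs.
From Stdlib Require Import Reals.
From mathcomp Require all_boot.
From Stdlib Require Import ZArith Lia Lra Machin.
From Coquelicot Require Import Coquelicot.

(* The circle method made explicit, in real variables only. Write
   F(q) = sum p(n) q^n = prod (1 + q^i) / (1 - q^i) and Lam(a) = ln F(e^-a).
   With F cut to its first N >= n factors, p(n) e^{-an} is still the integral of
   (1/pi) Re (F(e^{-a+it}) e^{-int}) over [0, pi]: both sides satisfy the same recurrence
   in N, so no complex analysis is needed; the saddle is at a = pi / (2 sqrt n). By Gauss
   1/F = theta4, and theta3(q) = 2 theta3(q^4) - theta4(q) telescopes along q, q^(1/4),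
   q^(1/16), ..., so that Lam(a) = pi^2/(4a) + ln(a/(4 pi))/2 up to an exponentially
   small error, with no appeal to Poisson summation. As Lam is completely monotone, its
   finite differences bound its derivatives, which control modulus and argument of the
   integrand near the saddle; this settles n >= 3000. For smaller n, p(n) is computed
   from the recurrence p(n) = 2 (p(n-1) - p(n-4) + p(n-9) - ...), which is F theta4 = 1. *)

(** * Counting overpartitions by largest part *)

(** What is tight is the constant. With [lam = PI * sqrt n / 2] the theorem allows a relative error
    [1 / sqrt n = (PI / 2) / lam], about [1.571 / lam]. The true correction is near [- 0.5 / lam],
    but the lower bound of the integral takes the phase in absolute value, losing the signs of its
    linear and cubic terms, and ends with a loss of [1.495 / lam]. The tails of that integral decay
    like an exponential of [lam ^ (1/3)] only; [lam >= 86], which is [n >= 3000], is where they fit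
    into what remains. Working with finite products makes every function of [t] an elementary
    differentiable expression. The price is that [N] is chosen after [a], and that the bounds far
    from the saddle have to be uniform in [t] for that [N]. *)

Module OverpartitionCount.
Import all_boot.
Local Open Scope nat_scope.
Set Implicit Arguments.
Unset Strict Implicit.

(* [below M n s]: s is an overpartition of n into parts of size at most M;
   [plain M n s]: moreover s does not start with an overlined M. *)
Definition below M n (s : seq opart) :=
  is_overpartition n s && all (fun x => x.1 <= M) s.
Definition plain M n s := below M n s && (ohead s != Some (M, true)).

(** Puts copies of [M] that are not overlined in front of the lists of [f]. The fuel only ensures
    termination: for [M > 0], [n] units are enough. *)
Fixpoint plain_enum (M : nat) (f : nat -> seq (seq opart)) (fuel n : nat) :=
  f n ++ (if fuel is k.+1 then
            if M <= n then map (cons (M, false)) (plain_enum M f k (n - M))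
            else [::]
          else [::]).

(** If the size [N] occurs, its first copy is overlined or not, and in both cases the rest is a
    [plain] list. *)
Fixpoint below_enum (N n : nat) : seq (seq opart) :=
  if N is M.+1 then
    below_enum M n ++
    (if N <= n then
       map (cons (N, false)) (plain_enum N (below_enum M) (n - N) (n - N)) ++
       map (cons (N, true)) (plain_enum N (below_enum M) (n - N) (n - N))
     else [::])
  else if n is 0 then [:: [::]] else [::].

(** Sizes are nonincreasing, so the head bounds the tail and the bound [M] may be tightened to the
    size of the head. *)
Lemma below_cons M n (x : opart) s :
  below M n (x :: s) =
  [&& path opart_next x s, 0 < x.1 <= M, x.1 <= n & below x.1 (n - x.1) s].
Proof.
have tr : transitive (fun x y : opart => y.1 <= x.1).
  by move=> ? ? ? h1 h2; apply: leq_trans h2 h1.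
rewrite /below /is_overpartition /=.
case E: (path opart_next x s) => //=.
have srt : sorted opart_next s by apply: path_sorted E.
have le1 : all (fun y => y.1 <= x.1) s.
  have : path (fun x y : opart => y.1 <= x.1) x s.
    by apply: sub_path E => y z /andP[].
  by rewrite (path_sortedE tr) => /andP[].
rewrite srt le1 /= andbT.
case: (ltnP 0 x.1) => //= x0.
case xM: (x.1 <= M) => /=; last by rewrite andbF.
have -> : all (fun y => y.1 <= M) s.
  by apply: sub_all le1 => y /leq_trans; apply.
rewrite andbT; case: leqP => xn /=.
  by rewrite -[in LHS](subnKC xn) eqn_add2l.
by rewrite [_ == n]gtn_eqF ?andbF // ltn_addr.
Qed.

Lemma consI (T : Type) (x : T) : injective (cons x).
Proof. by move=> s1 s2 []. Qed.

Lemma below_nil M n : below M n [::] = (n == 0).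
Proof. by rewrite /below /is_overpartition /= eq_sym andbT. Qed.

Lemma path_plain M n s b : path opart_next (M, b) s && below M n s = plain M n s.
Proof.
rewrite /plain; case: s => [|y s]; first by rewrite andbT.
rewrite below_cons /= /opart_next /= (_ : (Some y == _) = (y == (M, true))) //.
case: y => [k c]; rewrite xpair_eqE /=.
case: (path _ _ s); rewrite ?andbF //= ?andbT.
case: (leqP k M) => kM; rewrite ?andbF //=.
by case: (k == M); case: c => //=; rewrite ?andbT ?andbF.
Qed.

Lemma below_consE M n b s : 0 < M ->
  below M n ((M, b) :: s) = (M <= n) && plain M (n - M) s.
Proof. by move=> M0; rewrite below_cons /= M0 leqnn /= andbCA path_plain. Qed.

Lemma below_small M n x s : x.1 <= M -> below M.+1 n (x :: s) = below M n (x :: s).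
Proof. by move=> xM; rewrite !below_cons xM (leq_trans xM). Qed.

Lemma below_large M n x s : M < x.1 -> below M n (x :: s) = false.
Proof. by move=> xM; rewrite below_cons [x.1 <= M]leqNgt xM /= !andbF. Qed.

Lemma plain_enumP M (f : nat -> seq (seq opart)) fuel n :
  (forall n s, (s \in f n) = below M n s) -> n <= fuel ->
  forall s, (s \in plain_enum M.+1 f fuel n) = plain M.+1 n s.
Proof.
move=> fP; elim: fuel n => [|k IH] n le_n s /=.
  move: le_n; rewrite leqn0 => /eqP ->; rewrite cats0 fP /plain.
  case: s => [|[i c] s]; rewrite ?below_nil // !below_cons /=.
  by case: i => [|i]; rewrite ?andbF.
rewrite mem_cat fP /plain; case: s => [|[i c] s].
  rewrite !below_nil andbT; case: (n == 0) => //=; case: leqP => // _.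
  by apply/mapP => -[].
case: (ltngtP i M.+1) => iM.
- rewrite below_small // (_ : (ohead _ != _)) ?andbT; last first.
    by apply/eqP => -[e _]; rewrite e ltnn in iM.
  case: (below M n _) => //=; case: leqP => // _.
  by apply/mapP => -[t _ [e]]; rewrite e ltnn in iM.
- rewrite !below_large //; last by apply: ltn_trans iM.
  case: leqP => // _; apply/mapP => -[t _ [e]]; by rewrite e ltnn in iM.
rewrite {i}iM below_large //= below_consE //; case: leqP => //= Mn.
case: c.
  rewrite eqxx andbF; apply/mapP => -[t _ []] //.
rewrite (mem_map (@consI _ _)) IH; last first.
  by rewrite leq_subLR addSn (leq_trans le_n) ?ltnS ?leq_addl.
by rewrite (_ : _ != Some _) ?andbT //; apply/eqP => -[].
Qed.

Lemma below_enumP N n s : (s \in below_enum N n) = below N n s.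
Proof.
elim: N n s => [|N IH] n s /=.
  case: s => [|[i c] s]; first by rewrite below_nil; case: n.
  rewrite below_cons /= andbCA ltnNge andNb /=; by case: n.
rewrite mem_cat IH; case: s => [|[i c] s].
  rewrite !below_nil; case: (n == 0) => //=; case: leqP => // _.
  by rewrite mem_cat; apply/orP => -[] /mapP[].
case: (ltngtP i N.+1) => iN.
- rewrite below_small //; case: (below N n _) => //=; case: leqP => // _.
  rewrite mem_cat; apply/orP => -[] /mapP[t _ [e]]; by rewrite e ltnn in iN.
- rewrite !below_large //; last by apply: ltn_trans iN.
  case: leqP => //= _; rewrite mem_cat; apply/orP => -[] /mapP[t _ [e]];
  by rewrite e ltnn in iN.
rewrite {i}iN below_large //= below_consE //; case: leqP => //= Nn.
rewrite mem_cat; case: c.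
  rewrite (mem_map (@consI _ _)) (plain_enumP IH) //.
  by case: (plain _ _ _); rewrite ?orbT // orbF; apply/mapP => -[].
rewrite (mem_map (@consI _ _)) (plain_enumP IH) //.
by case: (plain _ _ _) => //=; apply/mapP => -[].
Qed.

Lemma plain_enum_uniq M (f : nat -> seq (seq opart)) fuel n :
  (forall n s, (s \in f n) = below M n s) -> (forall n, uniq (f n)) ->
  uniq (plain_enum M.+1 f fuel n).
Proof.
move=> fP fU; elim: fuel n => [|k IH] n /=; first by rewrite cats0.
case: ifP => _; last by rewrite cats0 fU.
rewrite cat_uniq fU map_inj_uniq ?IH ?andbT; last exact: consI.
apply/hasPn => t /mapP[u _ ->]; by rewrite fP below_large.
Qed.

Lemma below_enum_uniq N n : uniq (below_enum N n).
Proof.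
elim: N n => [|N IH] n /=; first by case: n.
case: ifP => _; last by rewrite cats0 IH.
have U := plain_enum_uniq (n - N.+1) (n - N.+1) (@below_enumP N) IH.
rewrite !cat_uniq IH !(map_inj_uniq (@consI _ _)) U /= andbT; apply/andP; split.
  apply/hasPn => t; rewrite mem_cat below_enumP => /orP[] /mapP[u _ ->];
  by rewrite below_large.
by apply/hasPn => t /mapP[u _ ->]; apply/mapP => -[].
Qed.

(** Fuel beyond [n] changes nothing, so the recursive call can be given the canonical fuel. This is
    the equation [(1 - q^M) P = F], coefficientwise, for lists starting with plain copies of one
    size. *)
Lemma size_plain_enum M f fuel n : n <= fuel ->
  size (plain_enum M.+1 f fuel n) =
  size (f n) + (if M < n then size (plain_enum M.+1 f (n - M.+1) (n - M.+1)) else 0).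
Proof.
have sub m k : m <= k.+1 -> m - M.+1 <= k.
  by move=> h; rewrite leq_subLR addSn (leq_trans h) // ltnS leq_addl.
have indep k1 k2 m : m <= k1 -> m <= k2 ->
    size (plain_enum M.+1 f k1 m) = size (plain_enum M.+1 f k2 m).
  elim: k1 k2 m => [|k1 IH] [|k2] m //=.
  - by rewrite leqn0 => /eqP ->.
  - by rewrite leqn0 => _ /eqP ->.
  rewrite !size_cat => h1 h2; case: leqP => // Mm; rewrite !size_map; congr (_ + _); apply: IH; exact: sub.
case: fuel => [|k] h1 /=.
  by move: h1; rewrite leqn0 => /eqP ->; rewrite size_cat.
rewrite size_cat; case: leqP => // Mn; rewrite size_map.
congr (_ + _); apply: indep => //; exact: sub.
Qed.

(** The coefficient of [q^n] in [(1 - q^M) F_M = (1 + q^M) F_(M-1)], where [M = N.+1]. By [B], twice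
    the number of [plain] lists is the difference between the counts for [M] and for [N];
    substituting this into [size_plain_enum] eliminates the [plain] lists. *)
Lemma size_below_enumS N n : N < n ->
  size (below_enum N.+1 n) =
  size (below_enum N.+1 (n - N.+1)) + size (below_enum N n)
  + size (below_enum N (n - N.+1)).
Proof.
move=> Nn; set m := n - N.+1.
have B k : size (below_enum N.+1 k) = size (below_enum N k) +
    (if N < k then 2 * size (plain_enum N.+1 (below_enum N) (k - N.+1) (k - N.+1)) else 0).
  rewrite /= size_cat; case: leqP => // _.
  by rewrite size_cat !size_map mul2n addnn.
rewrite (B n) Nn -/m (@size_plain_enum N _ m m) // mulnDr.
have -> : 2 * (if N < m then size (plain_enum N.+1 (below_enum N) (m - N.+1) (m - N.+1)) else 0)
   = size (below_enum N.+1 m) - size (below_enum N m).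
  by rewrite (B m) addKn; case: leqP.
have le : size (below_enum N m) <= size (below_enum N.+1 m) by rewrite (B m) leq_addr.
by rewrite mul2n -addnn -(addnA (size _)) subnKC // addnA addnC addnA.
Qed.

Lemma size_below_enum_small N n : n <= N -> size (below_enum N.+1 n) = size (below_enum N n).
Proof. by move=> nN /=; rewrite ltnNge nN /= cats0. Qed.

Lemma overpE n : overp n = size (below_enum n n).
Proof.
have <- : size (map (@oparts n) (enum (overpartitions n))) = overp n.
  by rewrite size_map -cardE.
apply: perm_size; apply: uniq_perm.
- by rewrite map_inj_uniq ?enum_uniq //; apply: oparts_inj.
- exact: below_enum_uniq.
move=> s; rewrite below_enumP; apply/mapP/idP.
  case=> t; rewrite mem_enum inE => H ->; rewrite /below H /=.
  apply/allP => x /mapP[y _ ->] /=; by rewrite -ltnS.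
case/andP => /overpartition_in_box[t tP <-] _; exists t => //.
by rewrite mem_enum.
Qed.

Definition nb_below N n := size (below_enum N n).

(** Restated with the order and operations of Stdlib, which [lia] handles in the rest of the
    file. *)
Lemma nb_below_big N n : (N < n)%coq_nat ->
  nb_below N.+1 n =
  Init.Nat.add (Init.Nat.add (nb_below N.+1 (Init.Nat.sub n N.+1)) (nb_below N n))
    (nb_below N (Init.Nat.sub n N.+1)).
Proof. by move/ltP; exact: size_below_enumS. Qed.

Lemma nb_below_small N n : (n <= N)%coq_nat -> nb_below N.+1 n = nb_below N n.
Proof. by move/leP; exact: size_below_enum_small. Qed.

End OverpartitionCount.

Import OverpartitionCount.

(* Overpartitions of [n] into parts of size at most [N]. The extension by [0] to [n < 0] frees
   [cnt_S] of side conditions. *)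
Definition cnt (N : nat) (n : Z) : Z :=
  if (n <? 0)%Z then 0%Z else Z.of_nat (nb_below N (Z.to_nat n)).

Lemma cnt_neg N n : (n < 0)%Z -> cnt N n = 0%Z.
Proof. intros H. unfold cnt. now rewrite (proj2 (Z.ltb_lt _ _) H). Qed.

Lemma cnt_0 n : cnt 0 n = if (n =? 0)%Z then 1%Z else 0%Z.
Proof. destruct n as [|p|p]; trivial. unfold cnt; simpl. now destruct (Pos2Nat.is_succ p) as [k ->]. Qed.

Lemma cnt_S N n :
  (cnt (S N) n - cnt (S N) (n - Z.of_nat (S N)) = cnt N n + cnt N (n - Z.of_nat (S N)))%Z.
Proof.
destruct (Z.lt_ge_cases n 0) as [H|H].
  rewrite !cnt_neg; lia.
unfold cnt; rewrite (proj2 (Z.ltb_ge _ _) H).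
destruct (Z.lt_ge_cases n (Z.of_nat (S N))) as [H1|H1].
  rewrite (proj2 (Z.ltb_lt _ _)) by lia.
  rewrite nb_below_small; lia.
rewrite (proj2 (Z.ltb_ge (n - _) _)) by lia.
rewrite nb_below_big by lia.
replace (Z.to_nat (n - Z.of_nat (S N))) with (Nat.sub (Z.to_nat n) (S N)) by lia.
lia.
Qed.

Lemma cnt_overp N n : (n <= N)%nat -> cnt N (Z.of_nat n) = Z.of_nat (overp n).
Proof.
intros H; unfold cnt. rewrite (proj2 (Z.ltb_ge _ _)) by lia.
rewrite Nat2Z.id, overpE. change (Defs.overp n) with (overp n). f_equal.
induction H as [|N H IH]; trivial. rewrite nb_below_small; trivial.
Qed.

Open Scope R_scope.

(** * The Cauchy integral in real form *)

Fixpoint ssum (f : nat -> R) (N : nat) : R :=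
  match N with O => 0 | S k => ssum f k + f (S k) end.
Fixpoint sprod (f : nat -> R) (N : nat) : R :=
  match N with O => 1 | S k => sprod f k * f (S k) end.

Lemma ssum_S f N : ssum f (S N) = ssum f N + f (S N).
Proof. reflexivity. Qed.
Lemma derive_nonneg_le (f df : R -> R) a b : a <= b ->
  (forall x, a <= x <= b -> is_derive f x (df x)) ->
  (forall x, a <= x <= b -> 0 <= df x) -> f a <= f b.
Proof.
intros Hab Hd Hp.
destruct (MVT_gen f a b df) as [c [Hc E]].
- rewrite Rmin_left, Rmax_right by trivial. intros x Hx; apply Hd; lra.
- rewrite Rmin_left, Rmax_right by trivial. intros x Hx.
  apply continuity_pt_filterlim, (ex_derive_continuous f). eexists; now apply Hd.
rewrite Rmin_left, Rmax_right in Hc by trivial. generalize (Hp c Hc). nra.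
Qed.

Lemma ex_RInt_ex_derive (f : R -> R) u v : (forall t, ex_derive f t) -> ex_RInt f u v.
Proof.
intros H. apply (ex_RInt_continuous (V := R_CompleteNormedModule)). intros t _.
now apply (ex_derive_continuous f).
Qed.

Lemma exp_mono x y : x <= y -> exp x <= exp y.
Proof. intros [H| ->]; [now apply Rlt_le, exp_increasing|apply Rle_refl]. Qed.

Lemma exp_pow x j : exp x ^ j = exp (INR j * x).
Proof.
induction j as [|j IH]; [simpl; now rewrite Rmult_0_l, exp_0|].
rewrite S_INR, <- tech_pow_Rmult, IH, <- exp_plus. f_equal; ring.
Qed.

Lemma sinh_pos x : 0 < x -> 0 < sinh x.
Proof. intros H. unfold sinh. assert (exp (-x) < exp x) by (apply exp_increasing; lra). lra. Qed.

Lemma cosh_sq x : cosh x * cosh x = 1 + sinh x * sinh x.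
Proof.
assert (E : exp x * exp (-x) = 1) by (rewrite <- exp_plus; replace (x + - x) with 0 by ring; apply exp_0).
unfold cosh, sinh. nra.
Qed.

Lemma cosh_ge1 x : 1 <= cosh x.
Proof.
assert (0 < cosh x) by (unfold cosh; generalize (exp_pos x) (exp_pos (-x)); lra).
generalize (cosh_sq x); nra.
Qed.

Lemma cosh_gt1 x : 0 < x -> 1 < cosh x.
Proof. intros H. generalize (cosh_sq x) (sinh_pos x H) (cosh_ge1 x); nra. Qed.

(* [(1 + z) / (1 - z) = rho x phi * exp (i * alp x phi)] for [z = exp (- x + i * phi)]. *)
Definition rho (x phi : R) := sqrt ((cosh x + cos phi) / (cosh x - cos phi)).
Definition alp (x phi : R) := atan (sin phi / sinh x).

Lemma rho_pos x phi : 0 < x -> 0 < rho x phi.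
Proof.
intros H; apply sqrt_lt_R0. generalize (cosh_gt1 x H) (COS_bound phi); intros.
apply Rdiv_lt_0_compat; lra.
Qed.

(** The real part of [(1 + z) / (1 - z)]. It is positive, which is why [atan] gives the right
    argument; [rho_sin_alp] is the imaginary part. *)
Lemma rho_cos_alp x phi : 0 < x -> rho x phi * cos (alp x phi) = sinh x / (cosh x - cos phi).
Proof.
intros H. generalize (cosh_gt1 x H) (COS_bound phi) (sinh_pos x H) (cosh_sq x) (sin2_cos2 phi).
unfold Rsqr; intros h1 h2 h3 h4 h5. unfold rho, alp. rewrite cos_atan.
assert (E : 1 + (sin phi / sinh x)² = (cosh x + cos phi) * (cosh x - cos phi) / (sinh x * sinh x)).
  unfold Rsqr. field_simplify_eq; [nra | lra].
set (p := sqrt (cosh x + cos phi)). set (m := sqrt (cosh x - cos phi)).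
assert (0 < p) by (apply sqrt_lt_R0; lra). assert (0 < m) by (apply sqrt_lt_R0; lra).
assert (Em : m * m = cosh x - cos phi) by (apply sqrt_sqrt; lra).
assert (Ep : p * p = cosh x + cos phi) by (apply sqrt_sqrt; lra).
rewrite E, <- Em, <- Ep.
replace (p * p / (m * m)) with ((p / m) * (p / m)) by (field; lra).
replace (p * p * (m * m) / (sinh x * sinh x)) with ((p * m / sinh x) * (p * m / sinh x)) by (field; lra).
assert (0 < p / m) by (apply Rdiv_lt_0_compat; lra).
assert (0 < p * m / sinh x) by (apply Rdiv_lt_0_compat; nra).
rewrite !sqrt_square by lra. field. lra.
Qed.

Lemma rho_sin_alp x phi : 0 < x -> rho x phi * sin (alp x phi) = sin phi / (cosh x - cos phi).
Proof.
intros H. generalize (rho_cos_alp x phi H) (sinh_pos x H) (cosh_gt1 x H) (COS_bound phi); intros E h h1 h2.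
replace (sin (alp x phi)) with (cos (alp x phi) * (sin phi / sinh x)).
  rewrite <- Rmult_assoc, E. field. lra.
unfold alp. rewrite cos_atan, sin_atan. field.
split; [lra|]. apply Rgt_not_eq, sqrt_lt_R0. unfold Rsqr; nra.
Qed.

(** With [w = (1 + z) / (1 - z)], the real part of [w - z w = 1 + z] multiplied by
    [exp (i * gam)]. *)
Lemma rho_rec x phi gam : 0 < x ->
  rho x phi * cos (gam + alp x phi) - exp (-x) * (rho x phi * cos (gam + alp x phi + phi))
  = cos gam + exp (-x) * cos (gam + phi).
Proof.
intros H. generalize (rho_cos_alp x phi H) (rho_sin_alp x phi H).
generalize (cosh_gt1 x H) (COS_bound phi) (sinh_pos x H) (cosh_sq x) (sin2_cos2 phi).
unfold Rsqr; intros h1 h2 h3 h4 h5 EC ES.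
rewrite !cos_plus, !sin_plus.
set (C := rho x phi * cos (alp x phi)) in *. set (S := rho x phi * sin (alp x phi)) in *.
assert (Es : exp (-x) = cosh x - sinh x) by (unfold cosh, sinh; field).
transitivity (cos gam * (C - exp (-x) * (C * cos phi - S * sin phi))
             - sin gam * (S - exp (-x) * (S * cos phi + C * sin phi))).
  unfold C, S; ring.
rewrite EC, ES, Es. field_simplify_eq; [|lra].
replace (cosh x ^ 2) with (1 + sinh x * sinh x) by (rewrite <- h4; ring).
replace (sin phi ^ 2) with (1 - cos phi * cos phi) by (simpl; nra).
nra.
Qed.

Definition Rmod (a : R) (N : nat) (t : R) := sprod (fun m => rho (INR m * a) (INR m * t)) N.
Definition Aarg (a : R) (N : nat) (t : R) := ssum (fun m => alp (INR m * a) (INR m * t)) N.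
(* [exp (a n)] times the real part of [F_N(q) exp (- i n t)] at [q = exp (- a + i t)],
   where [F_N(q)] is the product of the [(1 + q^m) / (1 - q^m)], [1 <= m <= N]. *)
Definition kern (a : R) (N : nat) (n : Z) (t : R) :=
  exp (a * IZR n) * (Rmod a N t * cos (Aarg a N t - IZR n * t)).
Lemma Rmod_S a N t : Rmod a (S N) t = Rmod a N t * rho (INR (S N) * a) (INR (S N) * t).
Proof. reflexivity. Qed.
Lemma Aarg_S a N t : Aarg a (S N) t = Aarg a N t + alp (INR (S N) * a) (INR (S N) * t).
Proof. reflexivity. Qed.

Definition fcoef a N n := / PI * RInt (kern a N n) 0 PI.

Lemma INR_S_mult_pos a N : 0 < a -> 0 < INR (S N) * a.
Proof. intros H. apply Rmult_lt_0_compat; trivial. apply lt_0_INR; lia. Qed.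

Lemma Rmod_pos a N t : 0 < a -> 0 < Rmod a N t.
Proof.
intros H. induction N as [|N IH]; unfold Rmod; simpl sprod; [lra|].
apply Rmult_lt_0_compat; trivial. now apply rho_pos, INR_S_mult_pos.
Qed.

Lemma ex_derive_rho x k t : 0 < x -> ex_derive (fun t => rho x (k * t)) t.
Proof.
intros H. unfold rho. generalize (cosh_gt1 x H) (COS_bound (k * t)); intros h1 h2.
auto_derive. repeat split; try lra.
apply Rdiv_lt_0_compat; lra.
Qed.

Lemma ex_derive_alp x k t : 0 < x -> ex_derive (fun t => alp x (k * t)) t.
Proof.
intros H. unfold alp. auto_derive. trivial.
Qed.

Lemma ex_derive_Rmod a N t : 0 < a -> ex_derive (Rmod a N) t.
Proof.
intros H; induction N as [|N IH]; unfold Rmod; simpl sprod.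
  apply ex_derive_const.
apply (ex_derive_mult (Rmod a N)); trivial.
now apply ex_derive_rho, INR_S_mult_pos.
Qed.

Lemma ex_derive_Aarg a N t : 0 < a -> ex_derive (Aarg a N) t.
Proof.
intros H; induction N as [|N IH]; unfold Aarg; simpl ssum.
  apply ex_derive_const.
apply (ex_derive_plus (Aarg a N)); trivial.
now apply ex_derive_alp, INR_S_mult_pos.
Qed.

Lemma ex_derive_kern a N n t : 0 < a -> ex_derive (kern a N n) t.
Proof.
intros H; unfold kern. apply ex_derive_mult; [apply ex_derive_const|].
apply ex_derive_mult; [now apply ex_derive_Rmod|].
generalize (ex_derive_Aarg a N t H). intros. auto_derive; trivial.
Qed.

Lemma ex_RInt_kern a N n u v : 0 < a -> ex_RInt (kern a N n) u v.
Proof.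
intros H; apply ex_RInt_ex_derive; intros t; now apply ex_derive_kern.
Qed.

Lemma kern_rec a N n t : 0 < a ->
  kern a (S N) n t - kern a (S N) (n - Z.of_nat (S N)) t =
  kern a N n t + kern a N (n - Z.of_nat (S N)) t.
Proof.
intros H. set (M := Z.of_nat (S N)).
assert (EM : INR (S N) = IZR M) by (unfold M; apply INR_IZR_INZ).
generalize (rho_rec (INR (S N) * a) (INR (S N) * t) (Aarg a N t - IZR n * t) (INR_S_mult_pos a N H)).
unfold kern. rewrite !Rmod_S, !Aarg_S, !EM. rewrite minus_IZR.
replace (exp (a * (IZR n - IZR M))) with (exp (a * IZR n) * exp (- (IZR M * a)))
  by (rewrite <- exp_plus; f_equal; ring).
set (r := rho _ _). set (al := alp _ _). intros E.
replace (Aarg a N t + al - IZR n * t) with (Aarg a N t - IZR n * t + al) by ring.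
replace (Aarg a N t + al - (IZR n - IZR M) * t) with (Aarg a N t - IZR n * t + al + IZR M * t) by ring.
replace (Aarg a N t - (IZR n - IZR M) * t) with (Aarg a N t - IZR n * t + IZR M * t) by ring.
transitivity (exp (a * IZR n) * Rmod a N t *
  (r * cos (Aarg a N t - IZR n * t + al) - exp (- (IZR M * a)) * (r * cos (Aarg a N t - IZR n * t + al + IZR M * t)))).
ring.
rewrite E. ring.
Qed.

Lemma fcoef_rec a N n : 0 < a ->
  fcoef a (S N) n - fcoef a (S N) (n - Z.of_nat (S N)) =
  fcoef a N n + fcoef a N (n - Z.of_nat (S N)).
Proof.
intros H. unfold fcoef. rewrite <- Rmult_minus_distr_l, <- Rmult_plus_distr_l. f_equal.
transitivity (RInt (fun t => kern a (S N) n t - kern a (S N) (n - Z.of_nat (S N)) t) 0 PI).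
  symmetry; apply (RInt_minus (V := R_CompleteNormedModule)); now apply ex_RInt_kern.
transitivity (RInt (fun t => kern a N n t + kern a N (n - Z.of_nat (S N)) t) 0 PI).
  apply RInt_ext; intros t _; now apply kern_rec.
apply (RInt_plus (V := R_CompleteNormedModule)); now apply ex_RInt_kern.
Qed.

Lemma fcoef_0 a n : 0 < a -> fcoef a 0 n = IZR (cnt 0 n).
Proof.
intros H. unfold fcoef. rewrite cnt_0.
assert (E : forall t, kern a 0 n t = exp (a * IZR n) * cos (IZR n * t)).
  intros t; unfold kern; simpl. rewrite <- (cos_neg (IZR n * t)). rewrite Rmult_1_l. unfold Aarg; simpl. now rewrite Rminus_0_l.
rewrite (RInt_ext _ _ _ _ (fun t _ => E t)).
destruct (Z.eqb_spec n 0) as [->|H0].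
  rewrite (RInt_ext _ (fun _ => 1)).
    rewrite RInt_const. unfold scal; simpl; unfold mult; simpl. field. apply PI_neq0.
  intros t _. now rewrite Rmult_0_r, Rmult_0_l, exp_0, cos_0, Rmult_1_l.
assert (n0 : IZR n <> 0) by now apply not_0_IZR.
rewrite (is_RInt_unique _ 0 PI (minus (exp (a * IZR n) * (sin (IZR n * PI) / IZR n)) (exp (a * IZR n) * (sin (IZR n * 0) / IZR n)))).
  rewrite Rmult_0_r, sin_0. rewrite (sin_eq_0_1 (IZR n * PI)) by now exists n.
  unfold minus, plus, opp; simpl. field. split; trivial. apply PI_neq0.
apply (is_RInt_derive (fun t => exp (a * IZR n) * (sin (IZR n * t) / IZR n))).
  intros t _. auto_derive; trivial. field; trivial.
intros t _. apply (ex_derive_continuous (fun t => exp (a * IZR n) * cos (IZR n * t))). auto_derive; trivial.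
Qed.

Lemma Rmod_le_0 a N t : 0 < a -> Rmod a N t <= Rmod a N 0.
Proof.
intros H; induction N as [|N IH]; [unfold Rmod; simpl; lra|].
rewrite !Rmod_S. apply Rmult_le_compat; trivial.
- now apply Rlt_le, Rmod_pos.
- now apply Rlt_le, rho_pos, INR_S_mult_pos.
set (x := INR (S N) * a).
assert (Hx : 0 < x) by now apply INR_S_mult_pos.
rewrite Rmult_0_r. unfold rho. apply sqrt_le_1_alt.
rewrite cos_0. generalize (cosh_gt1 x Hx) (COS_bound (INR (S N) * t)); intros h1 h2.
apply Rmult_le_compat; try lra.
  apply Rlt_le, Rinv_0_lt_compat; lra.
apply Rinv_le_contravar; lra.
Qed.

(** Of use as [n] tends to minus infinity, where the bound tends to 0, and again in [cnt_bound] for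
    the growth of the coefficients. *)
Lemma fcoef_bound a N n : 0 < a -> Rabs (fcoef a N n) <= exp (a * IZR n) * Rmod a N 0.
Proof.
intros H. generalize PI_RGT_0; intros HP. unfold fcoef.
rewrite Rabs_mult, (Rabs_right (/ PI)); [|apply Rle_ge, Rlt_le, Rinv_0_lt_compat; trivial].
apply (Rmult_le_reg_l PI); trivial. rewrite <- Rmult_assoc, Rinv_r, Rmult_1_l by lra.
apply Rle_trans with ((PI - 0) * (exp (a * IZR n) * Rmod a N 0)); [|lra].
apply (abs_RInt_le_const (kern a N n)); try lra.
  now apply ex_RInt_kern.
intros t _. unfold kern. rewrite !Rabs_mult, (Rabs_right (exp _)); [|apply Rle_ge, Rlt_le, exp_pos].
apply Rmult_le_compat_l; [apply Rlt_le, exp_pos|].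
rewrite (Rabs_right (Rmod a N t)); [|apply Rle_ge, Rlt_le, Rmod_pos; trivial].
rewrite <- (Rmult_1_r (Rmod a N 0)).
apply Rmult_le_compat; [apply Rlt_le, Rmod_pos; trivial|apply Rabs_pos|now apply Rmod_le_0|].
apply Rabs_le, COS_bound.
Qed.

(** Both sides satisfy one recurrence, so at each level their difference [D] is periodic in [n] with
    period [N + 1]. Since it tends to 0 at minus infinity, where [cnt] vanishes and [fcoef_bound]
    decays, it is 0. *)
Lemma fcoef_cnt a N n : 0 < a -> fcoef a N n = IZR (cnt N n).
Proof.
intros H. revert n; induction N as [|N IH]; intros n.
  now apply fcoef_0.
set (D := fun k => fcoef a (S N) k - IZR (cnt (S N) k)).
assert (Dstep : forall k, D k = D (k - Z.of_nat (S N))%Z).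
  intros k. unfold D. generalize (fcoef_rec a N k H). rewrite !IH.
  generalize (f_equal IZR (cnt_S N k)). rewrite minus_IZR, plus_IZR. lra.
assert (Diter : forall j : nat, D n = D (n - Z.of_nat j * Z.of_nat (S N))%Z).
  induction j as [|j IHj]; [f_equal; lia|].
  rewrite IHj, Dstep. f_equal. lia.
enough (D0 : D n = 0) by (unfold D in D0; lra).
apply Rabs_eq_0. apply Rle_antisym; [|apply Rabs_pos].
set (C := Rmod a (S N) 0). assert (HC : 0 < C) by now apply Rmod_pos.
apply (is_lim_seq_le_loc (fun _ => Rabs (D n)) (fun j => exp (a * IZR n) * C * exp (- a) ^ j) (Rabs (D n)) 0).
- exists (Z.to_nat (Z.abs n + 1)). intros j Hj.
  rewrite (Diter j). set (k := (n - Z.of_nat j * Z.of_nat (S N))%Z).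
  assert (Hk : (k <= n - Z.of_nat j)%Z) by (unfold k; nia).
  unfold D. rewrite cnt_neg by lia. rewrite Rminus_0_r.
  eapply Rle_trans; [now apply fcoef_bound|]. fold C.
  replace (exp (a * IZR n) * C * exp (- a) ^ j) with (exp (a * IZR n) * exp (-a) ^ j * C) by ring.
  apply Rmult_le_compat_r; [lra|].
  rewrite exp_pow, <- exp_plus.
  apply IZR_le in Hk. rewrite minus_IZR, <- INR_IZR_INZ in Hk.
  destruct (Req_dec (a * IZR k) (a * IZR n + INR j * - a)) as [->|]; [lra|].
  apply Rlt_le, exp_increasing. nra.
- apply is_lim_seq_const.
- replace (Finite 0) with (Rbar_mult (exp (a * IZR n) * C) 0) by (simpl; f_equal; ring).
  apply is_lim_seq_scal_l. apply is_lim_seq_geom.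
  rewrite Rabs_right by (apply Rle_ge, Rlt_le, exp_pos).
  rewrite <- exp_0. apply exp_increasing. lra.
Qed.

Lemma overp_RInt a N n : 0 < a -> (n <= N)%nat ->
  INR (overp n) = exp (a * INR n) * (/ PI * RInt (fun t => Rmod a N t * cos (Aarg a N t - INR n * t)) 0 PI).
Proof.
intros H Hn. rewrite (INR_IZR_INZ (overp n)), <- (cnt_overp N n Hn), <- (fcoef_cnt a); trivial.
unfold fcoef, kern. rewrite <- INR_IZR_INZ.
rewrite (RInt_scal (V := R_CompleteNormedModule)).
  unfold scal; simpl; unfold mult; simpl. ring.
apply ex_RInt_ex_derive; intros t. apply ex_derive_mult; [now apply ex_derive_Rmod|].
generalize (ex_derive_Aarg a N t H). intros. auto_derive; trivial.
Qed.

(** * Gauss's identity for theta4 *)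

Definition oprod (N : nat) (q : R) := sprod (fun i => (1 + q ^ i) / (1 - q ^ i)) N.

Lemma oprod_S N q : oprod (S N) q = oprod N q * ((1 + q ^ S N) / (1 - q ^ S N)).
Proof. reflexivity. Qed.

Lemma ssum_ext f g N : (forall k, (1 <= k <= N)%nat -> f k = g k) -> ssum f N = ssum g N.
Proof.
induction N as [|N IH]; intros H; trivial. rewrite !ssum_S, IH, H; trivial; [lia|].
intros; apply H; lia.
Qed.

Lemma ssum_scal c f N : ssum (fun k => c * f k) N = c * ssum f N.
Proof. induction N as [|N IH]; simpl; [ring|]. rewrite IH; ring. Qed.

Lemma ssum_plus f g N : ssum (fun k => f k + g k) N = ssum f N + ssum g N.
Proof. induction N as [|N IH]; simpl; [ring|]. rewrite IH; ring. Qed.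

Lemma ssum_le f g N : (forall k, (1 <= k <= N)%nat -> f k <= g k) -> ssum f N <= ssum g N.
Proof.
induction N as [|N IH]; intros H; [simpl; lra|]. rewrite !ssum_S.
apply Rplus_le_compat; [apply IH; intros; apply H; lia | apply H; lia].
Qed.

Lemma pow_decr r n m : 0 <= r <= 1 -> (n <= m)%nat -> r ^ m <= r ^ n.
Proof.
intros H Hnm. replace m with (n + (m - n))%nat by lia. rewrite pow_add.
rewrite <- (Rmult_1_r (r ^ n)) at 2. apply Rmult_le_compat_l; [apply pow_le; lra|].
rewrite <- (pow1 (m - n)). apply pow_incr; lra.
Qed.

Lemma pow_lt1 q i : Rabs q < 1 -> (0 < i)%nat -> Rabs (q ^ i) < 1.
Proof.
intros H Hi. rewrite <- RPow_abs. destruct i as [|i]; [lia|].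
simpl. generalize (Rabs_pos q) (pow_incr (Rabs q) 1 i); rewrite pow1. intros h1 h2.
assert (Rabs q ^ i <= 1) by (apply h2; lra). assert (0 <= Rabs q ^ i) by (apply pow_le; lra). nra.
Qed.

Lemma one_minus_pow_pos q i : Rabs q < 1 -> (0 < i)%nat -> 0 < 1 - q ^ i.
Proof. intros H Hi. generalize (pow_lt1 q i H Hi) (Rle_abs (q ^ i)); lra. Qed.

Lemma one_plus_pow_pos q i : Rabs q < 1 -> (0 < i)%nat -> 0 < 1 + q ^ i.
Proof. intros H Hi. generalize (pow_lt1 q i H Hi) (Rle_abs (- q ^ i)); rewrite Rabs_Ropp; lra. Qed.

(* [(q)_N ^ 2 / ((q)_(N-k) (q)_(N+k))], which vanishes for [k > N]. *)
Fixpoint gcoef (q : R) (N k : nat) : R :=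
  match k with
  | O => 1
  | S j => gcoef q N j * ((1 - q ^ (N - j)) / (1 - q ^ (N + S j)))
  end.

Definition gterm q N k := (-1) ^ k * q ^ (k * k) * gcoef q N k.
(** The finite form of [theta4]: the sum over [- N <= k <= N], folded by the symmetry in [k]. It
    equals the finite product exactly. *)
Definition gauss_sum q N := 1 + 2 * ssum (gterm q N) N.

Lemma gcoef_pred q N k : Rabs q < 1 -> (k <= S N)%nat ->
  gcoef q N k * (1 - q ^ S N) ^ 2 =
  gcoef q (S N) k * ((1 - q ^ (S N - k)) * (1 - q ^ (S N + k))).
Proof.
intros H. induction k as [|k IH]; intros Hk.
  simpl gcoef. rewrite Nat.sub_0_r, Nat.add_0_r. ring.
assert (IHk := IH ltac:(lia)). cbn [gcoef].
replace (S N - S k)%nat with (N - k)%nat by lia.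
replace (S N + S k)%nat with (S (S N + k)) by lia.
replace (N + S k)%nat with (S N + k)%nat by lia.
assert (h1 := one_minus_pow_pos q (S N + k) H ltac:(lia)).
assert (h2 := one_minus_pow_pos q (S (S N + k)) H ltac:(lia)).
transitivity (gcoef q N k * (1 - q ^ S N) ^ 2 * (1 - q ^ (N - k)) / (1 - q ^ (S N + k))).
  field; lra.
rewrite IHk. field. split; lra.
Qed.

Lemma gterm_S q N k : Rabs q < 1 ->
  gterm q N (S k) * (1 - q ^ (N + S k)) = - gterm q N k * q ^ (2 * k + 1) * (1 - q ^ (N - k)).
Proof.
intros H. unfold gterm. cbn [gcoef].
assert (h2 := one_minus_pow_pos q (N + S k) H ltac:(lia)).
replace (S k * S k)%nat with (k * k + (2 * k + 1))%nat by lia.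
rewrite pow_add. change ((-1) ^ S k) with (-1 * (-1) ^ k). field. lra.
Qed.

(** The summand is [G k - G (k - 1)] for [G k = gterm q N k * q ^ (N + k) * (1 - q ^ (N - k))]; the
    last term is [G 0], up to sign. *)
Lemma gterm_telescope q N K : Rabs q < 1 -> (K <= N)%nat ->
  ssum (fun k => gterm q N k * (q ^ (N - k) + q ^ (N + k) - 2 * q ^ (2 * N))) K =
  gterm q N K * (q ^ (N + K) * (1 - q ^ (N - K))) - q ^ N * (1 - q ^ N).
Proof.
intros H. induction K as [|K IH]; intros HK.
  simpl ssum. unfold gterm; simpl gcoef. rewrite Nat.sub_0_r, Nat.add_0_r. simpl. ring.
rewrite ssum_S, IH by lia. generalize (gterm_S q N K H).
set (x := gterm q N (S K)). set (y := gterm q N K).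
replace (2 * N)%nat with ((N + S K) + (N - S K))%nat by lia.
replace (q ^ (N + K)) with (q ^ (2 * K + 1) * q ^ (N - S K)) by (rewrite <- pow_add; f_equal; lia).
rewrite (pow_add q (N + S K)).
set (A := q ^ (N + S K)). set (B := q ^ (N - S K)). set (C := q ^ (2 * K + 1)).
set (D := q ^ (N - K)). intros E.
transitivity (x * (B + A - 2 * (A * B)) - B * (- y * C * (1 - D)) - q ^ N * (1 - q ^ N)).
  ring.
rewrite <- E. ring.
Qed.

(** Let [M = N + 1]. The constant [1 - q^(2M)] is the factor summed in [gterm_telescope] plus
    [(1 - q^(M-k)) (1 - q^(M+k))], and by [gcoef_pred] the latter turns the sum for [M] into
    [(1 - q^M)^2] times the sum for [N]. *)
Lemma gauss_sum_S q N : Rabs q < 1 ->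
  (1 + q ^ S N) * gauss_sum q (S N) = (1 - q ^ S N) * gauss_sum q N.
Proof.
intros H.
assert (h := one_minus_pow_pos q (S N) H ltac:(lia)).
apply (Rmult_eq_reg_l (1 - q ^ S N)); [|lra].
assert (E0 : gterm q N (S N) = 0).
  unfold gterm. cbn [gcoef]. rewrite Nat.sub_diag. simpl. unfold Rdiv. ring.
assert (E : (1 - q ^ S N) ^ 2 * ssum (gterm q N) N =
  ssum (fun k => gterm q (S N) k * ((1 - q ^ (S N - k)) * (1 - q ^ (S N + k)))) (S N)).
  rewrite <- (Rplus_0_r (ssum _ N)), <- E0, <- ssum_S, <- ssum_scal.
  apply ssum_ext; intros k Hk. unfold gterm.
  rewrite Rmult_comm, Rmult_assoc, gcoef_pred by (trivial || lia). ring.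
assert (T := gterm_telescope q (S N) (S N) H ltac:(lia)).
rewrite Nat.sub_diag in T.
unfold gauss_sum.
assert (L : (1 - q ^ (2 * S N)) * ssum (gterm q (S N)) (S N) =
  ssum (fun k => gterm q (S N) k * (q ^ (S N - k) + q ^ (S N + k) - 2 * q ^ (2 * S N))) (S N)
  + (1 - q ^ S N) ^ 2 * ssum (gterm q N) N).
  rewrite E, <- ssum_plus, <- ssum_scal. apply ssum_ext; intros k Hk.
  replace (2 * S N)%nat with ((S N - k) + (S N + k))%nat by lia. rewrite pow_add. ring.
rewrite T in L. replace (2 * S N)%nat with (S N + S N)%nat in L by lia. rewrite pow_add in L.
set (x := q ^ S N) in *. rewrite pow_O in L. unfold pow in L. nra.
Qed.

Lemma oprod_pos q N : Rabs q < 1 -> 0 < oprod N q.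
Proof.
intros H; induction N as [|N IH]; [unfold oprod; simpl; lra|].
rewrite oprod_S. apply Rmult_lt_0_compat; trivial.
apply Rdiv_lt_0_compat; [apply one_plus_pow_pos|apply one_minus_pow_pos]; trivial; lia.
Qed.

Lemma gauss_sum_oprod q N : Rabs q < 1 -> gauss_sum q N = / oprod N q.
Proof.
intros H. induction N as [|N IH].
  unfold gauss_sum, oprod; simpl. field.
generalize (gauss_sum_S q N H) (oprod_pos q N H). rewrite IH, oprod_S.
assert (h1 := one_minus_pow_pos q (S N) H ltac:(lia)).
assert (h2 := one_plus_pow_pos q (S N) H ltac:(lia)).
intros E h. apply (Rmult_eq_reg_l (1 + q ^ S N)); [|lra]. rewrite E. field. repeat split; lra.
Qed.

Lemma ssum_sum_n f N : ssum f (S N) = sum_n (fun k => f (S k)) N.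
Proof.
induction N as [|N IH].
  rewrite sum_O. simpl. ring.
rewrite ssum_S, IH, sum_Sn. reflexivity.
Qed.

Lemma ssum_lim f l : is_series (fun k => f (S k)) l -> is_lim_seq (ssum f) l.
Proof.
intros H. apply is_lim_seq_incr_1. apply (is_lim_seq_ext (sum_n (fun k => f (S k)))); trivial.
intros n; symmetry; apply ssum_sum_n.
Qed.

Lemma ssum_incr f N M : (forall k, 0 <= f k) -> (N <= M)%nat -> ssum f N <= ssum f M.
Proof.
intros H HNM; induction HNM as [|M HNM IH]; [lra|]. rewrite ssum_S. generalize (H (S M)); lra.
Qed.

Lemma ssum_dist_le u l b N K : (forall k, Rabs (u k) <= b k) -> (forall k, Rabs (l k) <= b k) ->
  (K <= N)%nat ->
  Rabs (ssum u N - ssum l N) <=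
  ssum (fun k => Rabs (u k - l k)) K + 2 * (ssum b N - ssum b K).
Proof.
intros Hu Hl HK; induction HK as [|N HK IH].
  replace (ssum b K - ssum b K) with 0 by ring. rewrite Rmult_0_r, Rplus_0_r.
  induction K as [|K IH]; [simpl; rewrite Rminus_0_r, Rabs_R0; lra|].
  rewrite !ssum_S. eapply Rle_trans; [|apply Rplus_le_compat_r, IH].
  replace (_ - _) with ((ssum u K - ssum l K) + (u (S K) - l (S K))) by ring. apply Rabs_triang.
rewrite !ssum_S.
replace (_ - (ssum l N + _)) with ((ssum u N - ssum l N) + (u (S N) + - l (S N))) by ring.
eapply Rle_trans; [apply Rabs_triang|].
assert (h := Rabs_triang (u (S N)) (- l (S N))). rewrite Rabs_Ropp in h.
generalize (Hu (S N)) (Hl (S N)); lra.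
Qed.

Lemma ssum_lim_0 (v : nat -> nat -> R) K :
  (forall k, is_lim_seq (fun N => v N k) 0) -> is_lim_seq (fun N => ssum (v N) K) 0.
Proof.
intros H; induction K as [|K IH]; [apply is_lim_seq_const|].
replace (Finite 0) with (Rbar_plus 0 0) by (simpl; f_equal; ring).
apply is_lim_seq_plus'; trivial.
Qed.

(* Tannery's theorem. *)
Lemma ssum_dominated (u : nat -> nat -> R) (l b : nat -> R) :
  (forall N k, Rabs (u N k) <= b k) -> ex_series (fun k => b (S k)) ->
  (forall k, is_lim_seq (fun N => u N k) (l k)) ->
  is_lim_seq (fun N => ssum (u N) N) (Series (fun k => l (S k))).
Proof.
intros Hu [B HB] Hl. apply ssum_lim in HB.
assert (Hlb : forall k, Rabs (l k) <= b k).
  intros k. apply (is_lim_seq_le (fun N => Rabs (u N k)) (fun _ => b k) (Rabs (l k)) (b k)); trivial.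
    now apply (is_lim_seq_abs _ (l k)).
  apply is_lim_seq_const.
assert (Hb0 : forall k, 0 <= b k) by (intros k; eapply Rle_trans; [apply Rabs_pos|apply Hlb]).
assert (HL : is_lim_seq (ssum l) (Series (fun k => l (S k)))).
  apply ssum_lim, Series_correct. apply ex_series_Rabs.
  apply (ex_series_le (V := R_CompleteNormedModule) _ (fun k => b (S k))).
    intros n; unfold norm; simpl; unfold abs; simpl. rewrite Rabs_Rabsolu; apply Hlb.
  exists B. apply is_lim_seq_incr_1 in HB. apply is_lim_seq_ext with (2 := HB); intros n; apply ssum_sum_n.
assert (HD : is_lim_seq (fun N => ssum (u N) N - ssum l N) 0).
  apply is_lim_seq_spec; intros eps.
  assert (He : 0 < eps / 8) by (generalize (cond_pos eps); lra).
  apply is_lim_seq_spec in HB. destruct (HB (mkposreal _ He)) as [K HK]. simpl in HK.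
  assert (HV : is_lim_seq (fun N => ssum (fun k => Rabs (u N k - l k)) K) 0).
    apply ssum_lim_0; intros k. apply (proj1 (is_lim_seq_abs_0 _)).
    replace (Finite 0) with (Rbar_minus (l k) (l k)) by (simpl; f_equal; ring).
    apply is_lim_seq_minus'; [apply Hl|apply is_lim_seq_const].
  apply is_lim_seq_spec in HV. destruct (HV (mkposreal _ He)) as [M HM]. simpl in HM.
  exists (max K M). intros N HN. rewrite Rminus_0_r.
  eapply Rle_lt_trans; [apply (ssum_dist_le (u N) l b N K); auto; lia|].
  generalize (HM N ltac:(lia)) (HK K ltac:(lia)) (HK N ltac:(lia)). rewrite Rminus_0_r.
  intros h1 h2 h3. apply Rabs_def2 in h1, h2, h3. generalize (cond_pos eps); lra.
apply (is_lim_seq_ext (fun N => (ssum (u N) N - ssum l N) + ssum l N)); [intros; ring|].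
replace (Finite (Series _)) with (Rbar_plus 0 (Series (fun k => l (S k)))) by (simpl; f_equal; ring).
apply is_lim_seq_plus'; trivial.
Qed.

Definition thterm q k := (-1) ^ k * q ^ (k * k).
Definition theta4 q := 1 + 2 * Series (fun k => thterm q (S k)).

(** The bound has to be uniform in [N] and [k] for Tannery's theorem. With [y = r ^ (N - j)], the
    factor of index [j] is at most [(1 + y) / (1 - y) <= exp (2 * y / (1 - r))], and these exponents
    form a geometric sum. *)
Lemma gcoef_le q N k : Rabs q < 1 -> Rabs (gcoef q N k) <= exp (2 / (1 - Rabs q) ^ 2).
Proof.
intros H. set (r := Rabs q) in *. assert (Hr : 0 <= r) by apply Rabs_pos.
assert (Hpow : forall i, 0 <= r ^ i) by (intros; now apply pow_le).
destruct (le_lt_dec k N) as [Hk|Hk].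
  assert (A : Rabs (gcoef q N k) <= exp (2 / (1 - r) * ((r ^ (N - k) - r ^ N) * (r / (1 - r))))).
    induction k as [|k IH].
      simpl. rewrite Nat.sub_0_r. replace (r ^ N - r ^ N) with 0 by ring. rewrite Rmult_0_l, Rmult_0_r, exp_0, Rabs_R1; lra.
    cbn [gcoef]. rewrite Rabs_mult.
    replace (2 / (1 - r) * ((r ^ (N - S k) - r ^ N) * (r / (1 - r)))) with
      (2 / (1 - r) * ((r ^ (N - k) - r ^ N) * (r / (1 - r))) + 2 / (1 - r) * r ^ (N - k)).
      2:{ replace (N - k)%nat with (S (N - S k)) by lia. simpl. field. lra. }
    rewrite exp_plus. apply Rmult_le_compat; try apply Rabs_pos; [apply IH; lia|].
    unfold Rdiv at 1. rewrite Rabs_mult, Rabs_inv.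
    assert (h1 := one_minus_pow_pos q (N + S k) H ltac:(lia)). rewrite (Rabs_right (1 - q ^ (N + S k))) by lra.
    assert (h2 : r ^ (N + S k) <= r ^ (N - k)).
      apply pow_decr; [lra|lia].
    assert (h3 : q ^ (N + S k) <= r ^ (N - k)).
      eapply Rle_trans; [apply Rle_abs|]. now rewrite <- RPow_abs.
    assert (h4 : Rabs (1 - q ^ (N - k)) <= 1 + r ^ (N - k)).
      eapply Rle_trans; [apply Rabs_triang|]. rewrite Rabs_Ropp, Rabs_R1, <- RPow_abs. apply Rle_refl.
    set (y := r ^ (N - k)) in *.
    assert (Hy : 0 <= y <= r).
      split; [apply Hpow|]. rewrite <- (pow_1 r). apply pow_decr; [lra|lia].
    apply Rle_trans with ((1 + y) * / (1 - y)).
      apply Rmult_le_compat; trivial; [apply Rabs_pos|apply Rlt_le, Rinv_0_lt_compat; trivial|].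
      apply Rinv_le_contravar; lra.
    apply Rle_trans with (1 + 2 / (1 - r) * y); [|apply exp_ineq1_le].
    apply (Rmult_le_reg_r (1 - y)); [lra|]. rewrite Rmult_assoc, Rinv_l by lra.
    assert (h5 : 0 <= y * (r - y) / (1 - r)) by (apply Rdiv_le_0_compat; nra).
    replace ((1 + 2 / (1 - r) * y) * (1 - y)) with (1 + y + 2 * (y * (r - y) / (1 - r))) by (field; lra).
    lra.
  eapply Rle_trans; [exact A|]. apply exp_mono.
  replace (2 / (1 - r) ^ 2) with (2 / (1 - r) * (1 * (1 / (1 - r)))) by (field; lra).
  apply Rmult_le_compat_l; [apply Rdiv_le_0_compat; lra|].
  assert (h : 0 <= r ^ N <= r ^ (N - k)).
    split; [apply Hpow|apply pow_decr; [lra|lia]].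
  assert (h' : r ^ (N - k) <= 1) by (apply (pow_decr r 0); [lra|lia]).
  apply Rmult_le_compat; try lra.
    apply Rdiv_le_0_compat; lra.
  apply Rmult_le_compat_r; [apply Rlt_le, Rinv_0_lt_compat; lra|lra].
replace (gcoef q N k) with 0.
  rewrite Rabs_R0. apply Rlt_le, exp_pos.
symmetry. induction Hk as [|k Hk IH]; cbn [gcoef].
  rewrite Nat.sub_diag. simpl. unfold Rdiv. ring.
rewrite IH. ring.
Qed.

Lemma gcoef_lim q k : Rabs q < 1 -> is_lim_seq (fun N => gcoef q N k) 1.
Proof.
intros H.
assert (P0 : is_lim_seq (fun N => q ^ N) 0) by now apply is_lim_seq_geom.
induction k as [|k IH]; cbn [gcoef]; [apply is_lim_seq_const|].
replace (Finite 1) with (Rbar_mult 1 (Rbar_div (1 - 0) (1 - 0))).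
  2:{ simpl. f_equal. field. }
apply is_lim_seq_mult'; trivial.
apply is_lim_seq_div'; [| |lra].
  apply is_lim_seq_minus'; [apply is_lim_seq_const|].
  apply (is_lim_seq_incr_n _ k). apply is_lim_seq_ext with (2 := P0). intros n; f_equal; lia.
apply is_lim_seq_minus'; [apply is_lim_seq_const|].
apply (is_lim_seq_incr_n (fun n => q ^ n) (S k)) in P0. exact P0.
Qed.

Lemma ex_series_pow_sq r : 0 <= r < 1 -> ex_series (fun k => r ^ (S k * S k)).
Proof.
intros H. apply (ex_series_le (V := R_CompleteNormedModule) _ (fun k => r ^ k)).
  intros n; unfold norm; simpl norm; unfold abs; simpl abs.
  rewrite Rabs_right by (apply Rle_ge, pow_le; lra).
  apply pow_decr; [lra|nia].
apply ex_series_geom. rewrite Rabs_right; lra.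
Qed.

Lemma Rabs_thterm q k : Rabs (thterm q k) = Rabs q ^ (k * k).
Proof.
unfold thterm. rewrite Rabs_mult, pow_1_abs, <- RPow_abs. apply Rmult_1_l.
Qed.

Lemma ex_series_thterm q : Rabs q < 1 -> ex_series (fun k => thterm q (S k)).
Proof.
intros H. apply ex_series_Rabs. apply (ex_series_ext (fun k => Rabs q ^ (S k * S k))).
  intros n; symmetry; apply Rabs_thterm.
apply ex_series_pow_sq. split; trivial; apply Rabs_pos.
Qed.

(* Gauss: [theta4 q] is the product of the [(1 - q^i) / (1 + q^i)]. *)
Lemma oprod_lim q : Rabs q < 1 -> is_lim_seq (fun N => / oprod N q) (theta4 q).
Proof.
intros H. apply (is_lim_seq_ext (fun N => 1 + 2 * ssum (gterm q N) N)).
  intros N. now apply gauss_sum_oprod.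
unfold theta4. apply is_lim_seq_plus'; [apply is_lim_seq_const|].
apply (is_lim_seq_mult' _ _ 2); [apply is_lim_seq_const|].
set (C := exp (2 / (1 - Rabs q) ^ 2)).
apply (ssum_dominated (fun N k => gterm q N k) (thterm q) (fun k => Rabs q ^ (k * k) * C)).
- intros N k. unfold gterm. rewrite Rabs_mult. fold (thterm q k). rewrite Rabs_thterm.
  apply Rmult_le_compat_l; [apply pow_le, Rabs_pos|]. now apply gcoef_le.
- apply ex_series_scal_r. apply ex_series_pow_sq. split; trivial; apply Rabs_pos.
- intros k. unfold gterm. fold (thterm q k).
  replace (Finite (thterm q k)) with (Rbar_mult (thterm q k) 1) by (simpl; f_equal; ring).
  apply (is_lim_seq_mult' _ _ (thterm q k) 1); [apply is_lim_seq_const|]. now apply gcoef_lim.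
Qed.

(** * The Gaussian integral *)

Definition gint (x : R) := RInt (fun t => exp (- (t * t))) 0 x.
(** The classical companion of [gint]: [gint ^ 2 + gaux] has derivative 0 and is [atan 1] at 0.
    Since [gaux] decays like [exp (- x ^ 2)], the Gaussian integral comes with an explicit
    truncation error. *)
Definition gaux (x : R) := RInt (fun t => exp (- (x * x) * (1 + t * t)) / (1 + t * t)) 0 1.

Lemma cont_gauss t : continuous (fun t => exp (- (t * t))) t.
Proof. apply (ex_derive_continuous (fun t => exp (- (t * t)))). auto_derive; trivial. Qed.

Lemma ex_RInt_gauss u v : ex_RInt (fun t => exp (- (t * t))) u v.
Proof. apply (ex_RInt_continuous (V := R_CompleteNormedModule)); intros; apply cont_gauss. Qed.

Lemma is_derive_gint x : is_derive gint x (exp (- (x * x))).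
Proof.
apply (is_derive_RInt (fun t => exp (- (t * t))) gint 0 x).
  apply filter_forall; intros y. apply (RInt_correct (V := R_CompleteNormedModule) (fun t => exp (- (t * t))) 0 y), ex_RInt_gauss.
apply cont_gauss.
Qed.

Lemma ex_RInt_gaux x u v : ex_RInt (fun t => exp (- (x * x) * (1 + t * t)) / (1 + t * t)) u v.
Proof.
apply ex_RInt_ex_derive; intros t. auto_derive. nra.
Qed.

Lemma gaux_scal x : x * RInt (fun t => exp (- (x * x) * (t * t))) 0 1 = gint x.
Proof.
assert (E := RInt_comp_lin (fun t => exp (- (t * t))) x 0 0 1).
rewrite Rmult_0_r, Rmult_1_r, !Rplus_0_r in E. unfold gint. rewrite <- E by apply ex_RInt_gauss.
rewrite (RInt_scal (V := R_CompleteNormedModule)).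
  unfold scal; simpl; unfold mult; simpl. f_equal. apply RInt_ext; intros t _. f_equal. ring.
apply ex_RInt_ex_derive; intros t. auto_derive; trivial.
Qed.

Lemma is_derive_gaux x : is_derive gaux x (- 2 * exp (- (x * x)) * gint x).
Proof.
assert (D : forall u t, is_derive (fun z => exp (- (z * z) * (1 + t * t)) / (1 + t * t)) u
    (- 2 * u * exp (- (u * u) * (1 + t * t)))).
  intros u t. auto_derive; [nra|]. field. nra.
replace (- 2 * exp (- (x * x)) * gint x) with
  (RInt (fun t => Derive (fun u => exp (- (u * u) * (1 + t * t)) / (1 + t * t)) x) 0 1).
  apply (is_derive_RInt_param (fun u t => exp (- (u * u) * (1 + t * t)) / (1 + t * t))).
  - apply filter_forall; intros u t _. eexists; apply D.
  - intros t _.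
    apply (continuity_2d_pt_ext (fun u v => (- 2 * u) * exp ((- (u * u)) * (1 + v * v)))).
      intros u v. symmetry. apply is_derive_unique, D.
    apply continuity_2d_pt_mult.
      apply (continuity_1d_2d_pt_comp (fun u => - 2 * u)); [|apply continuity_2d_pt_id1].
      apply derivable_continuous_pt; reg.
    apply (continuity_1d_2d_pt_comp exp).
      apply derivable_continuous_pt, derivable_pt_exp.
    apply continuity_2d_pt_mult.
      apply (continuity_1d_2d_pt_comp (fun u => - (u * u))); [|apply continuity_2d_pt_id1].
      apply derivable_continuous_pt; reg.
    apply (continuity_1d_2d_pt_comp (fun u => 1 + u * u)); [|apply continuity_2d_pt_id2].
    apply derivable_continuous_pt; reg.
  - apply filter_forall; intros y. apply ex_RInt_gaux.
rewrite <- gaux_scal.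
rewrite (RInt_ext _ (fun t => (- 2 * exp (- (x * x)) * x) * exp (- (x * x) * (t * t)))).
  rewrite (RInt_scal (V := R_CompleteNormedModule)).
    unfold scal; simpl; unfold mult; simpl. ring.
  apply ex_RInt_ex_derive; intros t. auto_derive; trivial.
intros t _. etransitivity; [apply is_derive_unique, D|].
replace (- (x * x) * (1 + t * t)) with (- (x * x) + - (x * x) * (t * t)) by ring.
(* The equation is typed in the carrier of a Coquelicot structure; [ring] needs it in [R]. *)
rewrite exp_plus. match goal with |- ?a = ?b => change (a = b :> R) end. ring.
Qed.

Lemma gint_sq x : 0 <= x -> gint x ^ 2 + gaux x = PI / 4.
Proof.
intros Hx.
assert (E0 : gint 0 ^ 2 + gaux 0 = PI / 4).
  unfold gint. rewrite RInt_point. unfold zero; simpl.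
  unfold gaux. rewrite (is_RInt_unique _ 0 1 (minus (atan 1) (atan 0))).
    rewrite atan_1, atan_0. unfold minus, plus, opp; simpl. field.
  apply (is_RInt_ext (fun t => / (1 + t²))).
    intros t _. rewrite Rmult_0_l, Ropp_0, Rmult_0_l, exp_0. unfold Rsqr. match goal with |- ?a = ?b => change (a = b :> R) end. field. nra.
  apply (is_RInt_derive atan).
    intros t _; apply is_derive_atan.
  intros t _. apply (ex_derive_continuous (fun t => / (1 + t²))). unfold Rsqr; auto_derive. nra.
destruct Hx as [Hx| <-]; trivial.
rewrite <- E0. symmetry. apply (eq_is_derive (fun x => gint x ^ 2 + gaux x)); trivial.
intros t _. unfold zero; simpl.
replace 0 with (2 * exp (- (t * t)) * gint t ^ 1 + - 2 * exp (- (t * t)) * gint t) by ring.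
apply (is_derive_plus (fun x => gint x ^ 2)); [|apply is_derive_gaux].
apply (is_derive_pow gint 2). apply is_derive_gint.
Qed.

Lemma gaux_bound x : 0 <= gaux x <= exp (- (x * x)) * (PI / 4).
Proof.
split.
  apply RInt_ge_0; [lra|apply ex_RInt_gaux|]. intros t _.
  apply Rdiv_le_0_compat; [apply Rlt_le, exp_pos|nra].
assert (E : is_RInt (fun t => / (1 + t²)) 0 1 (PI / 4)).
  replace (PI / 4) with (minus (atan 1) (atan 0)).
    2:{ rewrite atan_1, atan_0. unfold minus, plus, opp; simpl. ring. }
  apply (is_RInt_derive atan).
    intros t _; apply is_derive_atan.
  intros t _. apply (ex_derive_continuous (fun t => / (1 + t²))). unfold Rsqr; auto_derive. nra.
rewrite <- (is_RInt_unique _ _ _ _ E).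
rewrite <- (RInt_scal (V := R_CompleteNormedModule)) by (eexists; apply E).
apply RInt_le; [lra|apply ex_RInt_gaux| |].
  apply (ex_RInt_scal (V := R_NormedModule)). eexists; apply E.
intros t _. unfold scal; simpl; unfold mult; simpl. unfold Rdiv, Rsqr.
apply Rmult_le_compat_r; [apply Rlt_le, Rinv_0_lt_compat; nra|].
destruct (Req_dec (x * t) 0) as [E0|E0].
  replace (- (x * x) * (1 + t * t)) with (- (x * x) - (x * t) * (x * t)) by ring. rewrite E0.
  apply Req_le; f_equal; ring.
apply Rlt_le, exp_increasing. nra.
Qed.

Lemma gint_bounds x : 0 <= x -> sqrt PI / 2 * (1 - exp (- (x * x))) <= gint x <= sqrt PI / 2.
Proof.
intros Hx. generalize (gint_sq x Hx) (gaux_bound x) PI_RGT_0; intros E [B1 B2] HP.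
assert (G0 : 0 <= gint x).
  apply RInt_ge_0; trivial; [apply ex_RInt_gauss|]. intros; apply Rlt_le, exp_pos.
assert (S := sqrt_sqrt PI ltac:(lra)). assert (S0 := sqrt_lt_R0 PI HP).
assert (e1 : exp (- (x * x)) <= 1).
  rewrite <- exp_0. destruct (Req_dec x 0) as [->|]; [apply Req_le; f_equal; ring|].
  apply Rlt_le, exp_increasing. nra.
generalize (exp_pos (- (x * x))); intros e0. set (e := exp _) in *.
split.
  apply Rsqr_incr_0_var; trivial. unfold Rsqr.
  replace (sqrt PI / 2 * (1 - e) * (sqrt PI / 2 * (1 - e))) with (PI / 4 * (1 - e) ^ 2) by (rewrite <- S at 1; field).
  nra.
apply Rsqr_incr_0_var; [|lra]. unfold Rsqr.
replace (sqrt PI / 2 * (sqrt PI / 2)) with (PI / 4) by (rewrite <- S at 1; field). nra.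
Qed.

(** * The Basel sum over odd integers *)

Lemma ssum_first f N : ssum f (S N) = f 1%nat + ssum (fun k => f (S k)) N.
Proof. induction N as [|N IH]; [simpl; ring|]. rewrite ssum_S, IH, ssum_S. ring. Qed.

Lemma ssum_rev f N : ssum f N = ssum (fun k => f (S N - k)%nat) N.
Proof.
induction N as [|N IH]; trivial.
rewrite (ssum_first (fun k => f (S (S N) - k)%nat)), ssum_S, IH, Rplus_comm.
f_equal.
Qed.

Lemma ssum_app f N M : ssum f (N + M) = ssum f N + ssum (fun k => f (N + k)%nat) M.
Proof.
induction M as [|M IH]; [rewrite Nat.add_0_r; simpl; ring|].
rewrite Nat.add_succ_r, !ssum_S, IH, Nat.add_succ_r. ring.
Qed.

Lemma ssum_double f M : ssum f (2 * M) = ssum (fun k => f k + f (2 * M + 1 - k)%nat) M.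
Proof.
replace (2 * M)%nat with (M + M)%nat by lia. rewrite ssum_app, ssum_plus. f_equal.
rewrite ssum_rev. apply ssum_ext; intros k Hk. f_equal. lia.
Qed.

(** Divide [s^2 + c^2 = 1] by [s^2 c^2]. The cosine is written as the sine of the complementary
    angle so that the identity can be iterated. *)
Lemma inv_sin_sq_half x : sin x <> 0 ->
  / sin x ^ 2 = / 4 * (/ sin (x / 2) ^ 2 + / sin (PI / 2 - x / 2) ^ 2).
Proof.
intros H. rewrite sin_shift.
assert (E : sin x = 2 * sin (x / 2) * cos (x / 2)) by (rewrite <- sin_2a; f_equal; field).
generalize (sin2_cos2 (x / 2)). unfold Rsqr. rewrite E in *. intros E2.
set (s := sin _) in *. set (c := cos _) in *.
assert (s <> 0) by (intros Z; apply H; rewrite Z; ring).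
assert (c <> 0) by (intros Z; apply H; rewrite Z; ring).
replace (/ 4 * (/ s ^ 2 + / c ^ 2)) with (/ 4 * ((s * s + c * c) / (s ^ 2 * c ^ 2))) by (field; auto).
rewrite E2. field. auto.
Qed.

(* The angles [(2 k - 1) pi / 2^(n+2)], [1 <= k <= 2^n], are those obtained from
   [pi / 4] by [n] steps [x |-> x / 2, pi / 2 - x / 2]. *)
Definition angle (n k : nat) := (2 * INR k - 1) * PI / (4 * 2 ^ n).

Lemma angle_range n k : (1 <= k <= 2 ^ n)%nat -> 0 < angle n k < PI / 2.
Proof.
intros [H1 H2]. apply le_INR in H1, H2. rewrite pow_INR in H2. simpl in H1. change (INR 2) with 2 in H2.
generalize PI_RGT_0 (pow_lt 2 n ltac:(lra)); intros HP Hp. unfold angle. split.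
  apply Rdiv_lt_0_compat; nra.
apply (Rmult_lt_reg_r (4 * 2 ^ n)); [lra|].
replace ((2 * INR k - 1) * PI / (4 * 2 ^ n) * (4 * 2 ^ n)) with ((2 * INR k - 1) * PI) by (field; lra).
nra.
Qed.

(** Starts from [/ sin (PI / 4) ^ 2 = 2]; each halving step multiplies the sum by 4. The two angles
    coming from angle [k] are numbers [k] and [2 * 2 ^ n + 1 - k] of the next level. *)
Lemma sum_inv_sin_sq n : ssum (fun k => / sin (angle n k) ^ 2) (2 ^ n) = 2 * 4 ^ n.
Proof.
induction n as [|n IH].
  simpl ssum. unfold angle. simpl.
  replace ((2 * 1 - 1) * PI / (4 * 1)) with (PI / 4) by field. rewrite sin_PI4.
  assert (S := sqrt_sqrt 2 ltac:(lra)). assert (0 < sqrt 2) by (apply sqrt_lt_R0; lra).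
  replace (1 / sqrt 2 * (1 / sqrt 2 * 1)) with (/ (sqrt 2 * sqrt 2)) by (field; lra).
  rewrite S. field.
replace (2 ^ S n)%nat with (2 * 2 ^ n)%nat by reflexivity. rewrite ssum_double.
rewrite <- tech_pow_Rmult. transitivity (4 * (2 * 4 ^ n)); [|ring].
rewrite <- IH, <- ssum_scal. apply ssum_ext; intros k Hk.
destruct (angle_range n k Hk) as [h1 h2]. generalize PI_RGT_0; intros HP.
assert (hs : 0 < sin (angle n k)) by (apply sin_gt_0; lra).
rewrite (inv_sin_sq_half (angle n k)) by lra.
generalize (pow_lt 2 n ltac:(lra)); intros Hp.
replace (angle n k / 2) with (angle (S n) k)
  by (unfold angle; change (2 ^ S n) with (2 * 2 ^ n); field; lra).
replace (angle (S n) (2 * 2 ^ n + 1 - k)) with (PI / 2 - angle (S n) k).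
  field. split.
    rewrite sin_shift.
    destruct (angle_range (S n) k) as [h3 h4]; [simpl; lia|]. apply Rgt_not_eq, cos_gt_0; lra.
  destruct (angle_range (S n) k) as [h3 h4]; [simpl; lia|]. apply Rgt_not_eq, sin_gt_0; lra.
unfold angle. rewrite minus_INR, plus_INR, mult_INR, pow_INR by lia.
change (2 ^ S n) with (2 * 2 ^ n). change (INR 2) with 2. change (INR 1) with 1. field. lra.
Qed.

(** From [sin x <= x <= tan x], because [/ sin x ^ 2 - 1 = / tan x ^ 2]. *)
Lemma inv_sin_sq_bounds x : 0 < x < PI / 2 -> / x ^ 2 <= / sin x ^ 2 <= / x ^ 2 + 1.
Proof.
intros [H0 H1]. assert (hs : 0 < sin x) by (apply sin_gt_0; lra).
assert (hc : 0 < cos x) by (apply cos_gt_0; lra).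
assert (h1 : sin x < x) by now apply sin_lt_x.
assert (h3 : x * cos x <= sin x).
  enough (sin 0 - 0 * cos 0 <= sin x - x * cos x) by (rewrite sin_0 in *; lra).
  apply (derive_nonneg_le (fun x => sin x - x * cos x) (fun x => x * sin x)); [lra| |].
    intros y _. auto_derive; trivial. ring.
  intros y Hy. apply Rmult_le_pos; [lra|]. apply sin_ge_0; lra.
split.
  apply Rinv_le_contravar; nra.
generalize (sin2_cos2 x); unfold Rsqr; intros E.
apply (Rmult_le_reg_r (sin x ^ 2 * x ^ 2)); [apply Rmult_lt_0_compat; nra|].
replace (/ sin x ^ 2 * (sin x ^ 2 * x ^ 2)) with (x ^ 2) by (field; lra).
replace ((/ x ^ 2 + 1) * (sin x ^ 2 * x ^ 2)) with (sin x ^ 2 * (1 + x ^ 2)) by (field; lra).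
assert ((x * cos x) ^ 2 <= sin x ^ 2) by (apply pow_incr; nra).
nra.
Qed.

Definition odd_inv_sq (k : nat) := / (2 * INR k - 1) ^ 2.

Lemma odd_inv_sq_pos k : 0 <= odd_inv_sq k.
Proof.
unfold odd_inv_sq. assert (2 * INR k - 1 <> 0).
  destruct k as [|k]; [simpl; lra|]. rewrite S_INR. generalize (pos_INR k); lra.
apply Rlt_le, Rinv_0_lt_compat. nra.
Qed.

(** The angles are odd multiples of one angle, so the sum of their inverse squares is the odd Basel
    sum up to a factor. It differs from [sum_inv_sin_sq], which is [2 * 4 ^ n], by at most 1 per
    term, that is by [2 ^ n]. *)
Lemma basel_odd_pow2 n :
  ssum odd_inv_sq (2 ^ n) <= PI ^ 2 / 8 <= ssum odd_inv_sq (2 ^ n) + PI ^ 2 / 16 / 2 ^ n.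
Proof.
generalize PI_RGT_0 (pow_lt 2 n ltac:(lra)); intros HP Hp.
assert (E4 : 4 ^ n = 2 ^ n * 2 ^ n) by (rewrite <- Rpow_mult_distr; f_equal; ring).
assert (E : forall k, (1 <= k <= 2 ^ n)%nat -> odd_inv_sq k = PI ^ 2 / (16 * 4 ^ n) * / angle n k ^ 2).
  intros k Hk. unfold odd_inv_sq, angle. rewrite E4. field.
  destruct Hk as [Hk _]. apply le_INR in Hk. simpl in Hk. repeat split; lra.
rewrite (ssum_ext _ _ _ E), ssum_scal.
assert (S1 : ssum (fun k => / angle n k ^ 2) (2 ^ n) <= 2 * 4 ^ n).
  rewrite <- sum_inv_sin_sq. apply ssum_le; intros k Hk. apply inv_sin_sq_bounds, angle_range, Hk.
assert (S2 : 2 * 4 ^ n <= ssum (fun k => / angle n k ^ 2) (2 ^ n) + 2 ^ n).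
  rewrite <- sum_inv_sin_sq.
  apply Rle_trans with (ssum (fun k => / angle n k ^ 2 + 1) (2 ^ n)).
    apply ssum_le; intros k Hk. apply inv_sin_sq_bounds, angle_range, Hk.
  rewrite ssum_plus. apply Rplus_le_compat_l.
  replace (2 ^ n) with (INR (2 ^ n)) by (rewrite pow_INR; reflexivity).
  generalize (2 ^ n)%nat; intros m; induction m as [|m IH]; [simpl; lra|]. rewrite ssum_S, S_INR; lra.
set (T := ssum _ _) in *.
assert (h4 : 0 < 4 ^ n) by (rewrite E4; nra).
split.
  replace (PI ^ 2 / 8) with (PI ^ 2 / (16 * 4 ^ n) * (2 * 4 ^ n)) by (field; lra).
  apply Rmult_le_compat_l; trivial. apply Rdiv_le_0_compat; nra.
replace (PI ^ 2 / 8) with (PI ^ 2 / (16 * 4 ^ n) * (2 * 4 ^ n)) by (field; lra).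
replace (PI ^ 2 / 16 / 2 ^ n) with (PI ^ 2 / (16 * 4 ^ n) * 2 ^ n) by (rewrite E4; field; lra).
rewrite <- Rmult_plus_distr_l.
apply Rmult_le_compat_l; trivial. apply Rdiv_le_0_compat; nra.
Qed.

Lemma basel_odd_le N : ssum odd_inv_sq N <= PI ^ 2 / 8.
Proof.
eapply Rle_trans; [|apply (basel_odd_pow2 N)].
apply ssum_incr; [apply odd_inv_sq_pos|]. apply Nat.lt_le_incl, Nat.pow_gt_lin_r; lia.
Qed.

Lemma basel_odd_ge eps : 0 < eps -> exists N, PI ^ 2 / 8 - eps <= ssum odd_inv_sq N.
Proof.
intros He.
assert (L : is_lim_seq (fun n => PI ^ 2 / 16 / 2 ^ n) 0).
  apply (is_lim_seq_ext (fun n => PI ^ 2 / 16 * (/ 2) ^ n)).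
    intros n. rewrite pow_inv. reflexivity.
  replace (Finite 0) with (Rbar_mult (PI ^ 2 / 16) 0) by (simpl; f_equal; ring).
  apply is_lim_seq_scal_l. apply is_lim_seq_geom. rewrite Rabs_right; lra.
apply is_lim_seq_spec in L. destruct (L (mkposreal eps He)) as [n Hn].
specialize (Hn n (Nat.le_refl n)). simpl in Hn. rewrite Rminus_0_r in Hn. apply Rabs_def2 in Hn.
exists (2 ^ n)%nat. generalize (basel_odd_pow2 n); simpl in *; lra.
Qed.

(** * The logarithm of the generating function on the positive axis *)

Lemma is_lim_seq_even (u : nat -> R) l : is_lim_seq u l -> is_lim_seq (fun n => u (2 * n)%nat) l.
Proof.
intros H. apply (is_lim_seq_subseq u l (fun n => (2 * n)%nat)); trivial.
apply eventually_subseq. intros n; lia.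
Qed.

Lemma is_lim_seq_inj (u : nat -> R) (l1 l2 : R) : is_lim_seq u l1 -> is_lim_seq u l2 -> l1 = l2.
Proof.
intros H1 H2. apply is_lim_seq_unique in H1, H2. rewrite H1 in H2. now injection H2.
Qed.

(** This is [theta4 q * theta3 q = theta4 (q^2) ^ 2]. On the product side the factors of odd index
    at [q] and [- q] cancel, and those of even index coincide. *)
Lemma theta4_mul q : Rabs q < 1 -> theta4 q * theta4 (- q) = theta4 (q ^ 2) ^ 2.
Proof.
intros H. assert (H' : Rabs (- q) < 1) by now rewrite Rabs_Ropp.
assert (H2 : Rabs (q ^ 2) < 1) by (apply pow_lt1; trivial; lia).
assert (E : forall N, oprod (2 * N) q * oprod (2 * N) (- q) = oprod N (q ^ 2) ^ 2).
  induction N as [|N IH]; [unfold oprod; simpl; ring|].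
  replace (2 * S N)%nat with (S (S (2 * N))) by lia.
  rewrite !oprod_S.
  assert (e1 : (- q) ^ S (2 * N) = - q ^ S (2 * N)).
    simpl. rewrite !(Nat.add_0_r N). replace (N + N)%nat with (2 * N)%nat by lia. rewrite !pow_mult. replace ((- q) ^ 2) with (q ^ 2) by ring. ring.
  assert (e2 : (- q) ^ S (S (2 * N)) = q ^ S (S (2 * N))).
    replace (S (S (2 * N))) with (2 * S N)%nat by lia. rewrite !pow_mult. f_equal; ring.
  rewrite e1, e2. replace ((q ^ 2) ^ S N) with (q ^ S (S (2 * N))).
    2:{ rewrite <- pow_mult; f_equal; lia. }
  assert (h1 := one_minus_pow_pos q (S (2 * N)) H ltac:(lia)).
  assert (h2 := one_plus_pow_pos q (S (2 * N)) H ltac:(lia)).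
  assert (h3 := one_minus_pow_pos q (S (S (2 * N))) H ltac:(lia)).
  transitivity (oprod (2 * N) q * oprod (2 * N) (- q) * ((1 + q ^ S (S (2 * N))) / (1 - q ^ S (S (2 * N)))) ^ 2).
    field. repeat split; lra.
  rewrite IH. ring.
apply (is_lim_seq_inj (fun N => / oprod (2 * N) q * / oprod (2 * N) (- q))).
  apply is_lim_seq_mult'.
    apply (is_lim_seq_even (fun N => / oprod N q)). now apply oprod_lim.
  apply (is_lim_seq_even (fun N => / oprod N (- q))). now apply oprod_lim.
apply (is_lim_seq_ext (fun N => / oprod N (q ^ 2) * / oprod N (q ^ 2))).
  intros N. rewrite <- Rinv_mult. rewrite <- Rinv_mult. f_equal. rewrite E. simpl; ring.
replace (theta4 (q ^ 2) ^ 2) with (theta4 (q ^ 2) * theta4 (q ^ 2)) by ring.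
apply is_lim_seq_mult'; now apply oprod_lim.
Qed.

Lemma theta4_lim q : Rabs q < 1 -> is_lim_seq (fun N => 1 + 2 * ssum (thterm q) N) (theta4 q).
Proof.
intros H. apply is_lim_seq_plus'; [apply is_lim_seq_const|].
apply (is_lim_seq_mult' _ _ 2); [apply is_lim_seq_const|].
apply ssum_lim, Series_correct, ex_series_thterm, H.
Qed.

(** This is [theta3 q + theta4 q = 2 * theta3 (q^4)]: the terms of odd [k] cancel and those of even
    [k] double. *)
Lemma theta4_split q : Rabs q < 1 -> theta4 (- q) + theta4 q = 2 * theta4 (- q ^ 4).
Proof.
intros H. assert (H' : Rabs (- q) < 1) by now rewrite Rabs_Ropp.
assert (H4 : Rabs (- q ^ 4) < 1) by (rewrite Rabs_Ropp; apply pow_lt1; trivial; lia).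
assert (m1 : forall k, (-1) ^ k * (-1) ^ (k * k) = 1).
  intros k. rewrite <- pow_add. destruct (Nat.Even_or_Odd k) as [[j ->]|[j ->]].
    replace (2 * j + 2 * j * (2 * j))%nat with (2 * (j + 2 * j * j))%nat by ring. apply pow_1_even.
  replace (2 * j + 1 + (2 * j + 1) * (2 * j + 1))%nat with (2 * (1 + 3 * j + 2 * j * j))%nat by ring. apply pow_1_even.
assert (T : forall x k, thterm (- x) k = x ^ (k * k)).
  intros x k; unfold thterm. replace (- x) with (-1 * x) by ring.
  rewrite Rpow_mult_distr, <- Rmult_assoc, m1. ring.
assert (E : forall N, ssum (thterm (- q)) (2 * N) + ssum (thterm q) (2 * N) = 2 * ssum (thterm (- q ^ 4)) N).
  induction N as [|N IH]; [simpl; ring|].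
  replace (2 * S N)%nat with (S (S (2 * N))) by lia.
  rewrite !ssum_S, Rmult_plus_distr_l, <- IH, !T. unfold thterm.
  replace ((-1) ^ S (S (2 * N))) with 1.
    2:{ replace (S (S (2 * N))) with (2 * S N)%nat by lia. now rewrite pow_1_even. }
  replace ((-1) ^ S (2 * N)) with (-1) by now rewrite pow_1_odd.
  replace ((q ^ 4) ^ (S N * S N)) with (q ^ (S (S (2 * N)) * S (S (2 * N)))).
    2:{ rewrite <- pow_mult. f_equal. lia. }
  ring.
apply (is_lim_seq_inj (fun N => (1 + 2 * ssum (thterm (- q)) (2 * N)) + (1 + 2 * ssum (thterm q) (2 * N)))).
  apply is_lim_seq_plus'.
    apply (is_lim_seq_even (fun N => 1 + 2 * ssum (thterm (- q)) N)). now apply theta4_lim.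
  apply (is_lim_seq_even (fun N => 1 + 2 * ssum (thterm q) N)). now apply theta4_lim.
apply (is_lim_seq_ext (fun N => 2 * (1 + 2 * ssum (thterm (- q ^ 4)) N))).
  intros N. generalize (E N); lra.
apply (is_lim_seq_mult' _ _ 2); [apply is_lim_seq_const|now apply theta4_lim].
Qed.

(** The function [ln (coth (x / 2))], the logarithm of one factor of the product. *)
Definition lcoth (x : R) := ln ((1 + exp (- x)) / (1 - exp (- x))).
Definition LamN (N : nat) (a : R) := ssum (fun m => lcoth (INR m * a)) N.
Definition Lam (a : R) := - ln (theta4 (exp (- a))).

Lemma exp_neg_lt1 x : 0 < x -> 0 < exp (- x) < 1.
Proof. intros H. split; [apply exp_pos|]. rewrite <- exp_0. apply exp_increasing; lra. Qed.

Lemma exp_neg_abs x : 0 < x -> Rabs (exp (- x)) < 1.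
Proof. intros H. destruct (exp_neg_lt1 x H). rewrite Rabs_right; lra. Qed.

Lemma LamN_oprod N a : 0 < a -> LamN N a = ln (oprod N (exp (- a))).
Proof.
intros H. induction N as [|N IH]; [unfold LamN, oprod; simpl; now rewrite ln_1|].
unfold LamN in *. rewrite ssum_S, IH, oprod_S.
rewrite ln_mult.
- unfold lcoth. rewrite exp_pow. now rewrite Ropp_mult_distr_r.
- apply oprod_pos. now apply exp_neg_abs.
- apply Rdiv_lt_0_compat; [apply one_plus_pow_pos|apply one_minus_pow_pos]; try apply exp_neg_abs; trivial; lia.
Qed.

Lemma lcoth_pos x : 0 < x -> 0 < lcoth x.
Proof.
intros H. destruct (exp_neg_lt1 x H). unfold lcoth. rewrite <- ln_1. apply ln_increasing; [lra|].
apply (Rmult_lt_reg_r (1 - exp (- x))); [lra|]. unfold Rdiv. rewrite Rmult_assoc, Rinv_l; lra.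
Qed.

(** Taylor polynomial of [ln ((1 + y) / (1 - y))]. *)
Definition artanh_sum (y : R) (K : nat) := ssum (fun k => 2 * y ^ (2 * k - 1) / (2 * INR k - 1)) K.

Lemma odd_pos k : (1 <= k)%nat -> 1 <= 2 * INR k - 1.
Proof. intros H; apply le_INR in H; simpl in H; lra. Qed.

Lemma is_derive_monomial n c y :
  is_derive (fun y => 2 * y ^ n / c) y (2 * (INR n * y ^ pred n) / c).
Proof. auto_derive; trivial. unfold Rdiv; ring. Qed.

Lemma is_derive_artanh_sum y K : y ^ 2 <> 1 ->
  is_derive (fun y => artanh_sum y K) y (2 * (1 - y ^ (2 * K)) / (1 - y ^ 2)).
Proof.
intros Hy. induction K as [|K IH].
  replace (2 * (1 - y ^ (2 * 0)) / (1 - y ^ 2)) with 0 by (simpl; unfold Rdiv; ring).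
  unfold artanh_sum; simpl. apply (is_derive_const (V := R_NormedModule) 0).
replace (2 * (1 - y ^ (2 * S K)) / (1 - y ^ 2)) with
  (2 * (1 - y ^ (2 * K)) / (1 - y ^ 2) + 2 * y ^ (2 * K)).
  2:{ replace (2 * S K)%nat with (2 * K + 2)%nat by lia. rewrite pow_add. field. lra. }
apply (is_derive_plus (fun y => artanh_sum y K)); trivial.
generalize (odd_pos (S K) ltac:(lia)); intros Ho.
replace (2 * S K - 1)%nat with (S (2 * K)) by lia.
replace (2 * y ^ (2 * K)) with (2 * (INR (S (2 * K)) * y ^ pred (S (2 * K))) / (2 * INR (S K) - 1)).
  apply is_derive_monomial.
rewrite Nat.pred_succ. replace (INR (S (2 * K))) with (2 * INR (S K) - 1).
  generalize (y ^ (2 * K)); intros z; field; lra.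
rewrite !S_INR, mult_INR. change (INR 2) with 2. ring.
Qed.

Lemma artanh_bounds Y K : 0 <= Y < 1 ->
  artanh_sum Y K <= ln ((1 + Y) / (1 - Y)) <=
  artanh_sum Y K + 2 * Y ^ (2 * K + 1) / ((2 * INR K + 1) * (1 - Y ^ 2)).
Proof.
intros HY.
assert (D : forall y, 0 <= y <= Y -> is_derive (fun y => ln ((1 + y) / (1 - y))) y (2 / (1 - y ^ 2))).
  intros y Hy. auto_derive.
    repeat split; try lra. apply Rdiv_lt_0_compat; lra.
  field. repeat split; nra.
assert (Z : artanh_sum 0 K = 0).
  unfold artanh_sum. transitivity (ssum (fun _ => 0 * 0) K).
    apply ssum_ext; intros k Hk. rewrite pow_i by lia. unfold Rdiv; ring.
  rewrite ssum_scal; ring.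
assert (L0 : ln ((1 + 0) / (1 - 0)) = 0) by (replace ((1 + 0) / (1 - 0)) with 1 by field; apply ln_1).
assert (P : forall y n, 0 <= y <= Y -> 0 <= y ^ n) by (intros; apply pow_le; lra).
split.
  enough (ln ((1 + 0) / (1 - 0)) - artanh_sum 0 K <= ln ((1 + Y) / (1 - Y)) - artanh_sum Y K) by lra.
  apply (derive_nonneg_le (fun y => ln ((1 + y) / (1 - y)) - artanh_sum y K)
     (fun y => 2 / (1 - y ^ 2) - 2 * (1 - y ^ (2 * K)) / (1 - y ^ 2))); [lra| |].
    intros y Hy. apply (is_derive_minus (fun y => ln ((1 + y) / (1 - y)))); [now apply D|].
    apply is_derive_artanh_sum. nra.
  intros y Hy. replace (_ - _) with (2 * y ^ (2 * K) / (1 - y ^ 2))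
    by (generalize (y ^ (2 * K)); intros z; field; nra).
  apply Rdiv_le_0_compat; [generalize (P y (2 * K)%nat Hy); lra|nra].
set (c := (2 * INR K + 1) * (1 - Y ^ 2)).
generalize (pos_INR K); intros HK.
assert (Hc : 0 < c) by (unfold c; apply Rmult_lt_0_compat; nra).
enough (artanh_sum 0 K + 2 * 0 ^ (2 * K + 1) / c - ln ((1 + 0) / (1 - 0)) <=
  artanh_sum Y K + 2 * Y ^ (2 * K + 1) / c - ln ((1 + Y) / (1 - Y))).
  rewrite L0, Z, pow_i in H by lia. unfold Rdiv in *. lra.
apply (derive_nonneg_le (fun y => artanh_sum y K + 2 * y ^ (2 * K + 1) / c - ln ((1 + y) / (1 - y)))
  (fun y => 2 * (1 - y ^ (2 * K)) / (1 - y ^ 2) + 2 * y ^ (2 * K) / (1 - Y ^ 2) - 2 / (1 - y ^ 2))); [lra| |].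
  intros y Hy. apply (is_derive_minus (fun y => artanh_sum y K + 2 * y ^ (2 * K + 1) / c)); [|now apply D].
  apply (is_derive_plus (fun y => artanh_sum y K)); [apply is_derive_artanh_sum; nra|].
  replace (2 * y ^ (2 * K) / (1 - Y ^ 2)) with (2 * (INR (2 * K + 1) * y ^ pred (2 * K + 1)) / c).
    apply is_derive_monomial.
  replace (pred (2 * K + 1)) with (2 * K)%nat by lia.
  rewrite plus_INR, mult_INR. change (INR 2) with 2; change (INR 1) with 1.
  unfold c. generalize (y ^ (2 * K)); intros z. field. split; nra.
intros y Hy.
replace (_ - _) with (2 * y ^ (2 * K) * (/ (1 - Y ^ 2) - / (1 - y ^ 2)))
  by (generalize (y ^ (2 * K)); intros z; field; split; nra).
apply Rmult_le_pos; [generalize (P y (2 * K)%nat Hy); lra|].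
assert (/ (1 - y ^ 2) <= / (1 - Y ^ 2)) by (apply Rinv_le_contravar; nra). lra.
Qed.

Lemma ssum_geom y N : y <> 1 -> ssum (fun m => y ^ m) N = y * (1 - y ^ N) / (1 - y).
Proof.
intros H; induction N as [|N IH]; [simpl; unfold Rdiv; ring|].
rewrite ssum_S, IH. simpl. field. lra.
Qed.

Lemma ssum_swap (f : nat -> nat -> R) N K :
  ssum (fun m => ssum (fun k => f m k) K) N = ssum (fun k => ssum (fun m => f m k) N) K.
Proof.
induction N as [|N IH].
  simpl. induction K as [|K IH]; [trivial|]. rewrite ssum_S, <- IH. ring.
rewrite ssum_S, IH, <- ssum_plus. now apply ssum_ext.
Qed.

(** After the exchange of sums, the inner sum is geometric of ratio [exp (- c)], [c = (2 k - 1) a],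
    and close to [/ c]. This is how the Basel sum over odd integers enters. *)
Lemma artanh_ssum a N K : 0 < a ->
  ssum (fun m => artanh_sum (exp (- (INR m * a))) K) N =
  ssum (fun k => 2 / (2 * INR k - 1) *
     ssum (fun m => exp (- ((2 * INR k - 1) * a)) ^ m) N) K.
Proof.
intros H. unfold artanh_sum. rewrite ssum_swap. apply ssum_ext; intros k Hk.
rewrite <- ssum_scal. apply ssum_ext; intros m Hm.
rewrite !exp_pow. replace (INR (2 * k - 1)) with (2 * INR k - 1).
  replace (INR m * - ((2 * INR k - 1) * a)) with ((2 * INR k - 1) * - (INR m * a)) by ring.
  unfold Rdiv; ring.
rewrite minus_INR, mult_INR by lia. reflexivity.
Qed.

Lemma inv_exp_sub1 c : 0 < c -> / c - 1 <= exp (- c) / (1 - exp (- c)) <= / c.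
Proof.
intros H. destruct (exp_neg_lt1 c H) as [h0 h1]. split.
  apply Rle_trans with (exp (- c) / c).
    generalize (exp_ineq1_le (- c)); intros h. apply (Rmult_le_reg_r c); trivial.
    unfold Rdiv. rewrite Rmult_minus_distr_r, Rmult_assoc, Rinv_l; lra.
  unfold Rdiv. apply Rmult_le_compat_l; [lra|]. apply Rinv_le_contravar; [lra|].
  generalize (exp_ineq1_le (- c)); lra.
apply (Rmult_le_reg_r (c * (1 - exp (- c)))); [nra|].
replace (exp (- c) / (1 - exp (- c)) * (c * (1 - exp (- c)))) with (exp (- c) * c) by (field; lra).
replace (/ c * (c * (1 - exp (- c)))) with (1 - exp (- c)) by (field; lra).
generalize (exp_ineq1_le c). assert (exp c * exp (- c) = 1).
  rewrite <- exp_plus. replace (c + - c) with 0 by ring. apply exp_0.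
nra.
Qed.

(** Each geometric sum is at most [/ c], so the Basel sum bounds the Taylor part; the remainders of
    the [N] logarithms vanish as [K] grows. *)
Lemma LamN_le a N : 0 < a -> LamN N a <= PI ^ 2 / 4 / a.
Proof.
intros H.
apply (is_lim_seq_le (fun _ => LamN N a)
  (fun K => PI ^ 2 / 4 / a + ssum (fun m => 2 * exp (- (INR m * a)) ^ (2 * K + 1) / ((2 * INR K + 1) * (1 - exp (- (INR m * a)) ^ 2))) N)
  (LamN N a) (PI ^ 2 / 4 / a)).
- intros K. apply Rle_trans with (ssum (fun m => artanh_sum (exp (- (INR m * a))) K + 2 * exp (- (INR m * a)) ^ (2 * K + 1) / ((2 * INR K + 1) * (1 - exp (- (INR m * a)) ^ 2))) N).
    apply ssum_le; intros m Hm. unfold lcoth. apply artanh_bounds.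
    destruct m as [|m]; [lia|]. generalize (exp_neg_lt1 _ (INR_S_mult_pos a m H)); lra.
  rewrite ssum_plus. apply Rplus_le_compat_r. rewrite artanh_ssum by trivial.
  apply Rle_trans with (ssum (fun k => 2 / a * odd_inv_sq k) K).
    apply ssum_le; intros k Hk. generalize (odd_pos k ltac:(lia)); intros Ho.
    assert (Hc : 0 < (2 * INR k - 1) * a) by nra.
    destruct (exp_neg_lt1 _ Hc) as [h0 h1].
    rewrite ssum_geom by lra. unfold odd_inv_sq.
    replace (2 / a * / (2 * INR k - 1) ^ 2) with (2 / (2 * INR k - 1) * / ((2 * INR k - 1) * a)) by (field; lra).
    apply Rmult_le_compat_l; [apply Rdiv_le_0_compat; lra|].
    eapply Rle_trans; [|apply (inv_exp_sub1 _ Hc)].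
    set (y := exp _) in *. assert (0 <= y ^ N) by (apply pow_le; lra).
    unfold Rdiv. apply Rmult_le_compat_r; [apply Rlt_le, Rinv_0_lt_compat; lra|nra].
  rewrite ssum_scal. generalize (basel_odd_le K); intros HB.
  replace (PI ^ 2 / 4 / a) with (2 / a * (PI ^ 2 / 8)) by (field; lra).
  apply Rmult_le_compat_l; trivial. apply Rdiv_le_0_compat; lra.
- apply is_lim_seq_const.
- replace (Finite (PI ^ 2 / 4 / a)) with (Rbar_plus (PI ^ 2 / 4 / a) 0) by (simpl; f_equal; ring).
  apply is_lim_seq_plus'; [apply is_lim_seq_const|].
  enough (E : is_lim_seq (fun K => ssum (fun m => 2 / (1 - exp (- (INR m * a)) ^ 2) * (exp (- (INR m * a)) ^ (2 * K + 1) / (2 * INR K + 1))) N) 0).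
    apply is_lim_seq_ext with (2 := E). intros K. apply ssum_ext; intros m Hm.
    destruct m as [|m]; [lia|]. generalize (exp_neg_lt1 _ (INR_S_mult_pos a m H)) (pos_INR K); intros h1 h2.
    generalize (exp (- (INR (S m) * a)) ^ (2 * K + 1)); intros z. field. split; nra.
  clear -H. induction N as [|N IH]; [apply is_lim_seq_const|].
  replace (Finite 0) with (Rbar_plus 0 0) by (simpl; f_equal; ring).
  apply is_lim_seq_plus'; trivial.
  set (y := exp _). set (c := 2 / _).
  replace (Finite 0) with (Rbar_mult c 0) by (simpl; f_equal; ring). apply is_lim_seq_scal_l.
  generalize (exp_neg_lt1 _ (INR_S_mult_pos a N H)); fold y; intros hy.
  apply (is_lim_seq_le_le (fun _ => 0) _ (fun K => y ^ K)).
  + intros K. generalize (pos_INR K); intros hK.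
    assert (h1 : 0 <= y ^ (2 * K + 1)) by (apply pow_le; lra).
    assert (h2 : y ^ (2 * K + 1) <= y ^ K) by (apply pow_decr; [lra|lia]).
    split; [apply Rdiv_le_0_compat; lra|].
    apply (Rmult_le_reg_r (2 * INR K + 1)); [lra|]. unfold Rdiv. rewrite Rmult_assoc, Rinv_l; nra.
  + apply is_lim_seq_const.
  + apply is_lim_seq_geom. rewrite Rabs_right; lra.
Qed.

(** A limit of positive numbers might be 0. The bound of [LamN_le], uniform in [N], excludes it, so
    that [Lam] is the logarithm of a positive number. *)
Lemma theta4_pos a : 0 < a -> exp (- (PI ^ 2 / 4 / a)) <= theta4 (exp (- a)).
Proof.
intros H.
apply (is_lim_seq_le (fun _ => exp (- (PI ^ 2 / 4 / a))) (fun N => / oprod N (exp (- a)))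
  (exp (- (PI ^ 2 / 4 / a))) (theta4 (exp (- a)))).
- intros N. generalize (oprod_pos (exp (- a)) N (exp_neg_abs a H)); intros hp.
  rewrite exp_Ropp. apply Rinv_le_contravar; trivial.
  rewrite <- (exp_ln (oprod N (exp (- a)))) by trivial. apply exp_mono.
  rewrite <- LamN_oprod by trivial. now apply LamN_le.
- apply is_lim_seq_const.
- apply oprod_lim, exp_neg_abs, H.
Qed.

Lemma LamN_lim a : 0 < a -> is_lim_seq (fun N => LamN N a) (Lam a).
Proof.
intros H. apply (is_lim_seq_ext (fun N => - ln (/ oprod N (exp (- a))))).
  intros N. rewrite LamN_oprod by trivial. rewrite ln_Rinv; [ring|]. apply oprod_pos, exp_neg_abs, H.
unfold Lam. apply (is_lim_seq_opp _ (ln (theta4 (exp (- a))))).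
apply (is_lim_seq_continuous ln).
  apply derivable_continuous_pt. exists (/ theta4 (exp (- a))). apply derivable_pt_lim_ln.
  generalize (theta4_pos a H) (exp_pos (- (PI ^ 2 / 4 / a))); lra.
apply oprod_lim, exp_neg_abs, H.
Qed.

Lemma Lam_le a : 0 < a -> Lam a <= PI ^ 2 / 4 / a.
Proof.
intros H. apply (is_lim_seq_le (fun N => LamN N a) (fun _ => PI ^ 2 / 4 / a) (Lam a) (PI ^ 2 / 4 / a)).
- intros N; now apply LamN_le.
- now apply LamN_lim.
- apply is_lim_seq_const.
Qed.

(** Each geometric series is at least [/ c - 1], which costs at most 2 for each of the [K] odd
    integers kept. *)
Lemma Lam_ge a K : 0 < a -> 2 / a * ssum odd_inv_sq K - 2 * INR K <= Lam a.
Proof.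
intros H.
eapply Rle_trans; [|refine (is_lim_seq_le
  (fun N => ssum (fun k => 2 / (2 * INR k - 1) * ssum (fun m => exp (- ((2 * INR k - 1) * a)) ^ m) N) K)
  (fun N => LamN N a)
  (ssum (fun k => 2 / (2 * INR k - 1) * (exp (- ((2 * INR k - 1) * a)) / (1 - exp (- ((2 * INR k - 1) * a))))) K)
  (Lam a) _ _ _)].
- apply Rle_trans with (ssum (fun k => 2 / a * odd_inv_sq k + - 2 * 1) K).
    rewrite ssum_plus, !ssum_scal. apply Req_le.
    replace (ssum (fun _ => 1) K) with (INR K); [ring|].
    clear. induction K as [|K IH]; [trivial|]. rewrite S_INR, ssum_S; lra.
  apply ssum_le; intros k Hk. generalize (odd_pos k ltac:(lia)); intros Ho.
  assert (Hc : 0 < (2 * INR k - 1) * a) by nra.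
  destruct (inv_exp_sub1 _ Hc) as [h _].
  unfold odd_inv_sq.
  apply Rle_trans with (2 / (2 * INR k - 1) * (/ ((2 * INR k - 1) * a) - 1)).
    replace (2 / (2 * INR k - 1) * (/ ((2 * INR k - 1) * a) - 1)) with
      (2 / a * / (2 * INR k - 1) ^ 2 - 2 * / (2 * INR k - 1)) by (field; lra).
    assert (/ (2 * INR k - 1) <= / 1) by (apply Rinv_le_contravar; lra). lra.
  apply Rmult_le_compat_l; trivial. apply Rdiv_le_0_compat; lra.
- intros N. rewrite <- artanh_ssum by trivial. apply ssum_le; intros m Hm. unfold lcoth. apply artanh_bounds.
  destruct m as [|m]; [lia|]. generalize (exp_neg_lt1 _ (INR_S_mult_pos a m H)); lra.
- clear -H. induction K as [|K IH]; [apply is_lim_seq_const|].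
  apply is_lim_seq_plus'; trivial.
  apply (is_lim_seq_mult' _ _ (2 / (2 * INR (S K) - 1))); [apply is_lim_seq_const|].
  generalize (odd_pos (S K) ltac:(lia)); intros Ho.
  assert (Hc : 0 < (2 * INR (S K) - 1) * a) by nra.
  destruct (exp_neg_lt1 _ Hc) as [h0 h1]. set (y := exp _) in *.
  apply (is_lim_seq_ext (fun N => y * / (1 - y) - y * / (1 - y) * y ^ N)).
    intros N. rewrite ssum_geom by lra. field. lra.
  replace (Finite (y / (1 - y))) with (Rbar_minus (y * / (1 - y)) (Rbar_mult (y * / (1 - y)) 0)).
    2:{ simpl. f_equal. unfold Rdiv. ring. }
  apply is_lim_seq_minus'; [apply is_lim_seq_const|].
  apply is_lim_seq_mult'; [apply is_lim_seq_const|]. apply is_lim_seq_geom. rewrite Rabs_right; lra.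
- now apply LamN_lim.
Qed.

(** Together with [Lam_le], [a * Lam a] tends to [PI ^ 2 / 4] at 0. This crude asymptotics is the
    starting point of the exact one. *)
Lemma Lam_lower_small eps : 0 < eps ->
  exists C, forall a, 0 < a -> PI ^ 2 / 4 - eps - C * a <= a * Lam a.
Proof.
intros He. destruct (basel_odd_ge (eps / 2) ltac:(lra)) as [K HK].
exists (2 * INR K). intros a Ha.
generalize (Lam_ge a K Ha); intros h. apply (Rmult_le_compat_l a) in h; [|lra].
replace (a * (2 / a * ssum odd_inv_sq K - 2 * INR K)) with (2 * ssum odd_inv_sq K - 2 * INR K * a) in h by (field; lra).
lra.
Qed.

(** * Exponentially accurate asymptotics of the logarithm *)

Lemma gint_step x h : 0 <= x -> 0 <= h ->
  h * exp (- ((x + h) * (x + h))) <= gint (x + h) - gint x <= h * exp (- (x * x)).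
Proof.
intros Hx Hh.
destruct (MVT_gen gint x (x + h) (fun t => exp (- (t * t)))) as [c [Hc E]].
- intros t _; apply is_derive_gint.
- intros t _. apply continuity_pt_filterlim, (ex_derive_continuous gint). eexists; apply is_derive_gint.
rewrite Rmin_left, Rmax_right in Hc by lra. rewrite E.
replace (x + h - x) with h by ring. rewrite (Rmult_comm _ h).
split; apply Rmult_le_compat_l; trivial; apply exp_mono; nra.
Qed.

Lemma thterm_neg_exp a k : 0 <= a -> thterm (- exp (- a)) k = exp (- (sqrt a * INR k) ^ 2).
Proof.
intros H. unfold thterm. replace (- exp (- a)) with (-1 * exp (- a)) by ring.
rewrite Rpow_mult_distr, <- Rmult_assoc, <- pow_add.
replace ((-1) ^ (k + k * k)) with 1.
  rewrite Rmult_1_l, exp_pow. f_equal. rewrite Rpow_mult_distr, pow2_sqrt, mult_INR by trivial. ring.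
destruct (Nat.Even_or_Odd k) as [[j ->]|[j ->]].
  replace (2 * j + 2 * j * (2 * j))%nat with (2 * (j + 2 * j * j))%nat by ring. now rewrite pow_1_even.
replace (2 * j + 1 + (2 * j + 1) * (2 * j + 1))%nat with (2 * (1 + 3 * j + 2 * j * j))%nat by ring. now rewrite pow_1_even.
Qed.

(* [theta3 q = theta4 (- q)]; the factor [sqrt a] makes the limit at [0] equal to [sqrt PI]. *)
Definition theta3s (a : R) := sqrt a * theta4 (- exp (- a)).

Lemma exp_neg_abs' a : 0 < a -> Rabs (- exp (- a)) < 1.
Proof. intros H; rewrite Rabs_Ropp; now apply exp_neg_abs. Qed.

(** A Riemann sum of step [sqrt a] for the Gaussian, which decreases, is within one step of its
    integral. *)
Lemma theta3s_bounds a : 0 < a -> sqrt PI - sqrt a <= theta3s a <= sqrt PI + sqrt a.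
Proof.
intros H. assert (Hs : 0 < sqrt a) by now apply sqrt_lt_R0.
assert (T : forall k, thterm (- exp (- a)) k = exp (- ((INR k * sqrt a) * (INR k * sqrt a)))).
  intros k. rewrite thterm_neg_exp by lra. f_equal; ring.
assert (U : forall N, sqrt a * ssum (thterm (- exp (- a))) N <= gint (INR N * sqrt a)).
  induction N as [|N IH]; [simpl; rewrite Rmult_0_l; unfold gint; rewrite RInt_point; unfold zero; simpl; lra|].
  rewrite ssum_S, T, S_INR.
  generalize (gint_step (INR N * sqrt a) (sqrt a) ltac:(generalize (pos_INR N); nra) ltac:(lra)).
  replace (INR N * sqrt a + sqrt a) with ((INR N + 1) * sqrt a) by ring. lra.
assert (L : forall N, gint (INR (S N) * sqrt a) <= sqrt a * (1 + ssum (thterm (- exp (- a))) N)).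
  intros N; induction N as [|N IH].
    simpl. generalize (gint_step 0 (sqrt a) ltac:(lra) ltac:(lra)).
    replace (gint 0) with 0 by (unfold gint; rewrite RInt_point; reflexivity).
    rewrite !Rmult_0_l, Ropp_0, exp_0, Rplus_0_l, Rmult_1_l. lra.
  rewrite ssum_S, T, (S_INR (S N)).
  generalize (gint_step (INR (S N) * sqrt a) (sqrt a) ltac:(generalize (pos_INR (S N)); nra) ltac:(lra)).
  replace (INR (S N) * sqrt a + sqrt a) with ((INR (S N) + 1) * sqrt a) by ring. lra.
assert (Lm := theta4_lim _ (exp_neg_abs' a H)).
assert (Lm' : is_lim_seq (fun N => sqrt a * (1 + 2 * ssum (thterm (- exp (- a))) N)) (theta3s a)).
  apply (is_lim_seq_mult' _ _ (sqrt a)); [apply is_lim_seq_const|exact Lm].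
split.
- refine (is_lim_seq_le (fun N => 2 * (sqrt PI / 2 * (1 - exp (- a) ^ S N)) - sqrt a) _ (sqrt PI - sqrt a) (theta3s a) _ _ Lm').
  + intros N. eapply Rle_trans with (2 * gint (INR (S N) * sqrt a) - sqrt a); [|generalize (L N); lra].
    generalize (gint_bounds (INR (S N) * sqrt a) ltac:(generalize (pos_INR (S N)); nra)); intros [h _].
    enough (exp (- (INR (S N) * sqrt a * (INR (S N) * sqrt a))) <= exp (- a) ^ S N).
      assert (0 < sqrt PI) by (apply sqrt_lt_R0, PI_RGT_0). nra.
    rewrite exp_pow. apply exp_mono.
    replace (INR (S N) * sqrt a * (INR (S N) * sqrt a)) with (INR (S N) ^ 2 * (sqrt a * sqrt a)) by ring.
    rewrite sqrt_sqrt by lra. rewrite S_INR. generalize (pos_INR N); intros.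
    assert (0 <= INR N * a * (INR N + 1)) by (apply Rmult_le_pos; nra). nra.
  + replace (sqrt PI - sqrt a) with (2 * (sqrt PI / 2 * (1 - 0)) - sqrt a) by field.
    apply is_lim_seq_minus'; [|apply is_lim_seq_const].
    apply (is_lim_seq_mult' _ _ 2); [apply is_lim_seq_const|].
    apply (is_lim_seq_mult' _ _ (sqrt PI / 2)); [apply is_lim_seq_const|].
    apply is_lim_seq_minus'; [apply is_lim_seq_const|].
    apply (is_lim_seq_incr_1 (fun n => exp (- a) ^ n)). now apply is_lim_seq_geom, exp_neg_abs.
- refine (is_lim_seq_le _ (fun _ => sqrt PI + sqrt a) (theta3s a) (sqrt PI + sqrt a) _ Lm' (is_lim_seq_const _)).
  intros N. generalize (U N) (gint_bounds (INR N * sqrt a) ltac:(generalize (pos_INR N); nra)). lra.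
Qed.

(* [theta3 q = 2 * theta3 (q^4) - theta4 q] at [q = exp (- a)]. *)
Lemma theta3s_4 a : 0 < a -> theta3s (4 * a) = theta3s a + sqrt a * theta4 (exp (- a)).
Proof.
intros H. unfold theta3s.
assert (E := theta4_split (exp (- a)) (exp_neg_abs a H)).
rewrite exp_pow in E. replace (INR 4 * - a) with (- (4 * a)) in E by (simpl; ring).
replace (sqrt (4 * a)) with (2 * sqrt a).
  rewrite Rmult_comm, <- Rmult_assoc, (Rmult_comm _ 2), <- E. ring.
rewrite sqrt_mult_alt by lra. f_equal. replace 4 with (2 * 2) by ring. rewrite sqrt_square; lra.
Qed.

Lemma theta4_pos' a : 0 < a -> 0 < theta4 (exp (- a)).
Proof. intros H; generalize (theta4_pos a H) (exp_pos (- (PI ^ 2 / 4 / a))); lra. Qed.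

Lemma theta4_exp_Lam a : 0 < a -> theta4 (exp (- a)) = exp (- Lam a).
Proof. intros H. unfold Lam. rewrite Ropp_involutive, exp_ln; trivial. now apply theta4_pos'. Qed.

(** [Lam_ge] with a single odd term. The true rate is [PI ^ 2 / (4 a)]; [2 / a] already makes the
    increments of [theta3s_4] exponentially small. *)
Lemma theta4_le a : 0 < a -> theta4 (exp (- a)) <= exp (2 - 2 / a).
Proof.
intros H. rewrite theta4_exp_Lam by trivial. apply exp_mono.
generalize (Lam_ge a 1 H). unfold odd_inv_sq; simpl.
replace (2 / a * (0 + / ((2 * 1 - 1) * ((2 * 1 - 1) * 1)))) with (2 / a) by (field; lra). lra.
Qed.

(** Sums [theta3s_4] over [a / 4^j], [1 <= j <= J]. The increment is at most
    [sqrt a / 2^j * exp (2 - 8 / a)], where 8 is [2 * 4] because the nearest point is [a / 4]. As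
    [J] grows, [theta3s_bounds] gives the limit [sqrt PI]. *)
Lemma theta3s_iter a J : 0 < a ->
  theta3s (a / 4 ^ J) <= theta3s a <= theta3s (a / 4 ^ J) + sqrt a * exp (2 - 8 / a) * (1 - / 2 ^ J).
Proof.
intros H. induction J as [|J IH].
  simpl. rewrite Rdiv_1_r. lra.
assert (H4 := pow_lt 4 J ltac:(lra)). assert (H2 := pow_lt 2 J ltac:(lra)).
assert (Hb : 0 < a / 4 ^ S J) by (apply Rdiv_lt_0_compat; [trivial|simpl; lra]).
assert (E := theta3s_4 _ Hb).
replace (4 * (a / 4 ^ S J)) with (a / 4 ^ J) in E by (simpl; field; lra).
assert (hp := theta4_pos' _ Hb). assert (hs := sqrt_lt_R0 _ Hb).
assert (hle := theta4_le _ Hb).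
assert (Es : sqrt (a / 4 ^ S J) = sqrt a / 2 ^ S J).
  rewrite sqrt_div_alt by (apply pow_lt; lra). f_equal.
  replace (4 ^ S J) with (2 ^ S J * 2 ^ S J) by (rewrite <- Rpow_mult_distr; f_equal; ring).
  apply sqrt_square. apply pow_le; lra.
assert (hJ : 1 <= 4 ^ J) by (apply pow_R1_Rle; lra).
assert (hE : exp (2 - 2 / (a / 4 ^ S J)) <= exp (2 - 8 / a)).
  apply exp_mono. replace (2 / (a / 4 ^ S J)) with (8 / a * 4 ^ J) by (simpl; field; lra).
  assert (0 < 8 / a) by (apply Rdiv_lt_0_compat; lra). nra.
split.
  rewrite E in IH. nra.
assert (B : sqrt (a / 4 ^ S J) * theta4 (exp (- (a / 4 ^ S J))) <= sqrt a * exp (2 - 8 / a) * / 2 ^ S J).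
  rewrite Es. replace (sqrt a * exp (2 - 8 / a) * / 2 ^ S J) with (sqrt a / 2 ^ S J * exp (2 - 8 / a)) by (unfold Rdiv; ring).
  apply Rmult_le_compat_l; [rewrite <- Es; lra|]. lra.
replace (1 - / 2 ^ S J) with (1 - / 2 ^ J + / 2 ^ S J) by (simpl; field; lra).
lra.
Qed.

Lemma theta3s_tight a : 0 < a ->
  sqrt PI <= theta3s a <= sqrt PI + sqrt a * exp (2 - 8 / a).
Proof.
intros H.
assert (Ls : is_lim_seq (fun J => sqrt (a / 4 ^ J)) 0).
  apply (is_lim_seq_ext (fun J => sqrt a * (/ 2) ^ J)).
    intros J. assert (H2 := pow_lt 2 J ltac:(lra)).
    rewrite sqrt_div_alt by (apply pow_lt; lra).
    replace (4 ^ J) with (2 ^ J * 2 ^ J) by (rewrite <- Rpow_mult_distr; f_equal; ring).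
    rewrite sqrt_square, pow_inv by lra. reflexivity.
  replace (Finite 0) with (Rbar_mult (sqrt a) 0) by (simpl; f_equal; ring). apply is_lim_seq_scal_l.
  apply is_lim_seq_geom. rewrite Rabs_right; lra.
assert (Hb : forall J, 0 < a / 4 ^ J) by (intros J; apply Rdiv_lt_0_compat; trivial; apply pow_lt; lra).
split.
- refine (is_lim_seq_le (fun J => sqrt PI - sqrt (a / 4 ^ J)) (fun _ => theta3s a) (sqrt PI) (theta3s a) _ _ (is_lim_seq_const _)).
    intros J. generalize (theta3s_bounds _ (Hb J)) (theta3s_iter a J H); lra.
  replace (Finite (sqrt PI)) with (Rbar_minus (sqrt PI) 0) by (simpl; f_equal; ring).
  apply is_lim_seq_minus'; [apply is_lim_seq_const|exact Ls].
- refine (is_lim_seq_le (fun _ => theta3s a) (fun J => sqrt PI + sqrt (a / 4 ^ J) + sqrt a * exp (2 - 8 / a)) (theta3s a) (sqrt PI + sqrt a * exp (2 - 8 / a)) _ (is_lim_seq_const _) _).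
    intros J. generalize (theta3s_bounds _ (Hb J)) (theta3s_iter a J H).
    assert (0 < / 2 ^ J) by (apply Rinv_0_lt_compat, pow_lt; lra).
    assert (0 < sqrt a * exp (2 - 8 / a)) by (apply Rmult_lt_0_compat; [now apply sqrt_lt_R0|apply exp_pos]). nra.
  replace (sqrt PI + sqrt a * exp (2 - 8 / a)) with (sqrt PI + 0 + sqrt a * exp (2 - 8 / a)) by ring.
  repeat apply is_lim_seq_plus'; try apply is_lim_seq_const. exact Ls.
Qed.

(* What the modular transformation of [theta4] predicts for [Lam]. *)
Definition Lmod (a : R) := PI ^ 2 / 4 / a + / 2 * ln (a / (4 * PI)).
Definition Eerr (a : R) := Lam a - Lmod a.

(** The logarithm of [theta4_mul]. *)
Lemma Lam_double a : 0 < a -> ln (theta3s a) = Lam a - 2 * Lam (2 * a) + / 2 * ln a.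
Proof.
intros H. assert (E := theta4_mul (exp (- a)) (exp_neg_abs a H)).
rewrite exp_pow in E. replace (INR 2 * - a) with (- (2 * a)) in E by (simpl; ring).
rewrite !theta4_exp_Lam in E by lra.
assert (T : theta4 (- exp (- a)) = exp (Lam a - 2 * Lam (2 * a))).
  apply (Rmult_eq_reg_l (exp (- Lam a))); [|apply Rgt_not_eq, exp_pos].
  rewrite E, exp_pow, <- exp_plus. f_equal. simpl; ring.
unfold theta3s. rewrite T, ln_mult, ln_exp; [|now apply sqrt_lt_R0|apply exp_pos].
replace (ln (sqrt a)) with (/ 2 * ln a); [ring|].
rewrite <- (sqrt_sqrt a) at 1 by lra. assert (0 < sqrt a) by now apply sqrt_lt_R0.
rewrite ln_mult by trivial. field.
Qed.

(** [Lmod] satisfies the relation of [Lam_double] exactly, with [sqrt PI] in place of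
    [theta3s a]. *)
Lemma Eerr_double a : 0 < a -> Eerr (2 * a) = / 2 * (Eerr a - ln (theta3s a / sqrt PI)).
Proof.
intros H. generalize PI_RGT_0; intros HP.
assert (HsP : 0 < sqrt PI) by now apply sqrt_lt_R0.
assert (Ht : 0 < theta3s a) by (generalize (theta3s_tight a H); lra).
rewrite ln_div by trivial. rewrite Lam_double by trivial. unfold Eerr, Lmod.
rewrite !ln_div by lra. rewrite !ln_mult by lra.
replace (ln (sqrt PI)) with (/ 2 * ln PI).
  2:{ rewrite <- (sqrt_sqrt PI) at 1 by lra. rewrite ln_mult by trivial. field. }
replace (ln 4) with (2 * ln 2).
  2:{ replace 4 with (2 * 2) by ring. rewrite ln_mult by lra. ring. }
field. lra.
Qed.

Lemma ln_theta3s_bound a : 0 < a <= 2 -> 0 <= ln (theta3s a / sqrt PI) <= exp (2 - 8 / a).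
Proof.
intros H. generalize PI_RGT_0 PI_4 PI2_3_2; intros HP HP4 HP3. unfold PI2 in HP3.
assert (HsP : 0 < sqrt PI) by now apply sqrt_lt_R0.
destruct (theta3s_tight a) as [h1 h2]; [lra|].
set (e := exp (2 - 8 / a)) in *. assert (he : 0 < e) by apply exp_pos.
assert (hq : 1 <= theta3s a / sqrt PI).
  apply (Rmult_le_reg_r (sqrt PI)); trivial. unfold Rdiv. rewrite Rmult_assoc, Rinv_l; lra.
split.
  rewrite <- ln_1 at 1. apply ln_le; lra.
assert (hs : sqrt a <= sqrt PI) by (apply sqrt_le_1_alt; lra).
assert (hq2 : theta3s a / sqrt PI <= 1 + e).
  apply (Rmult_le_reg_r (sqrt PI)); trivial. unfold Rdiv. rewrite Rmult_assoc, Rinv_l by lra. nra.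
apply Rle_trans with (ln (1 + e)); [apply ln_le; lra|].
rewrite <- (ln_exp e) at 2. apply ln_le; [lra|apply exp_ineq1_le].
Qed.

(** The starting error is divided by [2 ^ J], so it need not be small: [Eerr x / 2 ^ J] is
    [x * Eerr x / a] for [x = a / 2 ^ J], and [x * Eerr x] tends to 0 by the next two lemmas. The 16
    is [8 * 2], from the point [a / 2]. *)
Lemma Eerr_iter a J : 0 < a <= 2 ->
  Eerr (a / 2 ^ J) / 2 ^ J - exp (2 - 16 / a) * (1 - / 2 ^ J) <= Eerr a <= Eerr (a / 2 ^ J) / 2 ^ J.
Proof.
intros H. induction J as [|J IH].
  simpl. rewrite !Rdiv_1_r. lra.
assert (H2 := pow_lt 2 J ltac:(lra)).
assert (hJ : 1 <= 2 ^ J) by (apply pow_R1_Rle; lra).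
assert (Hb : 0 < a / 2 ^ S J) by (apply Rdiv_lt_0_compat; [lra|simpl; lra]).
assert (Hb2 : a / 2 ^ S J <= 2).
  apply (Rmult_le_reg_r (2 ^ S J)); [simpl; lra|]. unfold Rdiv. rewrite Rmult_assoc, Rinv_l by (simpl; lra). simpl; nra.
assert (E := Eerr_double _ Hb).
replace (2 * (a / 2 ^ S J)) with (a / 2 ^ J) in E by (simpl; field; lra).
destruct (ln_theta3s_bound (a / 2 ^ S J) (conj Hb Hb2)) as [z0 z1].
assert (hE : exp (2 - 8 / (a / 2 ^ S J)) <= exp (2 - 16 / a)).
  apply exp_mono. replace (8 / (a / 2 ^ S J)) with (16 / a * 2 ^ J) by (simpl; field; lra).
  assert (0 < 16 / a) by (apply Rdiv_lt_0_compat; lra). nra.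
set (z := ln _) in *. rewrite E in IH.
replace (Eerr (a / 2 ^ S J) / 2 ^ S J) with (/ 2 * Eerr (a / 2 ^ S J) / 2 ^ J) by (simpl; field; lra).
replace (/ 2 * (Eerr (a / 2 ^ S J) - z) / 2 ^ J) with (/ 2 * Eerr (a / 2 ^ S J) / 2 ^ J - z * / 2 ^ S J) in IH by (simpl; field; lra).
assert (hi : 0 < / 2 ^ S J) by (apply Rinv_0_lt_compat; simpl; lra).
assert (hw : / 2 ^ J = 2 * / 2 ^ S J) by (simpl; field; lra). rewrite hw in IH.
set (w := / 2 ^ S J) in *. set (x := exp (2 - 16 / a)) in *.
split; [|nra]. assert (z * w <= x * w) by (apply Rmult_le_compat_r; lra). nra.
Qed.

Lemma x_Eerr_upper x : 0 < x <= 1 -> x * Eerr x <= 4 * sqrt x.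
Proof.
intros H. generalize PI_RGT_0 PI_4; intros HP HP4. unfold Eerr, Lmod.
assert (h := Lam_le x ltac:(lra)).
assert (hs : 0 < sqrt x) by (apply sqrt_lt_R0; lra).
assert (hs2 : sqrt x * sqrt x = x) by (apply sqrt_sqrt; lra).
assert (hs1 : sqrt x <= 1) by (rewrite <- sqrt_1; apply sqrt_le_1_alt; lra).
assert (hl : - ln (x / (4 * PI)) <= 2 * (4 / sqrt x - 1)).
  replace (- ln (x / (4 * PI))) with (ln (4 * PI / x)).
    2:{ rewrite <- ln_Rinv by (apply Rdiv_lt_0_compat; lra). f_equal; field; lra. }
  apply Rle_trans with (ln (4 / sqrt x * (4 / sqrt x))).
    apply ln_le; [apply Rdiv_lt_0_compat; lra|].
    replace (4 / sqrt x * (4 / sqrt x)) with (16 / (sqrt x * sqrt x)) by (field; lra). rewrite hs2.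
    apply Rmult_le_compat_r; [apply Rlt_le, Rinv_0_lt_compat; lra|lra].
  assert (0 < 4 / sqrt x) by (apply Rdiv_lt_0_compat; lra).
  rewrite ln_mult by trivial.
  enough (ln (4 / sqrt x) <= 4 / sqrt x - 1) by lra.
  rewrite <- (ln_exp (4 / sqrt x - 1)). apply ln_le; trivial.
  generalize (exp_ineq1_le (4 / sqrt x - 1)); lra.
assert (hm : x * (- / 2 * ln (x / (4 * PI))) <= x * (4 / sqrt x - 1)) by (apply Rmult_le_compat_l; lra).
assert (e4 : x * (4 / sqrt x) = 4 * sqrt x) by (rewrite <- hs2 at 1; field; lra).
rewrite Rmult_minus_distr_l, e4 in hm.
nra.
Qed.

Lemma x_Eerr_lower eps : 0 < eps -> exists C, forall x, 0 < x <= 1 -> - eps - C * x <= x * Eerr x.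
Proof.
intros He. destruct (Lam_lower_small eps He) as [C HC]. exists C. intros x Hx.
generalize PI_RGT_0 PI2_3_2; intros HP HP2. unfold PI2 in HP2.
generalize (HC x ltac:(lra)). unfold Eerr, Lmod. intros h.
assert (hl : ln (x / (4 * PI)) <= 0).
  rewrite <- ln_1. apply ln_le; [apply Rdiv_lt_0_compat; lra|].
  apply (Rmult_le_reg_r (4 * PI)); [lra|]. unfold Rdiv. rewrite Rmult_assoc, Rinv_l; lra.
assert (x * ln (x / (4 * PI)) <= 0) by nra.
replace (x * (Lam x - (PI ^ 2 / 4 / x + / 2 * ln (x / (4 * PI))))) with
  (x * Lam x - PI ^ 2 / 4 - / 2 * (x * ln (x / (4 * PI)))) by (field; lra). lra.
Qed.

Lemma Eerr_bounds a : 0 < a <= 1 -> - exp (2 - 16 / a) <= Eerr a <= 0.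
Proof.
intros H.
assert (Hb : forall J, 0 < a / 2 ^ J <= 1).
  intros J. assert (hJ : 1 <= 2 ^ J) by (apply pow_R1_Rle; lra). split.
    apply Rdiv_lt_0_compat; lra.
  apply (Rmult_le_reg_r (2 ^ J)); [lra|]. unfold Rdiv. rewrite Rmult_assoc, Rinv_l; lra.
assert (E : forall J, Eerr (a / 2 ^ J) / 2 ^ J = / a * ((a / 2 ^ J) * Eerr (a / 2 ^ J))).
  intros J. assert (h2 := pow_lt 2 J ltac:(lra)). field. lra.
assert (L2 : is_lim_seq (fun J => a / 2 ^ J) 0).
  apply (is_lim_seq_ext (fun J => a * (/ 2) ^ J)).
    intros J. rewrite pow_inv. reflexivity.
  replace (Finite 0) with (Rbar_mult a 0) by (simpl; f_equal; ring). apply is_lim_seq_scal_l.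
  apply is_lim_seq_geom. rewrite Rabs_right; lra.
assert (Ha : 0 < / a) by (apply Rinv_0_lt_compat; lra).
split.
- apply le_epsilon. intros eps He.
  destruct (x_Eerr_lower (eps * a) ltac:(nra)) as [C HC].
  enough (- exp (2 - 16 / a) - eps <= Eerr a) by lra.
  refine (is_lim_seq_le (fun J => / a * (- (eps * a) - C * (a / 2 ^ J)) - exp (2 - 16 / a)) (fun _ => Eerr a) (- exp (2 - 16 / a) - eps) (Eerr a) _ _ (is_lim_seq_const _)).
    intros J. generalize (Eerr_iter a J ltac:(lra)). rewrite E. intros [h _].
    generalize (Rmult_le_compat_l _ _ _ (Rlt_le _ _ Ha) (HC _ (Hb J))); intros h'.
    assert (0 < / 2 ^ J) by (apply Rinv_0_lt_compat, pow_lt; lra).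
    assert (0 < exp (2 - 16 / a)) by apply exp_pos. nra.
  replace (- exp (2 - 16 / a) - eps) with (/ a * (- (eps * a) - C * 0) - exp (2 - 16 / a)) by (field; lra).
  apply is_lim_seq_minus'; [|apply is_lim_seq_const].
  apply (is_lim_seq_mult' _ _ (/ a)); [apply is_lim_seq_const|].
  apply is_lim_seq_minus'; [apply is_lim_seq_const|].
  apply (is_lim_seq_mult' _ _ C); [apply is_lim_seq_const|exact L2].
- refine (is_lim_seq_le (fun _ => Eerr a) (fun J => / a * (4 * sqrt (a / 2 ^ J))) (Eerr a) 0 _ (is_lim_seq_const _) _).
    intros J. eapply Rle_trans; [apply (Eerr_iter a J); lra|]. rewrite E.
    apply Rmult_le_compat_l; [lra|]. apply x_Eerr_upper, Hb.
  replace 0 with (/ a * (4 * sqrt 0)) at 1 by (rewrite sqrt_0; ring).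
  apply (is_lim_seq_mult' _ _ (/ a)); [apply is_lim_seq_const|].
  apply (is_lim_seq_mult' _ _ 4); [apply is_lim_seq_const|].
  apply (is_lim_seq_continuous sqrt); [|exact L2]. apply continuity_pt_sqrt; lra.
Qed.

(** * Moments from finite differences *)

(** Oriented as [f (x - h) - f x] so that all differences of a completely monotone function are
    nonnegative. *)
Fixpoint bdiff (h : R) (k : nat) (f : R -> R) (x : R) : R :=
  match k with O => f x | S j => bdiff h j f (x - h) - bdiff h j f x end.

Lemma bdiff_derive h k f df x :
  (forall y, x - INR k * h <= y <= x -> is_derive f y (df y)) -> 0 <= h ->
  is_derive (bdiff h k f) x (bdiff h k df x).
Proof.
intros H Hh. revert x H. induction k as [|k IH]; intros x H.
  apply H. simpl; lra.
rewrite S_INR in H. generalize (pos_INR k); intros hk. simpl.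
apply (is_derive_minus (fun x => bdiff h k f (x - h))).
  evar_last.
    apply (is_derive_comp (bdiff h k f) (fun x => x - h)).
      apply IH. intros y Hy; apply H. lra.
    auto_derive; trivial.
  unfold scal; simpl; unfold mult; simpl. ring.
apply IH. intros y Hy; apply H. nra.
Qed.

(* [F j] is [(-1)^j] times the [j]-th derivative of [F 0]: complete monotonicity. *)
Lemma bdiff_bounds (F : nat -> R -> R) n h k i x :
  (forall j y, (j < n)%nat -> 0 < y -> is_derive (F j) y (- F (S j) y)) ->
  (forall j y z, (j <= n)%nat -> 0 < y -> y <= z -> F j z <= F j y) ->
  0 < h -> (i + k <= n)%nat -> 0 < x - INR k * h ->
  h ^ k * F (i + k)%nat x <= bdiff h k (F i) x <= h ^ k * F (i + k)%nat (x - INR k * h).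
Proof.
intros Hd Hm Hh. revert i x. induction k as [|k IH]; intros i x Hik Hx.
  rewrite Nat.add_0_r. simpl. rewrite Rmult_0_l, Rminus_0_r. lra.
rewrite S_INR in *. generalize (pos_INR k); intros hk. simpl bdiff.
assert (D : forall y, x - h <= y <= x -> is_derive (bdiff h k (F i)) y (bdiff h k (fun z => - F (S i) z) y)).
  intros y Hy. apply bdiff_derive; [|lra]. intros z Hz. apply Hd; [lia|]. nra.
assert (N : forall y, bdiff h k (fun z => - F (S i) z) y = - bdiff h k (F (S i)) y).
  clear. induction k as [|k IH]; intros y; simpl; [ring|]. rewrite !IH; ring.
destruct (MVT_gen (bdiff h k (F i)) (x - h) x (bdiff h k (fun z => - F (S i) z))) as [c [Hc E]].
- rewrite Rmin_left, Rmax_right by lra. intros y Hy; apply D; lra.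
- rewrite Rmin_left, Rmax_right by lra. intros y Hy.
  apply continuity_pt_filterlim, (ex_derive_continuous (bdiff h k (F i))). eexists; now apply D.
rewrite Rmin_left, Rmax_right in Hc by lra. rewrite N in E.
replace (bdiff h k (F i) (x - h) - bdiff h k (F i) x) with (h * bdiff h k (F (S i)) c) by lra.
replace (i + S k)%nat with (S i + k)%nat by lia.
destruct (IH (S i) c ltac:(lia) ltac:(nra)) as [h1 h2].
assert (hp : 0 <= h ^ k) by (apply pow_le; lra).
simpl. rewrite !Rmult_assoc. split; apply Rmult_le_compat_l; try lra.
  eapply Rle_trans; [|exact h1]. apply Rmult_le_compat_l; trivial. apply Hm; [lia|nra|lra].
eapply Rle_trans; [exact h2|]. apply Rmult_le_compat_l; trivial. apply Hm; [lia|nra|nra].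
Qed.

Lemma bdiff_plus h k f g x : bdiff h k (fun y => f y + g y) x = bdiff h k f x + bdiff h k g x.
Proof. revert x; induction k as [|k IH]; intros x; simpl; [trivial|]. rewrite !IH; ring. Qed.

Lemma bdiff_scal h k c f x : bdiff h k (fun y => c * f y) x = c * bdiff h k f x.
Proof. revert x; induction k as [|k IH]; intros x; simpl; [trivial|]. rewrite !IH; ring. Qed.

Lemma bdiff_dilate h k c f x : bdiff (c * h) k f (c * x) = bdiff h k (fun y => f (c * y)) x.
Proof.
revert x; induction k as [|k IH]; intros x; simpl; [trivial|].
now rewrite <- !IH, Rmult_minus_distr_l.
Qed.

Lemma bdiff_ext h k f g x : (forall y, f y = g y) -> bdiff h k f x = bdiff h k g x.
Proof. intros H; revert x; induction k as [|k IH]; intros x; simpl; [apply H|]. now rewrite !IH. Qed.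

Lemma bdiff_ssum h k (f : nat -> R -> R) N x :
  bdiff h k (fun y => ssum (fun m => f m y) N) x = ssum (fun m => bdiff h k (f m) x) N.
Proof.
induction N as [|N IH].
  revert x; simpl; induction k as [|k IH]; intros x; simpl; [trivial|]. rewrite !IH; ring.
rewrite ssum_S, <- IH, <- bdiff_plus. reflexivity.
Qed.

Lemma bdiff_err h k f g x eps : 0 <= h ->
  (forall j, (j <= k)%nat -> Rabs (f (x - INR j * h) - g (x - INR j * h)) <= eps) ->
  Rabs (bdiff h k f x - bdiff h k g x) <= 2 ^ k * eps.
Proof.
intros Hh. revert x. induction k as [|k IH]; intros x H.
  generalize (H 0%nat (Nat.le_refl 0)). simpl. rewrite Rmult_0_l, Rminus_0_r. lra.
simpl.
replace (_ - _ - _) with ((bdiff h k f (x - h) - bdiff h k g (x - h)) + - (bdiff h k f x - bdiff h k g x)) by ring.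
eapply Rle_trans; [apply Rabs_triang|]. rewrite Rabs_Ropp.
replace (2 * 2 ^ k * eps) with (2 ^ k * eps + 2 ^ k * eps) by ring.
apply Rplus_le_compat; apply IH; intros j Hj.
  replace (x - h - INR j * h) with (x - INR (S j) * h) by (rewrite S_INR; ring). apply H; lia.
apply H; lia.
Qed.

(* [Gd k] is [(-1)^k] times the [k]-th derivative of [lcoth]. *)
Definition Gd (k : nat) (x : R) : R :=
  match k with
  | 0%nat => lcoth x
  | 1%nat => / sinh x
  | 2%nat => cosh x / sinh x ^ 2
  | 3%nat => / sinh x + 2 / sinh x ^ 3
  | 4%nat => cosh x / sinh x ^ 2 + 6 * cosh x / sinh x ^ 4
  | _ => / sinh x + 20 / sinh x ^ 3 + 24 / sinh x ^ 5
  end.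

Lemma is_derive_sinh x : is_derive sinh x (cosh x).
Proof. apply is_derive_Reals. apply derivable_pt_lim_sinh. Qed.
Lemma is_derive_cosh x : is_derive cosh x (sinh x).
Proof. apply is_derive_Reals. apply derivable_pt_lim_cosh. Qed.

Lemma Gd_derive j x : (j < 5)%nat -> 0 < x -> is_derive (Gd j) x (- Gd (S j) x).
Proof.
intros Hj Hx. assert (hs := sinh_pos x Hx). assert (hc := cosh_sq x).
assert (es : ex_derive sinh x) by (eexists; apply is_derive_sinh).
assert (ec : ex_derive cosh x) by (eexists; apply is_derive_cosh).
assert (ds : Derive sinh x = cosh x) by (apply is_derive_unique, is_derive_sinh).
assert (dc : Derive cosh x = sinh x) by (apply is_derive_unique, is_derive_cosh).
assert (hc2 : cosh x ^ 2 = 1 + sinh x * sinh x) by (rewrite <- hc; ring).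
assert (p2 : sinh x ^ 2 <> 0) by (apply pow_nonzero; lra).
assert (p3 : sinh x ^ 3 <> 0) by (apply pow_nonzero; lra).
assert (p4 : sinh x ^ 4 <> 0) by (apply pow_nonzero; lra).
destruct j as [|[|[|[|[|j]]]]]; [| | | | |lia]; unfold Gd.
- unfold lcoth. destruct (exp_neg_lt1 x Hx) as [h0 h1]. auto_derive.
    repeat split; try lra. apply Rdiv_lt_0_compat; lra.
  unfold sinh. set (e := exp (- x)) in *.
  replace (exp x) with (/ e) by (unfold e; rewrite exp_Ropp; field; apply Rgt_not_eq, exp_pos).
  field. repeat split; nra.
- auto_derive; [repeat split; trivial; lra|]. rewrite ?ds. field. lra.
- auto_derive; [repeat split; trivial; lra|]. rewrite ?ds, ?dc. field_simplify_eq; [|lra]. rewrite hc2; ring.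
- auto_derive; [repeat split; trivial; lra|]. rewrite ?ds. field. lra.
- auto_derive; [repeat split; trivial; lra|]. rewrite ?ds, ?dc. field_simplify_eq; [|lra]. rewrite hc2; ring.
Qed.

Lemma Gd_nonneg j x : 0 < x -> 0 <= Gd j x.
Proof.
intros Hx. assert (hs := sinh_pos x Hx). assert (hc := cosh_ge1 x).
assert (i1 : 0 < / sinh x) by (apply Rinv_0_lt_compat; trivial).
assert (P : forall n, 0 < / sinh x ^ n) by (intros; apply Rinv_0_lt_compat, pow_lt; trivial).
generalize (P 2%nat) (P 3%nat) (P 4%nat) (P 5%nat); intros.
destruct j as [|[|[|[|[|j]]]]]; unfold Gd, Rdiv; try nra.
apply Rlt_le. now apply lcoth_pos.
Qed.

Lemma Gd_decr j x y : (j <= 4)%nat -> 0 < x -> x <= y -> Gd j y <= Gd j x.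
Proof.
intros Hj Hx Hxy. enough (- Gd j x <= - Gd j y) by lra.
apply (derive_nonneg_le (fun z => - Gd j z) (Gd (S j))); trivial.
  intros z Hz. replace (Gd (S j) z) with (opp (- Gd (S j) z)) by (unfold opp; simpl; ring).
  apply (is_derive_opp (Gd j)). apply Gd_derive; [lia|lra].
intros z Hz; apply Gd_nonneg; lra.
Qed.

(* [(-1)^k] times the [k]-th derivative of [LamN N]. *)
Definition MN (k N : nat) (a : R) := ssum (fun m => INR m ^ k * Gd k (INR m * a)) N.

(** The signed derivative [MN k N] decreases, so a difference taken to the left of [a] bounds it
    from above and, in [MN_bdiff'], one taken to the right from below. Only values of [LamN]
    enter. *)
Lemma MN_bdiff k N a h : (k <= 4)%nat -> 0 < h -> 0 < a - INR k * h ->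
  h ^ k * MN k N a <= bdiff h k (LamN N) a.
Proof.
intros Hk Hh Ha. unfold MN, LamN. rewrite bdiff_ssum, <- ssum_scal.
apply ssum_le; intros m Hm. assert (Hm' := le_INR _ _ (proj1 Hm)). simpl in Hm'.
rewrite <- (bdiff_dilate h k (INR m) lcoth a).
generalize (bdiff_bounds Gd 4 (INR m * h) k 0 (INR m * a)
  ltac:(intros; apply Gd_derive; trivial; lia) ltac:(intros; now apply Gd_decr)
  ltac:(nra) Hk ltac:(nra)).
rewrite Nat.add_0_l, Rpow_mult_distr. change (Gd 0) with lcoth. intros [h1 _]. lra.
Qed.

Lemma MN_bdiff' k N a h : (k <= 4)%nat -> 0 < h -> 0 < a ->
  bdiff h k (LamN N) (a + INR k * h) <= h ^ k * MN k N a.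
Proof.
intros Hk Hh Ha. unfold MN, LamN. rewrite bdiff_ssum, <- ssum_scal.
apply ssum_le; intros m Hm. assert (Hm' := le_INR _ _ (proj1 Hm)). simpl in Hm'.
rewrite <- (bdiff_dilate h k (INR m) lcoth (a + INR k * h)).
generalize (bdiff_bounds Gd 4 (INR m * h) k 0 (INR m * (a + INR k * h))
  ltac:(intros; apply Gd_derive; trivial; lia) ltac:(intros; now apply Gd_decr)
  ltac:(nra) Hk ltac:(nra)).
rewrite Nat.add_0_l, Rpow_mult_distr. change (Gd 0) with lcoth. intros [_ h2].
replace (INR m * (a + INR k * h) - INR k * (INR m * h)) with (INR m * a) in h2 by ring. lra.
Qed.

(* [(-1)^j] times the [j]-th derivatives of [/ x] and of [- ln (x / (4 * PI))]. *)
Definition InvD (j : nat) (x : R) := INR (fact j) / x ^ S j.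
Definition LogD (j : nat) (x : R) :=
  match j with O => - ln (x / (4 * PI)) | S i => INR (fact i) / x ^ S i end.

Lemma is_derive_inv_pow c n x : 0 < x ->
  is_derive (fun y => c / y ^ S n) x (- (INR (S n) * c / x ^ S (S n))).
Proof.
intros Hx. assert (p : x ^ S n <> 0) by (apply pow_nonzero; lra).
assert (q : x ^ n <> 0) by (apply pow_nonzero; lra).
auto_derive; trivial. change (x * x ^ n) with (x ^ S n) in *.
change (match n with O => 1 | S _ => INR n + 1 end) with (INR (S n)).
simpl. generalize (INR n). intros; field. repeat split; trivial; lra.
Qed.

Lemma InvD_derive j y : 0 < y -> is_derive (InvD j) y (- InvD (S j) y).
Proof.
intros Hy. unfold InvD. rewrite fact_simpl, mult_INR. now apply is_derive_inv_pow.
Qed.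

Lemma LogD_derive j y : 0 < y -> is_derive (LogD j) y (- LogD (S j) y).
Proof.
intros Hy. destruct j as [|j].
  generalize PI_RGT_0; intros HP. unfold LogD. simpl fact.
  auto_derive; [|simpl; field; lra]. apply Rdiv_lt_0_compat; lra.
unfold LogD. rewrite fact_simpl, mult_INR. now apply is_derive_inv_pow.
Qed.

Lemma inv_pow_decr c n y z : 0 <= c -> 0 < y -> y <= z -> c / z ^ n <= c / y ^ n.
Proof.
intros Hc Hy Hz. unfold Rdiv. apply Rmult_le_compat_l; trivial.
apply Rinv_le_contravar; [now apply pow_lt|]. apply pow_incr; lra.
Qed.

Lemma InvD_decr j y z : 0 < y -> y <= z -> InvD j z <= InvD j y.
Proof. intros; apply inv_pow_decr; trivial. apply pos_INR. Qed.

Lemma LogD_decr j y z : 0 < y -> y <= z -> LogD j z <= LogD j y.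
Proof.
intros Hy Hz. destruct j as [|j]; [|apply inv_pow_decr; trivial; apply pos_INR].
generalize PI_RGT_0; intros HP. unfold LogD. apply Ropp_le_contravar, ln_le.
  apply Rdiv_lt_0_compat; lra.
apply Rmult_le_compat_r; trivial. apply Rlt_le, Rinv_0_lt_compat; lra.
Qed.

(** [Lmod] is a combination of [/ x] and [- ln (x / (4 * PI))], to each of which [bdiff_bounds]
    applies. The second has a negative weight, hence the opposite endpoints. *)
Lemma Lmod_bdiff h k x : 0 < h -> 0 < x - INR (S k) * h ->
  h ^ S k * (PI ^ 2 / 4 * InvD (S k) x - / 2 * LogD (S k) (x - INR (S k) * h))
  <= bdiff h (S k) Lmod x <=
  h ^ S k * (PI ^ 2 / 4 * InvD (S k) (x - INR (S k) * h) - / 2 * LogD (S k) x).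
Proof.
intros Hh Hx.
rewrite (bdiff_ext _ _ Lmod (fun y => PI ^ 2 / 4 * InvD 0 y + - / 2 * LogD 0 y)).
  2:{ intros y; unfold Lmod, InvD, LogD; simpl. rewrite !Rmult_1_r. unfold Rdiv; ring. }
rewrite bdiff_plus, !bdiff_scal.
generalize (bdiff_bounds InvD (S k) h (S k) 0 x ltac:(intros; now apply InvD_derive) ltac:(intros; now apply InvD_decr) Hh ltac:(lia) Hx).
generalize (bdiff_bounds LogD (S k) h (S k) 0 x ltac:(intros; now apply LogD_derive) ltac:(intros; now apply LogD_decr) Hh ltac:(lia) Hx).
rewrite Nat.add_0_l.
assert (0 < PI ^ 2 / 4) by (generalize PI_RGT_0; nra).
intros [h1 h2] [h3 h4]. split; nra.
Qed.

(** One error for all nodes of the differences: [16 / x] still exceeds [14 / a], and the 3 in place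
    of 2 leaves room for passing from [Lam] to [LamN]. *)
Lemma LamN_near a x : 0 < a <= / 25 -> 0 < x <= 11 / 10 * a ->
  exists N0, forall N, (N0 <= N)%nat -> Rabs (LamN N x - Lmod x) <= exp (3 - 14 / a).
Proof.
intros Ha Hx.
assert (He := Eerr_bounds x ltac:(lra)). unfold Eerr in He.
assert (hd : exp (2 - 16 / x) <= exp (2 - 14 / a)).
  apply exp_mono. enough (14 / a <= 16 / x) by lra.
  apply (Rmult_le_reg_r (a * x)); [nra|].
  replace (14 / a * (a * x)) with (14 * x) by (field; lra).
  replace (16 / x * (a * x)) with (16 * a) by (field; lra). lra.
assert (hlt : 0 < exp (3 - 14 / a) - exp (2 - 14 / a)) by (apply Rlt_0_minus, exp_increasing; lra).
assert (L := LamN_lim x ltac:(lra)). apply is_lim_seq_spec in L.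
destruct (L (mkposreal _ hlt)) as [N0 HN]. simpl in HN.
exists N0. intros N HN0. specialize (HN N HN0). apply Rabs_def2 in HN. apply Rabs_le. lra.
Qed.

Lemma eventually_forall_le (P : nat -> nat -> Prop) k :
  (forall j, (j <= k)%nat -> exists N0, forall N, (N0 <= N)%nat -> P j N) ->
  exists N0, forall N, (N0 <= N)%nat -> forall j, (j <= k)%nat -> P j N.
Proof.
induction k as [|k IH]; intros H.
  destruct (H 0%nat (Nat.le_refl _)) as [N0 HN]. exists N0; intros N HN0 j Hj.
  replace j with 0%nat by lia. now apply HN.
destruct IH as [N1 H1]; [intros; apply H; lia|].
destruct (H (S k) (Nat.le_refl _)) as [N2 H2]. exists (max N1 N2). intros N HN j Hj.
destruct (le_lt_dec j k); [apply H1; lia|]. replace j with (S k) by lia. apply H2; lia.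
Qed.

(** The error has to survive a division by up to [(a ^ 2 / 1000) ^ 4]. Half of the exponent yields
    the power of [a], the other half the numerical factor. *)
Lemma delta_small a : 0 < a <= / 25 -> exp (3 - 14 / a) <= a ^ 8 / 10 ^ 18.
Proof.
intros Ha.
assert (h1 : exp (- (7 / a)) <= 3 * a ^ 8).
  assert (e : exp (- (7 / a)) * exp (7 / a) = 1).
    rewrite <- exp_plus. replace (- (7 / a) + 7 / a) with 0 by ring. apply exp_0.
  assert (h : (7 / 8 / a) ^ 8 <= exp (7 / a)).
    replace (exp (7 / a)) with (exp (7 / 8 / a) ^ 8).
      2:{ rewrite exp_pow. f_equal. simpl; field; lra. }
    assert (0 < 7 / 8 / a) by (apply Rdiv_lt_0_compat; lra).
    apply pow_incr. split; [lra|]. generalize (exp_ineq1_le (7 / 8 / a)); lra.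
  assert (h' : / 3 / a ^ 8 <= (7 / 8 / a) ^ 8).
    replace ((7 / 8 / a) ^ 8) with ((7 / 8) ^ 8 / a ^ 8) by (field; lra).
    apply Rmult_le_compat_r; [apply Rlt_le, Rinv_0_lt_compat, pow_lt; lra|]. lra.
  apply (Rmult_le_reg_r (exp (7 / a))); [apply exp_pos|]. rewrite e.
  assert (0 < a ^ 8) by (apply pow_lt; lra).
  apply Rle_trans with (3 * a ^ 8 * (/ 3 / a ^ 8)); [apply Req_le; field; lra|].
  apply Rmult_le_compat_l; lra.
assert (h2 : exp (3 - 7 / a) <= / 10 ^ 20).
  apply Rle_trans with (exp (- 172)).
    apply exp_mono. enough (175 <= 7 / a) by lra.
    apply (Rmult_le_reg_r a); [lra|]. unfold Rdiv. rewrite Rmult_assoc, Rinv_l; lra.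
  replace (- 172) with (- (172 * 1)) by ring. rewrite exp_Ropp.
  replace (exp (172 * 1)) with (exp 1 ^ 172).
    2:{ rewrite exp_pow. f_equal. rewrite INR_IZR_INZ. reflexivity. }
  apply Rinv_le_contravar; [lra|].
  apply Rle_trans with (2 ^ 172); [lra|]. apply pow_incr. generalize (exp_ineq1_le 1); lra.
replace (3 - 14 / a) with (- (7 / a) + (3 - 7 / a)) by (field; lra).
rewrite exp_plus. assert (0 < a ^ 8) by (apply pow_lt; lra).
generalize (exp_pos (- (7 / a))) (exp_pos (3 - 7 / a)); intros.
apply Rle_trans with (3 * a ^ 8 * / 10 ^ 20); [apply Rmult_le_compat; lra|]. lra.
Qed.

(** [Lmod] predicts [(k + 1)! * PI ^ 2 / (4 a) - k! / 2]. The step is [h = a * t]: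
    [t = a ^ 2 / 1000] is small enough to move terms of size [/ a] very little, yet [t ^ 4] dwarfs
    the exponentially small error of [LamN]. *)
Lemma MN_near a : 0 < a <= / 25 ->
  exists N0, forall N, (N0 <= N)%nat ->
   Rabs (LamN N a - Lmod a) <= a / 10000 /\
   (forall k, (k <= 3)%nat ->
     let t := a ^ 2 / 1000 in
     a ^ S k * MN (S k) N a <=
       PI ^ 2 / 4 / a * (INR (fact (S k)) / (1 - INR (S k) * t) ^ S (S k)) - INR (fact k) / 2 + / 1000 /\
     PI ^ 2 / 4 / a * (INR (fact (S k)) / (1 + INR (S k) * t) ^ S (S k)) - INR (fact k) / 2 - / 1000
       <= a ^ S k * MN (S k) N a).
Proof.
intros Ha. set (h := a ^ 3 / 1000).
assert (Hh : 0 < h <= a / 100).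
  unfold h. split; [apply Rdiv_lt_0_compat; [apply pow_lt|]; lra|].
  assert (a ^ 3 <= a) by (simpl; assert (a * a <= 1) by nra; nra). lra.
(* Nine nodes, from [a + 4 h] down to [a - 4 h], serve all differences of order at most 4 on either
   side of [a]. *)
destruct (eventually_forall_le (fun j N => Rabs (LamN N (a + 4 * h - INR j * h) - Lmod (a + 4 * h - INR j * h)) <= exp (3 - 14 / a)) 8) as [N0 HN].
  intros j Hj. apply LamN_near; trivial. apply le_INR in Hj. simpl in Hj. generalize (pos_INR j); intros. nra.
exists N0. intros N HN0. specialize (HN N HN0).
assert (hd := delta_small a Ha). set (d := exp (3 - 14 / a)) in *.
assert (hd0 : 0 < d) by apply exp_pos.
assert (ha : 0 < a) by lra.
assert (HP : 0 < PI ^ 2 / 4) by (generalize PI_RGT_0; nra).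
split.
  generalize (HN 4%nat ltac:(lia)). replace (a + 4 * h - INR 4 * h) with a by (simpl; ring).
  intros H. eapply Rle_trans; [exact H|]. eapply Rle_trans; [exact hd|].
  assert (a ^ 8 <= a). rewrite <- (pow_1 a) at 2. apply pow_decr; [lra|lia]. lra.
intros k Hk t.
assert (Hk4 := le_INR _ _ Hk). simpl in Hk4. generalize (pos_INR k); intros Hk0.
assert (ht : h = a * t) by (unfold h, t; field).
assert (ht0 : 0 < t) by (unfold t; apply Rdiv_lt_0_compat; [apply pow_lt; lra|lra]).
assert (ht1 : t < / 1000) by (unfold t; assert (a ^ 2 < 1) by nra; lra).
assert (hhk : 0 < h ^ S k) by (apply pow_lt; lra).
assert (hak : 0 < a ^ S k) by (apply pow_lt; lra).
assert (hsm : a ^ S k * (2 ^ S k * d) <= h ^ S k * / 1000).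
  rewrite ht, Rpow_mult_distr, Rmult_assoc. apply Rmult_le_compat_l; [lra|].
  assert (ht4 : t ^ 4 <= t ^ S k) by (apply pow_decr; [lra|lia]).
  assert (h24 : 2 ^ S k <= 2 ^ 4) by (apply Rle_pow; [lra|lia]).
  assert (0 < 2 ^ S k) by (apply pow_lt; lra).
  apply Rle_trans with (2 ^ 4 * (a ^ 8 / 10 ^ 18)); [apply Rmult_le_compat; lra|].
  apply Rle_trans with (t ^ 4 * / 1000); [|lra].
  unfold t. replace ((a ^ 2 / 1000) ^ 4 * / 1000) with (a ^ 8 / 10 ^ 15) by field.
  assert (0 < a ^ 8) by (apply pow_lt; lra). lra.
assert (hIr : INR (S k) <= 4) by (rewrite S_INR; lra).
assert (hI0 : 0 <= INR (S k)) by apply pos_INR.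
assert (e1 : a ^ S k * LogD (S k) a = INR (fact k)) by (unfold LogD; field; lra).
split.
- assert (Hx : 0 < a - INR (S k) * h) by nra.
  assert (U := MN_bdiff (S k) N a h ltac:(lia) (proj1 Hh) Hx).
  destruct (Lmod_bdiff h k a (proj1 Hh) Hx) as [_ V].
  assert (W := bdiff_err h (S k) (LamN N) Lmod a d (Rlt_le _ _ (proj1 Hh))).
  specialize (W ltac:(intros j Hj; generalize (HN (4 + j)%nat ltac:(lia)); rewrite plus_INR;
     replace (a + 4 * h - (INR 4 + INR j) * h) with (a - INR j * h) by (simpl; ring); trivial)).
  apply Rabs_le_between in W.
  apply (Rmult_le_reg_l (h ^ S k)); trivial.
  replace (PI ^ 2 / 4 / a * (INR (fact (S k)) / (1 - INR (S k) * t) ^ S (S k)))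
    with (a ^ S k * (PI ^ 2 / 4 * InvD (S k) (a - INR (S k) * h))).
    2:{ unfold InvD. rewrite ht. replace (a - INR (S k) * (a * t)) with (a * (1 - INR (S k) * t)) by ring.
        rewrite Rpow_mult_distr.
        assert (0 < (1 - INR (S k) * t) ^ S (S k)) by (apply pow_lt; nra).
        rewrite <- (tech_pow_Rmult a (S k)). field. repeat split; lra. }
  rewrite <- e1. nra.
- assert (Hx : 0 < a + INR (S k) * h - INR (S k) * h) by lra.
  assert (U := MN_bdiff' (S k) N a h ltac:(lia) (proj1 Hh) ha).
  destruct (Lmod_bdiff h k _ (proj1 Hh) Hx) as [V _].
  replace (a + INR (S k) * h - INR (S k) * h) with a in V by ring.
  assert (W := bdiff_err h (S k) (LamN N) Lmod (a + INR (S k) * h) d (Rlt_le _ _ (proj1 Hh))).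
  assert (W' : forall j, (j <= S k)%nat -> Rabs (LamN N (a + INR (S k) * h - INR j * h) - Lmod (a + INR (S k) * h - INR j * h)) <= d).
    intros j Hj. replace (a + INR (S k) * h - INR j * h) with (a + 4 * h - INR (3 - k + j) * h).
      apply HN; lia.
    rewrite plus_INR, minus_INR, (S_INR k) by lia. simpl; ring.
  specialize (W W').
  apply Rabs_le_between in W.
  apply (Rmult_le_reg_l (h ^ S k)); trivial.
  replace (PI ^ 2 / 4 / a * (INR (fact (S k)) / (1 + INR (S k) * t) ^ S (S k)))
    with (a ^ S k * (PI ^ 2 / 4 * InvD (S k) (a + INR (S k) * h))).
    2:{ unfold InvD. rewrite ht. replace (a + INR (S k) * (a * t)) with (a * (1 + INR (S k) * t)) by ring.
        rewrite Rpow_mult_distr.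
        assert (0 < (1 + INR (S k) * t) ^ S (S k)) by (apply pow_lt; nra).
        rewrite <- (tech_pow_Rmult a (S k)). field. repeat split; lra. }
  rewrite <- e1. nra.
Qed.

(** * The integrand near and far from the saddle *)

Lemma sin_le_x x : 0 <= x -> sin x <= x.
Proof. intros [H| <-]; [now apply Rlt_le, sin_lt_x|rewrite sin_0; lra]. Qed.

Lemma cos_ge_quad x : 0 <= x -> 1 - x ^ 2 / 2 <= cos x.
Proof.
intros H. enough (cos 0 - (1 - 0 ^ 2 / 2) <= cos x - (1 - x ^ 2 / 2)) by (rewrite cos_0 in *; lra).
apply (derive_nonneg_le (fun x => cos x - (1 - x ^ 2 / 2)) (fun x => x - sin x)); trivial.
  intros y _. auto_derive; trivial. field.
intros y Hy. generalize (sin_le_x y (proj1 Hy)); lra.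
Qed.

Lemma sin_ge_cubic x : 0 <= x -> x - x ^ 3 / 6 <= sin x.
Proof.
intros H. enough (sin 0 - (0 - 0 ^ 3 / 6) <= sin x - (x - x ^ 3 / 6)) by (rewrite sin_0 in *; lra).
apply (derive_nonneg_le (fun x => sin x - (x - x ^ 3 / 6)) (fun x => cos x - (1 - x ^ 2 / 2))); trivial.
  intros y _. auto_derive; trivial. field.
intros y Hy. generalize (cos_ge_quad y (proj1 Hy)); lra.
Qed.

Lemma cos_le_quartic x : 0 <= x -> cos x <= 1 - x ^ 2 / 2 + x ^ 4 / 24.
Proof.
intros H. enough (1 - 0 ^ 2 / 2 + 0 ^ 4 / 24 - cos 0 <= 1 - x ^ 2 / 2 + x ^ 4 / 24 - cos x) by (rewrite cos_0 in *; lra).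
apply (derive_nonneg_le (fun x => 1 - x ^ 2 / 2 + x ^ 4 / 24 - cos x) (fun x => sin x - (x - x ^ 3 / 6))); trivial.
  intros y _. auto_derive; trivial. field.
intros y Hy. generalize (sin_ge_cubic y (proj1 Hy)); lra.
Qed.

Lemma atan_le_x y : 0 <= y -> atan y <= y.
Proof.
intros H. enough (0 - atan 0 <= y - atan y) by (rewrite atan_0 in *; lra).
apply (derive_nonneg_le (fun x => x - atan x) (fun x => 1 - / (1 + x²))); trivial.
  intros x _. auto_derive; trivial. unfold Rsqr. field. nra.
intros x _. unfold Rsqr. assert (/ (1 + x * x) <= / 1) by (apply Rinv_le_contravar; nra). lra.
Qed.

Lemma atan_ge_cubic y : 0 <= y -> y - y ^ 3 / 3 <= atan y.
Proof.
intros H. enough (atan 0 - (0 - 0 ^ 3 / 3) <= atan y - (y - y ^ 3 / 3)) by (rewrite atan_0 in *; lra).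
apply (derive_nonneg_le (fun x => atan x - (x - x ^ 3 / 3)) (fun x => / (1 + x²) - (1 - x ^ 2))); trivial.
  intros x _. auto_derive; trivial. unfold Rsqr. field. nra.
intros x _. unfold Rsqr. assert (hx : 0 < 1 + x * x) by nra.
replace (/ (1 + x * x) - (1 - x ^ 2)) with (x ^ 4 / (1 + x * x)) by (field; lra).
apply Rdiv_le_0_compat; trivial. replace (x ^ 4) with ((x * x) * (x * x)) by ring. nra.
Qed.

(** [alp x phi] is the imaginary part of [lcoth (x - i phi)], so these are its Taylor polynomials in
    [phi]. They hold for all [phi >= 0], including those where the sine is negative. *)
Lemma alp_bounds x phi : 0 < x -> 0 <= phi ->
  Gd 1 x * phi - Gd 3 x * phi ^ 3 / 6 <= alp x phi <= Gd 1 x * phi.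
Proof.
intros Hx Hp. assert (hs := sinh_pos x Hx). unfold alp, Gd.
assert (hi : 0 < / sinh x) by now apply Rinv_0_lt_compat.
assert (s1 := sin_le_x phi Hp). assert (s2 := sin_ge_cubic phi Hp).
set (y := sin phi / sinh x).
assert (yE : y = sin phi * / sinh x) by reflexivity.
split.
- assert (L : y - phi ^ 3 / (3 * sinh x ^ 3) <= atan y).
    destruct (Rle_lt_dec 0 y) as [Hy|Hy].
      eapply Rle_trans; [|now apply atan_ge_cubic].
      enough (y ^ 3 / 3 <= phi ^ 3 / (3 * sinh x ^ 3)) by lra.
      replace (phi ^ 3 / (3 * sinh x ^ 3)) with ((phi * / sinh x) ^ 3 / 3) by (field; lra).
      apply Rmult_le_compat_r; [lra|]. apply pow_incr. split; trivial. rewrite yE. nra.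
    assert (h : 0 <= phi ^ 3 / (3 * sinh x ^ 3)).
      apply Rdiv_le_0_compat; [now apply pow_le|]. assert (0 < sinh x ^ 3) by now apply pow_lt. lra.
    assert (h2 := atan_le_x (- y) ltac:(lra)). rewrite atan_opp in h2. lra.
  eapply Rle_trans; [|exact L].
  replace (/ sinh x * phi - (/ sinh x + 2 / sinh x ^ 3) * phi ^ 3 / 6) with
    (/ sinh x * (phi - phi ^ 3 / 6) - phi ^ 3 / (3 * sinh x ^ 3)) by (field; lra).
  rewrite yE. nra.
- destruct (Rle_lt_dec 0 y) as [Hy|Hy].
    apply Rle_trans with y; [now apply atan_le_x|]. rewrite yE. nra.
  assert (atan y < 0) by (rewrite <- atan_0; now apply atan_increasing). nra.
Qed.

(* [rho x 0 / rho x phi = exp (hlog x phi)] *)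
Definition Vlog (x c : R) := / 2 * ln ((cosh x + c) / (cosh x - c)).
Definition hlog (x phi : R) := Vlog x 1 - Vlog x (cos phi).

Lemma Vlog_1 x : 0 < x -> Vlog x 1 = lcoth x.
Proof.
intros Hx. unfold Vlog, lcoth. destruct (exp_neg_lt1 x Hx) as [h0 h1].
set (e := exp (- x)) in *.
assert (hq : 0 < (1 + e) / (1 - e)) by (apply Rdiv_lt_0_compat; lra).
replace ((cosh x + 1) / (cosh x - 1)) with ((1 + e) / (1 - e) * ((1 + e) / (1 - e))).
  rewrite ln_mult by trivial. field.
unfold cosh. fold e. replace (exp x) with (/ e).
  2:{ unfold e. rewrite exp_Ropp. field. apply Rgt_not_eq, exp_pos. }
field. repeat split; try lra. nra.
Qed.

Lemma rho_hlog x phi : 0 < x -> rho x phi = exp (lcoth x) * exp (- hlog x phi).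
Proof.
intros Hx. rewrite <- exp_plus. unfold hlog. rewrite Vlog_1 by trivial.
replace (lcoth x + - (lcoth x - Vlog x (cos phi))) with (Vlog x (cos phi)) by ring.
generalize (cosh_gt1 x Hx) (COS_bound phi); intros hc hb.
assert (hp : 0 < (cosh x + cos phi) / (cosh x - cos phi)) by (apply Rdiv_lt_0_compat; lra).
unfold rho, Vlog. rewrite <- Rpower_sqrt by trivial. reflexivity.
Qed.

Lemma is_derive_Vlog x c : 0 < x -> -1 <= c <= 1 ->
  is_derive (Vlog x) c (cosh x / (cosh x ^ 2 - c ^ 2)).
Proof.
intros Hx Hc. assert (h := cosh_gt1 x Hx). unfold Vlog. auto_derive.
  repeat split; try lra. apply Rdiv_lt_0_compat; lra.
field. repeat split; nra.
Qed.

(** As a function of [c], the slope of [Vlog x] on [[cos phi, 1]] is at most its value at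
    [c = 1]. *)
Lemma hlog_le x phi : 0 < x -> hlog x phi <= (1 - cos phi) * (cosh x / sinh x ^ 2).
Proof.
intros Hx. generalize (cosh_gt1 x Hx) (COS_bound phi) (sinh_pos x Hx) (cosh_sq x); intros hc hb hs hq.
set (k := cosh x / sinh x ^ 2).
enough (k * cos phi - Vlog x (cos phi) <= k * 1 - Vlog x 1) by (unfold hlog; lra).
apply (derive_nonneg_le (fun c => k * c - Vlog x c) (fun c => k - cosh x / (cosh x ^ 2 - c ^ 2))); [lra| |].
  intros c Hc. apply (is_derive_minus (fun c => k * c)); [auto_derive; trivial; ring|].
  apply is_derive_Vlog; lra.
intros c Hc. unfold k, Rdiv. rewrite <- Rmult_minus_distr_l. apply Rmult_le_pos; [lra|].
enough (/ (cosh x ^ 2 - c ^ 2) <= / sinh x ^ 2) by lra.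
apply Rinv_le_contravar; nra.
Qed.

(** Here the slope is bounded by its least value, at [c = 0]. This is weak for small [x], but needs
    no smallness of [phi]. *)
Lemma hlog_ge_cosh x phi : 0 < x -> (1 - cos phi) * / cosh x <= hlog x phi.
Proof.
intros Hx. generalize (cosh_gt1 x Hx) (COS_bound phi) (sinh_pos x Hx) (cosh_sq x); intros hc hb hs hq.
set (k := / cosh x).
enough (Vlog x (cos phi) - k * cos phi <= Vlog x 1 - k * 1) by (unfold hlog; lra).
apply (derive_nonneg_le (fun c => Vlog x c - k * c) (fun c => cosh x / (cosh x ^ 2 - c ^ 2) - k)); [lra| |].
  intros c Hc. apply (is_derive_minus (Vlog x)); [|auto_derive; trivial; ring].
  apply is_derive_Vlog; lra.
intros c Hc. unfold k.
replace (cosh x / (cosh x ^ 2 - c ^ 2) - / cosh x) with (c ^ 2 / ((cosh x ^ 2 - c ^ 2) * cosh x)) by (field; split; nra).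
apply Rdiv_le_0_compat; [nra|]. apply Rmult_lt_0_compat; nra.
Qed.

(** The slope lies above its tangent at [c = 1]. *)
Lemma hlog_ge x phi : 0 < x ->
  cosh x / sinh x ^ 2 * ((1 - cos phi) - (1 - cos phi) ^ 2 / sinh x ^ 2) <= hlog x phi.
Proof.
intros Hx. generalize (cosh_gt1 x Hx) (COS_bound phi) (sinh_pos x Hx) (cosh_sq x); intros hc hb hs hq.
set (k := cosh x / sinh x ^ 2). assert (hs2 : 0 < sinh x ^ 2) by nra.
enough (Vlog x (cos phi) + k * ((1 - cos phi) - (1 - cos phi) ^ 2 / sinh x ^ 2) <=
  Vlog x 1 + k * ((1 - 1) - (1 - 1) ^ 2 / sinh x ^ 2)).
  unfold hlog. unfold Rdiv in *. lra.
apply (derive_nonneg_le (fun c => Vlog x c + k * ((1 - c) - (1 - c) ^ 2 / sinh x ^ 2))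
  (fun c => cosh x / (cosh x ^ 2 - c ^ 2) - k * (1 - 2 * (1 - c) / sinh x ^ 2))); [lra| |].
  intros c Hc. evar_last.
    apply (is_derive_plus (Vlog x)); [apply is_derive_Vlog; lra|].
    instantiate (1 := - (k * (1 - 2 * (1 - c) / sinh x ^ 2))). auto_derive; trivial. field. lra.
  unfold plus; simpl; ring.
intros c Hc. unfold k.
assert (hD : 0 < cosh x ^ 2 - c ^ 2) by nra.
replace (cosh x ^ 2) with (sinh x ^ 2 + 1) in * by (simpl; lra).
replace (cosh x / (sinh x ^ 2 + 1 - c ^ 2) - cosh x / sinh x ^ 2 * (1 - 2 * (1 - c) / sinh x ^ 2)) with
  (cosh x * (sinh x ^ 2 * (1 - c) ^ 2 + 2 * (1 - c) ^ 2 * (1 + c)) / ((sinh x ^ 2 + 1 - c ^ 2) * sinh x ^ 4)).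
  2:{ field. split; lra. }
apply Rdiv_le_0_compat.
  apply Rmult_le_pos; [lra|]. assert (0 <= (1 - c) ^ 2) by nra. nra.
apply Rmult_lt_0_compat; trivial. now apply pow_lt.
Qed.

(** The analogue of [alp_bounds] for the real part of [lcoth (x - i phi)]. *)
Lemma hlog_bounds x phi : 0 < x -> 0 <= phi ->
  Gd 2 x * phi ^ 2 / 2 - Gd 4 x * phi ^ 4 / 24 <= hlog x phi <= Gd 2 x * phi ^ 2 / 2.
Proof.
intros Hx Hp. generalize (cosh_gt1 x Hx) (COS_bound phi) (sinh_pos x Hx); intros hc hb hs.
assert (c1 := cos_ge_quad phi Hp). assert (c2 := cos_le_quartic phi Hp).
assert (hs2 : 0 < sinh x ^ 2) by nra.
assert (hk : 0 < cosh x / sinh x ^ 2) by (apply Rdiv_lt_0_compat; lra).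
unfold Gd. split.
- eapply Rle_trans; [|now apply hlog_ge].
  replace (cosh x / sinh x ^ 2 * phi ^ 2 / 2 - (cosh x / sinh x ^ 2 + 6 * cosh x / sinh x ^ 4) * phi ^ 4 / 24)
    with (cosh x / sinh x ^ 2 * (phi ^ 2 / 2 - phi ^ 4 / 24 - (phi ^ 2 / 2) ^ 2 / sinh x ^ 2)) by (field; lra).
  apply Rmult_le_compat_l; [lra|].
  assert ((1 - cos phi) ^ 2 / sinh x ^ 2 <= (phi ^ 2 / 2) ^ 2 / sinh x ^ 2).
    apply Rmult_le_compat_r; [apply Rlt_le, Rinv_0_lt_compat; trivial|]. apply pow_incr; lra.
  lra.
- eapply Rle_trans; [now apply hlog_le|].
  replace (cosh x / sinh x ^ 2 * phi ^ 2 / 2) with (phi ^ 2 / 2 * (cosh x / sinh x ^ 2)) by (field; lra).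
  apply Rmult_le_compat_r; lra.
Qed.

Definition HN a N t := ssum (fun m => hlog (INR m * a) (INR m * t)) N.

Lemma Rmod_HN a N t : 0 < a -> Rmod a N t = exp (LamN N a) * exp (- HN a N t).
Proof.
intros H; induction N as [|N IH].
  unfold Rmod, LamN, HN; simpl. rewrite Ropp_0, exp_0. ring.
rewrite Rmod_S, IH, rho_hlog by now apply INR_S_mult_pos.
unfold LamN, HN. rewrite !ssum_S, Ropp_plus_distr, !exp_plus. ring.
Qed.

Lemma HN_bounds a N t : 0 < a -> 0 <= t ->
  MN 2 N a * t ^ 2 / 2 - MN 4 N a * t ^ 4 / 24 <= HN a N t <= MN 2 N a * t ^ 2 / 2.
Proof.
intros Ha Ht. unfold HN, MN.
assert (P : forall m, (1 <= m <= N)%nat -> 0 < INR m * a /\ 0 <= INR m * t).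
  intros m Hm. assert (h := le_INR _ _ (proj1 Hm)). simpl in h. split; nra.
split.
- replace (ssum (fun m => INR m ^ 2 * Gd 2 (INR m * a)) N * t ^ 2 / 2 -
    ssum (fun m => INR m ^ 4 * Gd 4 (INR m * a)) N * t ^ 4 / 24) with
   (ssum (fun m => t ^ 2 / 2 * (INR m ^ 2 * Gd 2 (INR m * a)) + - (t ^ 4 / 24) * (INR m ^ 4 * Gd 4 (INR m * a))) N)
   by (rewrite ssum_plus, !ssum_scal; field).
  apply ssum_le; intros m Hm. destruct (P m Hm) as [h1 h2].
  destruct (hlog_bounds _ _ h1 h2) as [h _]. rewrite !Rpow_mult_distr in h. lra.
- replace (ssum (fun m => INR m ^ 2 * Gd 2 (INR m * a)) N * t ^ 2 / 2) with
   (ssum (fun m => t ^ 2 / 2 * (INR m ^ 2 * Gd 2 (INR m * a))) N)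
   by (rewrite !ssum_scal; field).
  apply ssum_le; intros m Hm. destruct (P m Hm) as [h1 h2].
  destruct (hlog_bounds _ _ h1 h2) as [_ h]. rewrite !Rpow_mult_distr in h. lra.
Qed.

Lemma Aarg_bounds a N t : 0 < a -> 0 <= t ->
  MN 1 N a * t - MN 3 N a * t ^ 3 / 6 <= Aarg a N t <= MN 1 N a * t.
Proof.
intros Ha Ht. unfold Aarg, MN.
assert (P : forall m, (1 <= m <= N)%nat -> 0 < INR m * a /\ 0 <= INR m * t).
  intros m Hm. assert (h := le_INR _ _ (proj1 Hm)). simpl in h. split; nra.
split.
- replace (ssum (fun m => INR m ^ 1 * Gd 1 (INR m * a)) N * t -
    ssum (fun m => INR m ^ 3 * Gd 3 (INR m * a)) N * t ^ 3 / 6) with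
   (ssum (fun m => t * (INR m ^ 1 * Gd 1 (INR m * a)) + - (t ^ 3 / 6) * (INR m ^ 3 * Gd 3 (INR m * a))) N)
   by (rewrite ssum_plus, !ssum_scal; field).
  apply ssum_le; intros m Hm. destruct (P m Hm) as [h1 h2].
  destruct (alp_bounds _ _ h1 h2) as [h _]. rewrite !Rpow_mult_distr in h. rewrite pow_1. lra.
- replace (ssum (fun m => INR m ^ 1 * Gd 1 (INR m * a)) N * t) with
   (ssum (fun m => t * (INR m ^ 1 * Gd 1 (INR m * a))) N)
   by (rewrite !ssum_scal; ring).
  apply ssum_le; intros m Hm. destruct (P m Hm) as [h1 h2].
  destruct (alp_bounds _ _ h1 h2) as [_ h]. rewrite pow_1. lra.
Qed.

(** * Lower bounds for [HN] far from the saddle *)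

Lemma ssum_geom_cos r t N :
  (1 - 2 * r * cos t + r ^ 2) * ssum (fun m => r ^ m * cos (INR m * t)) N =
  r * cos t - r ^ 2 - r ^ S N * cos (INR (S N) * t) + r ^ S (S N) * cos (INR N * t).
Proof.
induction N as [|N IH].
  simpl. rewrite Rmult_1_l, Rmult_0_l, cos_0. ring.
rewrite ssum_S, Rmult_plus_distr_l, IH.
assert (E : cos (INR (S (S N)) * t) + cos (INR N * t) = 2 * cos t * cos (INR (S N) * t)).
  rewrite !S_INR. replace ((INR N + 1 + 1) * t) with ((INR N + 1) * t + t) by ring.
  replace (INR N * t) with ((INR N + 1) * t - t) by ring. rewrite cos_plus, cos_minus. ring.
rewrite <- !tech_pow_Rmult.
replace (cos (INR N * t)) with (2 * cos t * cos (INR (S N) * t) - cos (INR (S (S N)) * t)) by lra.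
ring.
Qed.

(** Replacing [/ cosh] by the smaller [exp (- x)] makes the sum geometric, hence explicit for every
    [t] up to [PI]. *)
Lemma HN_ge_geom a N t : 0 < a ->
  ssum (fun m => exp (- a) ^ m * (1 - cos (INR m * t))) N <= HN a N t.
Proof.
intros Ha. apply ssum_le; intros m Hm. assert (h := le_INR _ _ (proj1 Hm)). simpl in h.
assert (hx : 0 < INR m * a) by nra.
eapply Rle_trans; [|now apply hlog_ge_cosh].
rewrite Rmult_comm. apply Rmult_le_compat_l; [generalize (COS_bound (INR m * t)); lra|].
rewrite exp_pow. replace (INR m * - a) with (- (INR m * a)) by ring. rewrite exp_Ropp.
apply Rinv_le_contravar; [generalize (cosh_ge1 (INR m * a)); lra|].
unfold cosh. enough (exp (- (INR m * a)) <= exp (INR m * a)) by lra. apply exp_mono; lra.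
Qed.

(** The fraction is the sum of the full series. The truncation error is uniform in [t] because the
    denominator is at least [(1 - r) ^ 2]. *)
Lemma geom_cos_lower a : 0 < a -> let r := exp (- a) in
  exists N0, forall N, (N0 <= N)%nat -> forall t,
  r * (1 + r) * (1 - cos t) / ((1 - r) * ((1 - r) ^ 2 + 2 * r * (1 - cos t))) - / 1000 <= HN a N t.
Proof.
intros Ha r. destruct (exp_neg_lt1 a Ha) as [h0 h1]. fold r in h0, h1.
assert (L : is_lim_seq (fun N => (/ (1 - r) + 2 / (1 - r) ^ 2) * r ^ N) 0).
  replace (Finite 0) with (Rbar_mult (/ (1 - r) + 2 / (1 - r) ^ 2) 0) by (simpl; f_equal; ring).
  apply is_lim_seq_scal_l. apply is_lim_seq_geom. rewrite Rabs_right; lra.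
apply is_lim_seq_spec in L. destruct (L (mkposreal (/ 1000) ltac:(lra))) as [N0 HN0]. change (pos (mkposreal (/ 1000) _)) with (/ 1000) in HN0.
exists N0. intros N HN1 s. specialize (HN0 N HN1). cbv beta in HN0. rewrite Rminus_0_r in HN0. apply Rabs_def2 in HN0.
eapply Rle_trans; [|now apply HN_ge_geom]. fold r.
assert (hc := COS_bound s).
set (D := (1 - r) ^ 2 + 2 * r * (1 - cos s)).
assert (hD : (1 - r) ^ 2 <= D) by (unfold D; nra).
assert (hD0 : 0 < (1 - r) ^ 2) by nra.
assert (E := ssum_geom_cos r s N).
replace (1 - 2 * r * cos s + r ^ 2) with D in E by (unfold D; ring).
rewrite (ssum_ext _ (fun m => r ^ m + - 1 * (r ^ m * cos (INR m * s)))) by (intros; ring).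
rewrite ssum_plus, ssum_scal, ssum_geom by lra.
set (C := ssum _ N) in *.
assert (EC : C = (r * cos s - r ^ 2) / D + (- r ^ S N * cos (INR (S N) * s) + r ^ S (S N) * cos (INR N * s)) / D).
  apply (Rmult_eq_reg_l D); [|lra]. rewrite E. field. lra.
assert (hr : 0 <= r ^ N) by (apply pow_le; lra).
assert (B1 : - r ^ S N * cos (INR (S N) * s) + r ^ S (S N) * cos (INR N * s) <= 2 * r ^ N).
  rewrite <- !tech_pow_Rmult. generalize (COS_bound (INR (S N) * s)) (COS_bound (INR N * s)); intros [x1 x2] [y1 y2].
  assert (z1 : 0 <= r * r ^ N <= r ^ N) by nra. set (z := r * r ^ N) in *.
  assert (z2 : 0 <= r * z <= z) by nra. nra.
assert (B2 : (- r ^ S N * cos (INR (S N) * s) + r ^ S (S N) * cos (INR N * s)) / D <= 2 / (1 - r) ^ 2 * r ^ N).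
  apply Rle_trans with (2 * r ^ N / D).
    apply Rmult_le_compat_r; [apply Rlt_le, Rinv_0_lt_compat; lra|lra].
  replace (2 / (1 - r) ^ 2 * r ^ N) with (2 * r ^ N / (1 - r) ^ 2) by (field; lra).
  unfold Rdiv. apply Rmult_le_compat_l; [lra|]. apply Rinv_le_contravar; lra.
replace (r * (1 - r ^ N) / (1 - r)) with (r / (1 - r) - r * / (1 - r) * r ^ N) by (field; lra).
replace (r * (1 + r) * (1 - cos s) / ((1 - r) * D)) with (r / (1 - r) - (r * cos s - r ^ 2) / D).
  2:{ unfold D; field. fold D. split; lra. }
assert (hi : 0 < / (1 - r)) by (apply Rinv_0_lt_compat; lra).
assert (r * / (1 - r) * r ^ N <= / (1 - r) * r ^ N) by (apply Rmult_le_compat_r; nra).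
rewrite EC. rewrite Rmult_plus_distr_r in HN0.
set (x := (- r ^ S N * _ + _) / D) in *. set (y := 2 / (1 - r) ^ 2 * r ^ N) in *.
set (z := r * / (1 - r) * r ^ N) in *. set (v := / (1 - r) * r ^ N) in *.
set (w := (r * cos s - r ^ 2) / D). lra.
Qed.

(** That is, [2 * tanh (a / 2) <= a]. *)
Lemma tanh_half_le a : 0 <= a -> 2 * (1 - exp (- a)) <= a * (1 + exp (- a)).
Proof.
intros H. enough (0 * (1 + exp (- 0)) - 2 * (1 - exp (- 0)) <= a * (1 + exp (- a)) - 2 * (1 - exp (- a))).
  rewrite Ropp_0, exp_0 in *. lra.
apply (derive_nonneg_le (fun a => a * (1 + exp (- a)) - 2 * (1 - exp (- a))) (fun a => 1 - exp (- a) * (1 + a))); trivial.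
  intros x _. auto_derive; trivial. ring.
intros x Hx. generalize (exp_ineq1_le x) (exp_pos (- x)). assert (exp x * exp (- x) = 1).
  rewrite <- exp_plus. replace (x + - x) with 0 by ring. apply exp_0.
nra.
Qed.

Lemma geom_kernel_lower a t p q : 0 < a <= 3 / 100 -> q * a <= t <= PI -> 0 <= q <= 1 -> 0 <= p < 1 ->
  p <= 2 * (97 / 100) * (q ^ 2 / 2 - / 10000) * (1 - p) ->
  let r := exp (- a) in
  p / a <= r * (1 + r) * (1 - cos t) / ((1 - r) * ((1 - r) ^ 2 + 2 * r * (1 - cos t))).
Proof.
intros Ha Ht Hq Hp Hpq r. destruct (exp_neg_lt1 a ltac:(lra)) as [h0 h1]. fold r in h0, h1.
assert (hr : 1 - a <= r) by (generalize (exp_ineq1_le (- a)); fold r; lra).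
assert (ht := tanh_half_le a ltac:(lra)). fold r in ht.
assert (hqa : 0 <= q * a) by nra.
assert (hc : cos t <= cos (q * a)).
  destruct (proj1 Ht) as [h| <-]; [|lra]. apply Rlt_le, cos_decreasing_1; lra.
assert (hc2 := cos_le_quartic (q * a) hqa).
set (d := 1 - cos t) in *.
assert (hd : (q ^ 2 / 2 - / 10000) * a ^ 2 <= d).
  assert ((q * a) ^ 4 / 24 <= / 10000 * a ^ 2).
    replace ((q * a) ^ 4 / 24) with (q ^ 4 * a ^ 2 / 24 * a ^ 2) by field.
    apply Rmult_le_compat_r; [nra|].
    assert (q ^ 4 <= 1) by (rewrite <- (pow1 4); apply pow_incr; lra).
    assert (0 <= q ^ 4) by (apply pow_le; lra). nra.
  unfold d. nra.
assert (hd0 : 0 <= d) by (unfold d; generalize (COS_bound t); lra).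
set (D := (1 - r) ^ 2 + 2 * r * d).
assert (hD : 0 < D) by (unfold D; nra).
assert (h2 : p * D <= 2 * r * d).
  enough (p * (1 - r) ^ 2 <= 2 * r * d * (1 - p)) by (unfold D; nra).
  apply Rle_trans with (p * a ^ 2); [apply Rmult_le_compat_l; [lra|apply pow_incr; lra]|].
  apply Rle_trans with (2 * (97 / 100) * d * (1 - p)).
    apply Rle_trans with (2 * (97 / 100) * ((q ^ 2 / 2 - / 10000) * a ^ 2) * (1 - p)); [nra|].
    apply Rmult_le_compat_r; lra.
  apply Rmult_le_compat_r; [lra|]. apply Rmult_le_compat_r; lra.
apply (Rmult_le_reg_r (a * ((1 - r) * D))); [apply Rmult_lt_0_compat; [lra|apply Rmult_lt_0_compat; lra]|].
replace (p / a * (a * ((1 - r) * D))) with ((p * D) * (1 - r)) by (field; lra).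
replace (r * (1 + r) * d / ((1 - r) * D) * (a * ((1 - r) * D))) with ((2 * r * d) * (a * (1 + r) / 2)) by (field; lra).
apply Rmult_le_compat; [nra|lra|trivial|lra].
Qed.

Lemma PI_bounds : 3.14159265 < PI < 3.14159266.
Proof.
generalize (PI_2_3_7_ineq 4). unfold PI_2_3_7_tg, tg_alt, Ratan_seq. simpl. lra.
Qed.

(** * The saddle point integral *)

Definition Gb (b x : R) := RInt (fun u => exp (- (b * u ^ 2))) 0 x.

Lemma Gb_gint b x : 0 < b -> Gb b x = gint (sqrt b * x) / sqrt b.
Proof.
intros Hb. assert (hs := sqrt_lt_R0 b Hb).
assert (E := RInt_comp_lin (fun t => exp (- (t * t))) (sqrt b) 0 0 x).
rewrite Rmult_0_r, !Rplus_0_r in E. unfold gint. rewrite <- E by apply ex_RInt_gauss.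
rewrite (RInt_scal (V := R_CompleteNormedModule)) by (apply ex_RInt_ex_derive; intros t; auto_derive; trivial).
unfold scal; simpl; unfold mult; simpl. unfold Gb.
transitivity (RInt (fun y => exp (- ((sqrt b * y + 0) * (sqrt b * y + 0)))) 0 x).
  2:{ assert (aux : forall s I : R, s <> 0 -> I = s * I / s) by (intros; field; trivial). apply aux; lra. }
apply RInt_ext. intros t _. f_equal. rewrite <- (sqrt_sqrt b) at 1 by lra. ring.
Qed.

Lemma Gb_bounds b x : 0 < b -> 0 <= x ->
  sqrt (PI / b) / 2 * (1 - exp (- (b * x ^ 2))) <= Gb b x <= sqrt (PI / b) / 2.
Proof.
intros Hb Hx. assert (hs := sqrt_lt_R0 b Hb). rewrite Gb_gint by trivial.
rewrite sqrt_div_alt by trivial.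
destruct (gint_bounds (sqrt b * x) ltac:(nra)) as [h1 h2].
replace (sqrt b * x * (sqrt b * x)) with (b * x ^ 2) in h1
  by (rewrite <- (sqrt_sqrt b) at 1 by lra; ring).
split.
  replace (sqrt PI / sqrt b / 2 * (1 - exp (- (b * x ^ 2)))) with (sqrt PI / 2 * (1 - exp (- (b * x ^ 2))) / sqrt b) by (field; lra).
  apply Rmult_le_compat_r; trivial. apply Rlt_le, Rinv_0_lt_compat; lra.
replace (sqrt PI / sqrt b / 2) with (sqrt PI / 2 / sqrt b) by (field; lra).
apply Rmult_le_compat_r; trivial. apply Rlt_le, Rinv_0_lt_compat; lra.
Qed.

Lemma is_derive_gauss b u :
  is_derive (fun u => exp (- (b * u ^ 2))) u (- (2 * b * u) * exp (- (b * u ^ 2))).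
Proof. auto_derive; trivial. simpl. ring. Qed.

(* Integrals of a polynomial against the Gaussian weight: [Q exp (- b u^2)] is a primitive of
   [(P - r) exp (- b u^2)]. *)
Lemma RInt_poly_gauss (P Q : R -> R) b r x :
  (forall u, is_derive Q u (P u - r + 2 * b * u * Q u)) -> (forall u, ex_derive P u) -> Q 0 = 0 ->
  RInt (fun u => P u * exp (- (b * u ^ 2))) 0 x = r * Gb b x + Q x * exp (- (b * x ^ 2)).
Proof.
intros HQ HP H0.
assert (exP : forall u v, ex_RInt (fun u => P u * exp (- (b * u ^ 2))) u v).
  intros; apply ex_RInt_ex_derive; intros t. apply ex_derive_mult; [apply HP|]. auto_derive; trivial.
assert (exE : forall u v, ex_RInt (fun u => exp (- (b * u ^ 2))) u v).
  intros; apply ex_RInt_ex_derive; intros t. auto_derive; trivial.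
assert (E : is_RInt (fun u => P u * exp (- (b * u ^ 2)) - r * exp (- (b * u ^ 2))) 0 x
   (minus (Q x * exp (- (b * x ^ 2))) (Q 0 * exp (- (b * 0 ^ 2))))).
  apply (is_RInt_derive (fun u => Q u * exp (- (b * u ^ 2)))).
    intros u _. evar_last.
      apply (is_derive_mult Q (fun u => exp (- (b * u ^ 2)))); [apply HQ|apply is_derive_gauss|intros; apply Rmult_comm].
    unfold plus, mult; simpl. ring.
  intros u _. apply (ex_derive_continuous (fun u => P u * exp (- (b * u ^ 2)) - r * exp (- (b * u ^ 2)))).
  apply (ex_derive_minus (fun u => P u * exp (- (b * u ^ 2)))).
    apply ex_derive_mult; [apply HP|]. auto_derive; trivial.
  auto_derive; trivial.
apply (is_RInt_unique (V := R_CompleteNormedModule)) in E.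
rewrite (RInt_minus (V := R_CompleteNormedModule) (fun u => P u * exp (- (b * u ^ 2)))) in E; trivial.
  2:{ apply (ex_RInt_scal (V := R_NormedModule)). apply exE. }
rewrite (RInt_scal (V := R_CompleteNormedModule) (fun u => exp (- (b * u ^ 2)))) in E by apply exE.
change (RInt (fun u => P u * exp (- (b * u ^ 2))) 0 x - r * Gb b x =
  Q x * exp (- (b * x ^ 2)) - Q 0 * exp (- (b * 0 ^ 2))) in E.
rewrite H0 in E. lra.
Qed.

Lemma RInt_lower_main b c l x : 0 < b -> 0 <= c -> 0 <= l -> 0 <= x ->
  (1 - (c ^ 2 / (4 * b) + 3 * c * l / (4 * b ^ 2) + 15 * l ^ 2 / (16 * b ^ 3))) * Gb b x <=
  RInt (fun u => (1 - (c * u + l * u ^ 3) ^ 2 / 2) * exp (- (b * u ^ 2))) 0 x.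
Proof.
intros Hb Hc Hl Hx.
set (q5 := l ^ 2 / (4 * b)). set (q3 := (5 * q5 + c * l) / (2 * b)). set (q1 := (3 * q3 + c ^ 2 / 2) / (2 * b)).
assert (0 <= q5) by (apply Rdiv_le_0_compat; nra).
assert (0 <= q3) by (apply Rdiv_le_0_compat; nra).
assert (0 <= q1) by (apply Rdiv_le_0_compat; nra).
rewrite (RInt_poly_gauss (fun u => 1 - (c * u + l * u ^ 3) ^ 2 / 2) (fun u => q1 * u + q3 * u ^ 3 + q5 * u ^ 5) b (1 - q1)).
- replace (c ^ 2 / (4 * b) + 3 * c * l / (4 * b ^ 2) + 15 * l ^ 2 / (16 * b ^ 3)) with q1
    by (unfold q1, q3, q5; field; lra).
  enough (0 <= (q1 * x + q3 * x ^ 3 + q5 * x ^ 5) * exp (- (b * x ^ 2))) by lra.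
  apply Rmult_le_pos; [|apply Rlt_le, exp_pos].
  assert (0 <= x ^ 3) by now apply pow_le. assert (0 <= x ^ 5) by now apply pow_le.
  repeat apply Rplus_le_le_0_compat; nra.
- intros u. auto_derive; trivial. unfold q1, q3, q5. field. lra.
- intros u. auto_derive; trivial.
- ring.
Qed.

Lemma RInt_u4_le b x : 0 < b -> 0 <= x ->
  RInt (fun u => u ^ 4 * exp (- (b * u ^ 2))) 0 x <= 3 / (4 * b ^ 2) * Gb b x.
Proof.
intros Hb Hx.
rewrite (RInt_poly_gauss (fun u => u ^ 4) (fun u => - (3 / (4 * b ^ 2) * u + / (2 * b) * u ^ 3)) b (3 / (4 * b ^ 2))).
- enough (0 <= (3 / (4 * b ^ 2) * x + / (2 * b) * x ^ 3) * exp (- (b * x ^ 2))) by lra.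
  apply Rmult_le_pos; [|apply Rlt_le, exp_pos].
  assert (0 <= x ^ 3) by now apply pow_le. assert (0 <= / (2 * b)) by (apply Rlt_le, Rinv_0_lt_compat; lra).
  assert (0 <= 3 / (4 * b ^ 2)) by (apply Rdiv_le_0_compat; nra).
  apply Rplus_le_le_0_compat; nra.
- intros u. auto_derive; trivial. field. lra.
- intros u. auto_derive; trivial.
- ring.
Qed.

Lemma RInt_u8_le b x : 0 < b -> 0 <= x ->
  RInt (fun u => u ^ 8 * exp (- (b * u ^ 2))) 0 x <= 105 / (16 * b ^ 4) * Gb b x.
Proof.
intros Hb Hx.
rewrite (RInt_poly_gauss (fun u => u ^ 8)
  (fun u => - (105 / (16 * b ^ 4) * u + 35 / (8 * b ^ 3) * u ^ 3 + 7 / (4 * b ^ 2) * u ^ 5 + / (2 * b) * u ^ 7)) b (105 / (16 * b ^ 4))).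
- enough (0 <= (105 / (16 * b ^ 4) * x + 35 / (8 * b ^ 3) * x ^ 3 + 7 / (4 * b ^ 2) * x ^ 5 + / (2 * b) * x ^ 7) * exp (- (b * x ^ 2))) by lra.
  apply Rmult_le_pos; [|apply Rlt_le, exp_pos].
  assert (P : forall n, 0 < b ^ n) by (intros; now apply pow_lt).
  assert (X : forall n, 0 <= x ^ n) by (intros; now apply pow_le).
  assert (0 <= / (2 * b)) by (apply Rlt_le, Rinv_0_lt_compat; lra).
  assert (0 <= 105 / (16 * b ^ 4)) by (apply Rdiv_le_0_compat; generalize (P 4%nat); lra).
  assert (0 <= 35 / (8 * b ^ 3)) by (apply Rdiv_le_0_compat; generalize (P 3%nat); lra).
  assert (0 <= 7 / (4 * b ^ 2)) by (apply Rdiv_le_0_compat; generalize (P 2%nat); lra).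
  generalize (X 3%nat) (X 5%nat) (X 7%nat); intros.
  repeat apply Rplus_le_le_0_compat; apply Rmult_le_pos; trivial.
- intros u. auto_derive; trivial. field. lra.
- intros u. auto_derive; trivial.
- ring.
Qed.

Lemma RInt_exp_lin_le E K u1 v : 0 < K -> u1 <= v ->
  RInt (fun u => exp (- (E + K * (u - u1)))) u1 v <= exp (- E) / K.
Proof.
intros HK Hv.
rewrite (is_RInt_unique _ u1 v (minus (- exp (- (E + K * (v - u1))) / K) (- exp (- (E + K * (u1 - u1))) / K))).
  unfold minus, plus, opp; simpl. replace (E + K * (u1 - u1)) with E by ring.
  assert (0 <= exp (- (E + K * (v - u1))) / K) by (apply Rdiv_le_0_compat; trivial; apply Rlt_le, exp_pos).
  unfold Rdiv in *. lra.
apply (is_RInt_derive (fun u => - exp (- (E + K * (u - u1))) / K)).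
  intros u _. auto_derive; trivial. unfold Rminus, Rdiv. field. lra.
intros u _. apply (ex_derive_continuous (fun u => exp (- (E + K * (u - u1))))). auto_derive; trivial.
Qed.

Lemma RInt_le_const (f : R -> R) u v C : u <= v -> ex_RInt f u v ->
  (forall t, u <= t <= v -> f t <= C) -> RInt f u v <= (v - u) * C.
Proof.
intros Huv Hf H.
replace ((v - u) * C) with (RInt (fun _ => C) u v).
  apply RInt_le; trivial; [apply ex_RInt_const|]. intros t Ht; apply H; lra.
rewrite RInt_const. reflexivity.
Qed.

(** Once [c * s >= k] the function [exp (- (c * s)) * s ^ k] decreases, so numerical estimates need
    checking at [s0] only. *)
Lemma exp_decay c k s s0 : 0 < s0 -> s0 <= s -> INR k <= c * s0 ->
  exp (- (c * s)) * s ^ k <= exp (- (c * s0)) * s0 ^ k.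
Proof.
intros H0 Hs Hk.
assert (h : s / s0 <= exp ((s - s0) / s0)).
  eapply Rle_trans; [|apply exp_ineq1_le]. apply Req_le; field; lra.
assert (h' : (s / s0) ^ k <= exp (c * (s - s0))).
  apply Rle_trans with (exp ((s - s0) / s0) ^ k).
    apply pow_incr. split; trivial. apply Rdiv_le_0_compat; lra.
  rewrite exp_pow. apply exp_mono.
  replace (INR k * ((s - s0) / s0)) with (INR k / s0 * (s - s0)) by (field; lra).
  apply Rmult_le_compat_r; [lra|].
  apply (Rmult_le_reg_r s0); trivial. unfold Rdiv. rewrite Rmult_assoc, Rinv_l; lra.
replace (s ^ k) with ((s / s0) ^ k * s0 ^ k) by (rewrite <- Rpow_mult_distr; f_equal; field; lra).
rewrite <- Rmult_assoc. apply Rmult_le_compat_r; [apply pow_le; lra|].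
replace (exp (- (c * s0))) with (exp (- (c * s)) * exp (c * (s - s0))).
  apply Rmult_le_compat_l; trivial. apply Rlt_le, exp_pos.
rewrite <- exp_plus. f_equal. ring.
Qed.

Lemma exp_1_ge : 2.718 <= exp 1.
Proof. generalize (exp_ge_taylor 1 6 ltac:(lra)). simpl. lra. Qed.

Lemma exp_neg_INR_le k x : INR k <= x -> exp (- x) <= / 2.718 ^ k.
Proof.
intros H. apply Rle_trans with (exp (- INR k)); [apply exp_mono; lra|].
replace (- INR k) with (- (INR k * 1)) by ring. rewrite exp_Ropp, <- exp_pow.
apply Rinv_le_contravar; [apply pow_lt; lra|]. apply pow_incr. generalize exp_1_ge; lra.
Qed.

(** With [lam = y ^ 6], both scales of the integral are powers of [y]: the width of the peak is
    [/ y ^ 3] and the phase becomes large near [/ y ^ 2]. Numerically, [2.1 ^ 6] is 85.77. *)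
Lemma sixth_root lam : 86 <= lam -> exists y, 21 / 10 <= y /\ y ^ 6 = lam.
Proof.
intros H. exists (exp (ln lam / 6)).
assert (E : exp (ln lam / 6) ^ 6 = lam).
  rewrite exp_pow. replace (INR 6 * (ln lam / 6)) with (ln lam) by (simpl; field). apply exp_ln; lra.
split; trivial.
destruct (Rle_lt_dec (21 / 10) (exp (ln lam / 6))) as [h|h]; trivial.
assert (exp (ln lam / 6) ^ 6 <= (21 / 10) ^ 6) by (apply pow_incr; split; [apply Rlt_le, exp_pos|lra]).
lra.
Qed.

Lemma sqrt_PI_div y : 0 < y -> 886 / 1000 / y ^ 3 <= sqrt (PI / y ^ 6) / 2.
Proof.
intros Hy. generalize PI_bounds; intros HP.
assert (hy : 0 < y ^ 3) by now apply pow_lt.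
enough (1772 / 1000 / y ^ 3 <= sqrt (PI / y ^ 6)).
  replace (886 / 1000 / y ^ 3) with (1772 / 1000 / y ^ 3 / 2) by (field; lra). lra.
rewrite <- (sqrt_square (1772 / 1000 / y ^ 3)) by (apply Rdiv_le_0_compat; lra).
apply sqrt_le_1_alt.
replace (1772 / 1000 / y ^ 3 * (1772 / 1000 / y ^ 3)) with ((1772 / 1000) ^ 2 / y ^ 6) by (field; lra).
apply Rmult_le_compat_r; [apply Rlt_le, Rinv_0_lt_compat, pow_lt; lra|]. lra.
Qed.

Lemma exp_taylor2 y : 0 <= y -> exp y <= 1 + y + y ^ 2 / 2 * exp y.
Proof.
intros H.
enough (1 + 0 + 0 ^ 2 / 2 * exp y - exp 0 <= 1 + y + y ^ 2 / 2 * exp y - exp y).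
  rewrite exp_0 in *. lra.
apply (derive_nonneg_le (fun z => 1 + z + z ^ 2 / 2 * exp y - exp z) (fun z => 1 + z * exp y - exp z)); trivial.
  intros z _. auto_derive; trivial. field.
intros z Hz.
enough (1 + 0 * exp y - exp 0 <= 1 + z * exp y - exp z) by (rewrite exp_0 in *; lra).
apply (derive_nonneg_le (fun z => 1 + z * exp y - exp z) (fun z => exp y - exp z)); [lra| |].
  intros w _. auto_derive; trivial. ring.
intros w Hw. generalize (exp_mono w y ltac:(lra)); lra.
Qed.

(** * The integral in the scaled variable [u = t / a] *)

Section Abstract_integral.
Variables (A B : R -> R) (lam U : R).
Hypothesis Hlam : 86 <= lam.
Hypothesis HU : U = 4 * lam / PI.
Hypothesis dA : forall u, ex_derive (fun u => exp (- A u)) u.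
Hypothesis dB : forall u, ex_derive B u.
(** The values aimed at are [lam - 1/4] here and [1/2] in [B_up]; they come from the logarithm in
    [Lmod] and are widened by 1/200 and 1/100. *)
Hypothesis A_up : forall u, 0 <= u -> A u <= (lam - 245 / 1000) * u ^ 2.
Hypothesis A_lo : forall u, 0 <= u -> (lam - 255 / 1000) * u ^ 2 - lam * u ^ 4 <= A u.
Hypothesis B_up : forall u, 0 <= u -> Rabs (B u) <= 51 / 100 * u + lam * u ^ 3.
Hypothesis A_far : forall u, 7 / 10 <= u <= U -> 13 / 100 * lam <= A u.
Hypothesis A_vfar : forall u, 1 <= u <= U -> 19 / 100 * lam <= A u.

Let f u := exp (- A u) * cos (B u).

Lemma exA u v : ex_RInt (fun u => exp (- A u)) u v.
Proof. now apply ex_RInt_ex_derive. Qed.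

Lemma exf u v : ex_RInt f u v.
Proof.
apply ex_RInt_ex_derive. intros t. apply ex_derive_mult; [apply dA|].
generalize (dB t). intros; auto_derive; trivial.
Qed.

Lemma U_bounds : 1 <= U <= 1274 / 1000 * lam.
Proof.
generalize PI_bounds; intros HP. rewrite HU. split.
  apply (Rmult_le_reg_r PI); [lra|]. unfold Rdiv. rewrite Rmult_assoc, Rinv_l; lra.
apply (Rmult_le_reg_r PI); [lra|]. unfold Rdiv. rewrite Rmult_assoc, Rinv_l by lra. nra.
Qed.

Lemma tail_small : RInt (fun u => exp (- A u)) (1 / 2) U <= 3 / 100 / lam * (sqrt (PI / lam) / 2).
Proof.
destruct U_bounds as [U1 U2].
(* For [w = t ^ 2] in [[1/4, 49/100]], [w - w ^ 2] is at least 3/16, and [255/1000 * w] is below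
   1/8. *)
assert (T2 : RInt (fun u => exp (- A u)) (1 / 2) (7 / 10) <= (7 / 10 - 1 / 2) * exp (1 / 8 - 1875 / 10000 * lam)).
  apply RInt_le_const; [lra|apply exA|]. intros t Ht. apply exp_mono.
  generalize (A_lo t ltac:(lra)); intros h.
  assert (hw : 25 / 100 <= t ^ 2 <= 49 / 100) by nra.
  replace (t ^ 4) with (t ^ 2 * t ^ 2) in h by ring. set (w := t ^ 2) in *.
  assert (1875 / 10000 <= w - w * w) by nra. nra.
assert (T3 : RInt (fun u => exp (- A u)) (7 / 10) 1 <= (1 - 7 / 10) * exp (- (13 / 100 * lam))).
  apply RInt_le_const; [lra|apply exA|]. intros t Ht. apply exp_mono.
  generalize (A_far t ltac:(lra)); lra.
assert (T4 : RInt (fun u => exp (- A u)) 1 U <= (U - 1) * exp (- (19 / 100 * lam))).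
  apply RInt_le_const; [lra|apply exA|]. intros t Ht. apply exp_mono.
  generalize (A_vfar t ltac:(lra)); lra.
rewrite <- (RInt_Chasles (V := R_CompleteNormedModule) _ (1 / 2) (7 / 10) U) by apply exA.
rewrite <- (RInt_Chasles (V := R_CompleteNormedModule) _ (7 / 10) 1 U) by apply exA.
unfold plus; simpl.
destruct (sixth_root lam Hlam) as [y [Hy Ey]].
assert (hs := sqrt_PI_div y ltac:(lra)). rewrite Ey in hs.
assert (e1 : exp (1 / 8 - 1875 / 10000 * lam) <= exp (- (13 / 100 * lam))) by (apply exp_mono; lra).
assert (D1 := exp_decay (13 / 100) 2 lam 86 ltac:(lra) Hlam ltac:(simpl; lra)).
assert (D2 := exp_decay (19 / 100) 3 lam 86 ltac:(lra) Hlam ltac:(simpl; lra)).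
assert (N1 := exp_neg_INR_le 11 (13 / 100 * 86) ltac:(simpl; lra)).
assert (N2 := exp_neg_INR_le 16 (19 / 100 * 86) ltac:(simpl; lra)).
set (E1 := exp (- (13 / 100 * lam))) in *. set (E2 := exp (- (19 / 100 * lam))) in *.
set (E3 := exp (1 / 8 - _)) in *.
assert (p1 : 0 < E1) by apply exp_pos. assert (p2 : 0 < E2) by apply exp_pos. assert (p3 : 0 < E3) by apply exp_pos.
assert (hl2 : 0 < lam ^ 2) by (apply pow_lt; lra).
assert (hy3 : 926 / 100 <= y ^ 3).
  assert ((21 / 10) ^ 3 <= y ^ 3) by (apply pow_incr; lra). lra.
assert (B1 : E1 * lam ^ 2 <= 124 / 1000).
  eapply Rle_trans; [exact D1|]. apply Rle_trans with (/ 2.718 ^ 11 * 86 ^ 2); [apply Rmult_le_compat_r; lra|lra].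
assert (B2 : E2 * lam ^ 3 <= 72 / 1000).
  eapply Rle_trans; [exact D2|]. apply Rle_trans with (/ 2.718 ^ 16 * 86 ^ 3); [apply Rmult_le_compat_r; lra|lra].
apply Rle_trans with (3 / 100 / lam * (886 / 1000 / y ^ 3)).
  2:{ apply Rmult_le_compat_l; trivial. apply Rdiv_le_0_compat; lra. }
apply Rle_trans with (/ 2 * E1 + 1274 / 1000 * lam * E2); [nra|].
apply (Rmult_le_reg_r (lam ^ 2)); trivial.
apply Rle_trans with (155 / 1000); [nra|].
replace (3 / 100 / lam * (886 / 1000 / y ^ 3) * lam ^ 2) with (3 / 100 * (886 / 1000) * (y ^ 6 / y ^ 3)) by (rewrite Ey; field; lra).
replace (y ^ 6 / y ^ 3) with (y ^ 3) by (field; lra). lra.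
Qed.

Lemma peak_tail_small u1 s : 0 < s -> s ^ 3 = lam -> u1 = 1125 / 1000 / s ->
  RInt (fun u => exp (- A u)) u1 (1 / 2) <= 18 / 100 / lam * (sqrt (PI / lam) / 2).
Proof.
intros Hs0 Hs Hu.
destruct (sixth_root lam Hlam) as [y [Hy Ey]].
assert (hs := sqrt_PI_div y ltac:(lra)). rewrite Ey in hs.
assert (Es : s = y ^ 2).
  assert (hy2 : 0 < y ^ 2) by (apply pow_lt; lra).
  assert (E : s ^ 3 = (y ^ 2) ^ 3) by (rewrite Hs, <- Ey; ring).
  assert (E' : (s - y ^ 2) * (s ^ 2 + s * y ^ 2 + (y ^ 2) ^ 2) = 0) by nra.
  apply Rmult_integral in E'. destruct E' as [E'|E']; [lra|]. nra.
assert (Hs1 : 441 / 100 <= s) by (rewrite Es; nra).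
set (w1 := u1 ^ 2).
assert (Ew : w1 * s ^ 2 = 1265625 / 1000000) by (unfold w1; rewrite Hu; field; lra).
assert (Hw1 : 0 < w1 <= 651 / 10000).
  unfold w1; rewrite Hu. split; [apply pow_lt, Rdiv_lt_0_compat; lra|].
  apply Rle_trans with ((1125 / 1000 / (441 / 100)) ^ 2); [|lra]. apply pow_incr. split; [apply Rdiv_le_0_compat; lra|].
  apply Rmult_le_compat_l; [lra|]. apply Rinv_le_contravar; lra.
assert (Hu0 : 0 < u1) by (rewrite Hu; apply Rdiv_lt_0_compat; lra).
assert (Hu2 : u1 <= 1 / 2) by (unfold w1 in Hw1; nra).
(* The line [E0 + K * (u - u1)] lies below [A] on [[u1, 1/2]]: [E0] bounds the value at [u1], and
   [K = 2 * u1 * (68/100 * lam)], where [68/100 * lam] bounds the slope in the variable [u ^ 2]. *)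
set (E0 := 12656 / 10000 * s - 38 / 100).
set (K := 153 / 100 * s ^ 2).
assert (HK : 0 < K) by (unfold K; nra).
assert (HE0 : E0 <= (lam - 255 / 1000) * w1 - lam * w1 ^ 2).
  rewrite <- Hs. replace ((s ^ 3 - 255 / 1000) * w1 - s ^ 3 * w1 ^ 2) with
    (s * (w1 * s ^ 2) - 255 / 1000 * w1 - (w1 * s ^ 2) * (w1 * s)) by ring.
  rewrite Ew. unfold E0.
  assert (w1 * s <= 288 / 1000).
    assert (w1 * s = w1 * s ^ 2 / s) by (field; lra). rewrite H, Ew.
    apply (Rmult_le_reg_r s); trivial. unfold Rdiv. rewrite Rmult_assoc, Rinv_l; lra.
  nra.
assert (L : RInt (fun u => exp (- A u)) u1 (1 / 2) <= exp (- E0) / K).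
  eapply Rle_trans; [|apply (RInt_exp_lin_le E0 K u1 (1 / 2) HK Hu2)].
  apply RInt_le; trivial; [apply exA|apply ex_RInt_ex_derive; intros t; auto_derive; trivial|].
  intros u Hu'. apply exp_mono, Ropp_le_contravar.
  eapply Rle_trans; [|apply A_lo; lra].
  replace (u ^ 4) with (u ^ 2 * u ^ 2) by ring.
  assert (hw : w1 <= u ^ 2 <= 1 / 4) by (unfold w1; nra).
  assert (hd : 2 * u1 * (u - u1) <= u ^ 2 - w1) by (unfold w1; nra).
  set (w := u ^ 2) in *.
  enough (K * (u - u1) <= (w - w1) * (lam - 255 / 1000 - lam * (w + w1))) by nra.
  assert (hk : 68 / 100 * lam <= lam - 255 / 1000 - lam * (w + w1)) by nra.
  apply Rle_trans with (2 * u1 * (u - u1) * (68 / 100 * lam)).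
    replace K with (2 * u1 * (68 / 100 * lam)); [apply Req_le; ring|].
    unfold K. rewrite Hu, <- Hs. field. lra.
  apply Rmult_le_compat; nra.
eapply Rle_trans; [exact L|].
assert (D := exp_decay (12656 / 10000) 3 s (441 / 100) ltac:(lra) Hs1 ltac:(simpl; lra)).
assert (N1 : exp (- E0) = exp (- (12656 / 10000 * s)) * exp (38 / 100)).
  rewrite <- exp_plus. f_equal. unfold E0; ring.
assert (N2 : exp (- (12656 / 10000 * (441 / 100))) * exp (38 / 100) <= 552 / 100000).
  rewrite <- exp_plus.
  replace (- (12656 / 10000 * (441 / 100)) + 38 / 100) with (- INR 5 + - (2012960 / 10000000)) by (simpl; field).
  rewrite exp_plus.
  assert (h1 := exp_neg_INR_le 5 (INR 5) ltac:(lra)).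
  assert (h2 : exp (- (2012960 / 10000000)) <= 818 / 1000).
    assert (e : exp (- (2012960 / 10000000)) * exp (2012960 / 10000000) = 1).
      rewrite <- exp_plus. replace (- (2012960 / 10000000) + 2012960 / 10000000) with 0 by ring. apply exp_0.
    generalize (exp_ge_taylor (2012960 / 10000000) 3 ltac:(lra)). simpl. generalize (exp_pos (- (2012960 / 10000000))). nra.
  generalize (exp_pos (- INR 5)) (exp_pos (- (2012960 / 10000000))); intros.
  apply Rle_trans with (/ 2.718 ^ 5 * (818 / 1000)); [apply Rmult_le_compat; lra|lra].
assert (M : exp (- E0) * s ^ 3 <= 474 / 1000).
  rewrite N1. set (e := exp (38 / 100)) in *. assert (0 < e) by apply exp_pos.
  apply Rle_trans with (exp (- (12656 / 10000 * (441 / 100))) * (441 / 100) ^ 3 * e); [|nra].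
  replace (exp (- (12656 / 10000 * s)) * e * s ^ 3) with (exp (- (12656 / 10000 * s)) * s ^ 3 * e) by ring.
  apply Rmult_le_compat_r; lra.
apply Rle_trans with (18 / 100 / lam * (886 / 1000 / y ^ 3)).
  2:{ apply Rmult_le_compat_l; trivial. apply Rdiv_le_0_compat; lra. }
apply (Rmult_le_reg_r (lam * y ^ 3)); [apply Rmult_lt_0_compat; [lra|apply pow_lt; lra]|].
replace (18 / 100 / lam * (886 / 1000 / y ^ 3) * (lam * y ^ 3)) with (18 / 100 * (886 / 1000)) by (field; lra).
apply Rle_trans with (exp (- E0) * s ^ 3 * (/ (153 / 100) * / y)).
  unfold K. rewrite <- Hs, Es. apply Req_le. field. lra.
assert (hiy : / y <= 10 / 21).
  apply (Rmult_le_reg_r y); [lra|]. rewrite Rinv_l; lra.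
assert (0 < / y) by (apply Rinv_0_lt_compat; lra).
assert (0 < exp (- E0) * s ^ 3) by (apply Rmult_lt_0_compat; [apply exp_pos|apply pow_lt; lra]).
apply Rle_trans with (474 / 1000 * (/ (153 / 100) * (10 / 21))); [apply Rmult_le_compat; lra|lra].
Qed.

Lemma sqrt_ratio_ge b k : 0 < b -> 0 <= k -> (1 + k / lam) ^ 2 * b <= lam ->
  (1 + k / lam) * sqrt (PI / lam) <= sqrt (PI / b).
Proof.
intros Hb Hk H. generalize PI_RGT_0; intros HP.
assert (h : 0 <= 1 + k / lam) by (assert (0 <= k / lam) by (apply Rdiv_le_0_compat; lra); lra).
rewrite <- (sqrt_square (1 + k / lam)), <- sqrt_mult_alt by nra.
apply sqrt_le_1_alt.
apply (Rmult_le_reg_r (b * lam)); [nra|].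
replace (PI / b * (b * lam)) with (PI * lam) by (field; lra).
replace ((1 + k / lam) * (1 + k / lam) * (PI / lam) * (b * lam)) with (PI * ((1 + k / lam) ^ 2 * b)) by (field; lra).
apply Rmult_le_compat_l; lra.
Qed.

Lemma sqrt_ratio_le b k : 0 < b -> 0 <= k -> lam <= (1 + k / lam) ^ 2 * b ->
  sqrt (PI / b) <= (1 + k / lam) * sqrt (PI / lam).
Proof.
intros Hb Hk H. generalize PI_RGT_0; intros HP.
assert (h : 0 <= 1 + k / lam) by (assert (0 <= k / lam) by (apply Rdiv_le_0_compat; lra); lra).
rewrite <- (sqrt_square (1 + k / lam)), <- sqrt_mult_alt by nra.
apply sqrt_le_1_alt.
apply (Rmult_le_reg_r (b * lam)); [nra|].
replace (PI / b * (b * lam)) with (PI * lam) by (field; lra).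
replace ((1 + k / lam) * (1 + k / lam) * (PI / lam) * (b * lam)) with (PI * ((1 + k / lam) ^ 2 * b)) by (field; lra).
apply Rmult_le_compat_l; lra.
Qed.

(** Up to [u1] the cosine is at least [1 - w ^ 2 / 2]. From [u1] to 1/2 that minorant is negative,
    so keeping it, at the cost of one extra tail, allows the Gaussian moments to be integrated up to
    1/2. In units of [/ lam] the losses are 1.285 for the peak, 0.18 and 0.03 for the tails. *)
Lemma integral_lower : (1 - 3 / 2 / lam) * (sqrt (PI / lam) / 2) <= RInt f 0 U.
Proof.
destruct (sixth_root lam Hlam) as [y [Hy Ey]].
set (s := y ^ 2). assert (Hs : s ^ 3 = lam) by (unfold s; rewrite <- Ey; ring).
assert (Hs1 : 441 / 100 <= s) by (unfold s; nra).
(* The cubic part of the phase bound is [1.125 ^ 3], about 1.424, at [u1]. Beyond [u1] it exceeds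
   [sqrt 2], so [1 - w ^ 2 / 2] is negative; before [u1] the whole bound stays below [PI / 2], so
   the cosine is nonnegative. Few values of 1.125 meet both conditions. *)
set (u1 := 1125 / 1000 / s).
assert (Hu0 : 0 < u1) by (apply Rdiv_lt_0_compat; lra).
assert (Hu2 : u1 <= 1 / 2).
  unfold u1. apply (Rmult_le_reg_r s); [lra|]. unfold Rdiv. rewrite Rmult_assoc, Rinv_l; lra.
assert (El : lam * u1 ^ 3 = (1125 / 1000) ^ 3) by (unfold u1; rewrite <- Hs; field; lra).
assert (Hu3 : 51 / 100 * u1 <= 131 / 1000).
  unfold u1. apply (Rmult_le_reg_r s); [lra|].
  replace (51 / 100 * (1125 / 1000 / s) * s) with (51 / 100 * (1125 / 1000)) by (field; lra). lra.
generalize PI_bounds; intros HP.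
set (b := lam - 245 / 1000). assert (Hb : 0 < b) by (unfold b; lra).
set (g := fun u => (1 - (51 / 100 * u + lam * u ^ 3) ^ 2 / 2) * exp (- (b * u ^ 2))).
assert (exg : forall u v, ex_RInt g u v).
  intros; apply ex_RInt_ex_derive. intros t. unfold g. auto_derive; trivial.
assert (Bnn : forall u, 0 <= u -> 0 <= 51 / 100 * u + lam * u ^ 3).
  intros u Hu. assert (0 <= u ^ 3) by now apply pow_le. nra.
assert (P1 : RInt g 0 u1 <= RInt f 0 u1).
  apply RInt_le; [lra|apply exg|apply exf|]. intros u Hu. unfold f, g.
  assert (h3 : u ^ 3 <= u1 ^ 3) by (apply pow_incr; lra).
  assert (hB := B_up u ltac:(lra)). assert (h0 := Bnn u ltac:(lra)).
  set (w := 51 / 100 * u + lam * u ^ 3) in *.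
  assert (h4 : lam * u ^ 3 <= lam * u1 ^ 3) by (apply Rmult_le_compat_l; lra).
  assert (hw : w <= 1557 / 1000) by (unfold w; lra).
  assert (hc1 : 1 - w ^ 2 / 2 <= cos (B u)).
    assert (hc := cos_ge_quad (Rabs (B u)) (Rabs_pos _)).
    replace (cos (Rabs (B u))) with (cos (B u)) in hc.
      2:{ unfold Rabs. destruct (Rcase_abs (B u)); [now rewrite cos_neg|trivial]. }
    assert (Rabs (B u) ^ 2 <= w ^ 2) by (apply pow_incr; split; [apply Rabs_pos|trivial]). lra.
  assert (hc0 : 0 <= cos (B u)).
    apply Rabs_le_between in hB. apply cos_ge_0; lra.
  assert (he : exp (- (b * u ^ 2)) <= exp (- A u)).
    apply exp_mono, Ropp_le_contravar. apply A_up; lra.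
  assert (hp := exp_pos (- (b * u ^ 2))).
  destruct (Rle_lt_dec 0 (1 - w ^ 2 / 2)) as [hn|hn].
    rewrite Rmult_comm. apply Rmult_le_compat; lra.
  apply Rle_trans with 0; [nra|]. apply Rmult_le_pos; [apply Rlt_le, exp_pos|trivial].
assert (P2 : RInt g u1 (1 / 2) - RInt (fun u => exp (- A u)) u1 (1 / 2) <= RInt f u1 (1 / 2)).
  rewrite <- (RInt_minus (V := R_CompleteNormedModule)) by (apply exg || apply exA).
  apply RInt_le; [lra| |apply exf|].
    apply (ex_RInt_minus (V := R_NormedModule)); [apply exg|apply exA].
  intros u Hu. change (g u - exp (- A u) <= f u).
  assert (hg : g u <= 0).
    unfold g. assert (hp := exp_pos (- (b * u ^ 2))).
    assert (h3 : u1 ^ 3 <= u ^ 3) by (apply pow_incr; lra).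
    assert (h4 : lam * u1 ^ 3 <= lam * u ^ 3) by (apply Rmult_le_compat_l; lra).
    assert (hw : 142 / 100 <= 51 / 100 * u + lam * u ^ 3) by lra.
    set (w := 51 / 100 * u + lam * u ^ 3) in *. assert (1 - w ^ 2 / 2 <= 0) by nra. nra.
  unfold f. generalize (COS_bound (B u)) (exp_pos (- A u)). nra.
assert (P3 : - RInt (fun u => exp (- A u)) (1 / 2) U <= RInt f (1 / 2) U).
  rewrite <- (RInt_opp (V := R_CompleteNormedModule)) by apply exA.
  destruct U_bounds as [hU _].
  apply RInt_le; [lra| |apply exf|].
    apply (ex_RInt_opp (V := R_NormedModule)), exA.
  intros u Hu. change (- exp (- A u) <= f u).
  unfold f. generalize (COS_bound (B u)) (exp_pos (- A u)). nra.
assert (C1 := RInt_Chasles (V := R_CompleteNormedModule) f 0 u1 (1 / 2) (exf _ _) (exf _ _)).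
assert (C2 := RInt_Chasles (V := R_CompleteNormedModule) f 0 (1 / 2) U (exf _ _) (exf _ _)).
assert (C3 := RInt_Chasles (V := R_CompleteNormedModule) g 0 u1 (1 / 2) (exg _ _) (exg _ _)).
change (RInt f 0 u1 + RInt f u1 (1 / 2) = RInt f 0 (1 / 2)) in C1.
change (RInt f 0 (1 / 2) + RInt f (1 / 2) U = RInt f 0 U) in C2.
change (RInt g 0 u1 + RInt g u1 (1 / 2) = RInt g 0 (1 / 2)) in C3.
assert (T1 := peak_tail_small u1 s ltac:(lra) Hs eq_refl).
assert (T2 := tail_small).
assert (M := RInt_lower_main b (51 / 100) lam (1 / 2) Hb ltac:(lra) ltac:(lra) ltac:(lra)).
fold g in M.
destruct (Gb_bounds b (1 / 2) Hb ltac:(lra)) as [G1 _].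
assert (R1 := sqrt_ratio_ge b (12 / 100) Hb ltac:(lra)).
set (K := sqrt (PI / lam) / 2) in *.
assert (HK : 0 < K).
  unfold K. assert (0 < sqrt (PI / lam)) by (apply sqrt_lt_R0, Rdiv_lt_0_compat; lra). lra.
assert (R2 : (1 + 12 / 100 / lam) * K <= sqrt (PI / b) / 2).
  unfold K. enough ((1 + 12 / 100 / lam) ^ 2 * b <= lam) by (specialize (R1 H); lra).
  unfold b. replace ((1 + 12 / 100 / lam) ^ 2 * (lam - 245 / 1000)) with
    (lam - 5 / 1000 - (588 / 10000 - 144 / 10000) / lam - 144 * 245 / 10000000 / lam ^ 2) by (field; lra).
  assert (0 < / lam) by (apply Rinv_0_lt_compat; lra).
  assert (0 < / lam ^ 2) by (apply Rinv_0_lt_compat, pow_lt; lra). unfold Rdiv. lra.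
assert (He : exp (- (b * (1 / 2) ^ 2)) <= / 1000 / lam).
  assert (D := exp_decay (1 / 5) 1 lam 86 ltac:(lra) Hlam ltac:(simpl; lra)).
  assert (N1 := exp_neg_INR_le 17 (1 / 5 * 86) ltac:(simpl; lra)).
  apply Rle_trans with (exp (- (1 / 5 * lam))); [apply exp_mono; unfold b; lra|].
  apply (Rmult_le_reg_r lam); [lra|]. replace (/ 1000 / lam * lam) with (/ 1000) by (field; lra).
  rewrite !pow_1 in D. lra.
set (rr := 1 - _) in M.
assert (Hr : 1 - 1396 / 1000 / lam <= rr).
  unfold rr. set (z := / b).
  assert (hz : z <= 10029 / 10000 / lam).
    unfold z, b. apply (Rmult_le_reg_r ((lam - 245 / 1000) * lam)); [nra|].
    replace (/ (lam - 245 / 1000) * ((lam - 245 / 1000) * lam)) with lam by (field; lra).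
    replace (10029 / 10000 / lam * ((lam - 245 / 1000) * lam)) with (10029 / 10000 * (lam - 245 / 1000)) by (field; lra).
    lra.
  assert (hz0 : 0 < z) by (apply Rinv_0_lt_compat; trivial).
  assert (hlz : 0 < lam * z <= 10029 / 10000).
    split; [nra|]. apply (Rmult_le_compat_l lam) in hz; [|lra].
    replace (lam * (10029 / 10000 / lam)) with (10029 / 10000) in hz by (field; lra). lra.
  replace ((51 / 100) ^ 2 / (4 * b) + 3 * (51 / 100) * lam / (4 * b ^ 2) + 15 * lam ^ 2 / (16 * b ^ 3))
    with (z * ((51 / 100) ^ 2 / 4 + 3 * (51 / 100) / 4 * (lam * z) + 15 / 16 * (lam * z) ^ 2)) by (unfold z; field; lra).
  set (v := lam * z) in *.
  assert (hv : (51 / 100) ^ 2 / 4 + 3 * (51 / 100) / 4 * v + 15 / 16 * v ^ 2 <= 13918 / 10000) by nra.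
  assert (0 <= (51 / 100) ^ 2 / 4 + 3 * (51 / 100) / 4 * v + 15 / 16 * v ^ 2) by nra.
  apply Rle_trans with (1 - 10029 / 10000 / lam * (13918 / 10000)).
    assert (0 < / lam) by (apply Rinv_0_lt_compat; lra). unfold Rdiv. lra.
  assert (z * ((51 / 100) ^ 2 / 4 + 3 * (51 / 100) / 4 * v + 15 / 16 * v ^ 2) <= 10029 / 10000 / lam * (13918 / 10000)).
    apply Rmult_le_compat; lra.
  lra.
set (x := / lam) in *.
assert (Hx : 0 < x <= / 86).
  unfold x. split; [apply Rinv_0_lt_compat; lra|apply Rinv_le_contravar; lra].
unfold Rdiv in Hr, He, R2, T1, T2 |- *. fold x in Hr, He, R2, T1, T2 |- *.
assert (G2 : (1 + 12 * / 100 * x) * K * (1 - / 1000 * x) <= Gb b (1 / 2)).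
  eapply Rle_trans; [|exact G1]. apply Rmult_le_compat.
  - apply Rmult_le_pos; [|lra]. lra.
  - lra.
  - unfold Rdiv. lra.
  - unfold Rdiv in *. lra.
assert (G3 : (1 - 1396 * / 1000 * x) * ((1 + 12 * / 100 * x) * K * (1 - / 1000 * x)) <= RInt g 0 (1 / 2)).
  eapply Rle_trans; [|exact M]. apply Rmult_le_compat; try lra.
  apply Rmult_le_pos; [|lra]. apply Rmult_le_pos; lra.
assert (G4 : (1 - 1285 * / 1000 * x) * K <= (1 - 1396 * / 1000 * x) * ((1 + 12 * / 100 * x) * K * (1 - / 1000 * x))).
  replace ((1 - 1396 * / 1000 * x) * ((1 + 12 * / 100 * x) * K * (1 - / 1000 * x))) with
    ((1 - 1396 * / 1000 * x) * (1 + 12 * / 100 * x) * (1 - / 1000 * x) * K) by ring.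
  apply Rmult_le_compat_r; [lra|]. nra.
assert (G5 : (1 - 3 * / 2 * x) * K <= (1 - 1285 * / 1000 * x) * K - 18 * / 100 * x * K - 3 * / 100 * x * K) by nra.
lra.
Qed.

(** The cosine is bounded by 1 and [exp (lam * u ^ 4)] expanded to second order. In the remainder,
    [u <= 1/2] gives [lam * u ^ 4 <= lam / 4 * u ^ 2], which is absorbed in a Gaussian of smaller
    rate [b']. *)
Lemma integral_upper : RInt f 0 U <= (1 + 3 / 2 / lam) * (sqrt (PI / lam) / 2).
Proof.
destruct U_bounds as [hU _]. generalize PI_bounds; intros HP.
set (b := lam - 255 / 1000). assert (Hb : 0 < b) by (unfold b; lra).
set (b' := b - lam / 4). assert (Hb' : 0 < b') by (unfold b', b; lra).
assert (P0 : RInt f (1 / 2) U <= RInt (fun u => exp (- A u)) (1 / 2) U).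
  apply RInt_le; [lra|apply exf|apply exA|]. intros u Hu. unfold f.
  generalize (COS_bound (B u)) (exp_pos (- A u)). nra.
set (g := fun u => exp (- (b * u ^ 2)) + lam * (u ^ 4 * exp (- (b * u ^ 2))) + lam ^ 2 / 2 * (u ^ 8 * exp (- (b' * u ^ 2)))).
assert (P1 : RInt f 0 (1 / 2) <= RInt g 0 (1 / 2)).
  apply RInt_le; [lra|apply exf|apply ex_RInt_ex_derive; intros t; unfold g; auto_derive; trivial|].
  intros u Hu. unfold f.
  apply Rle_trans with (exp (- A u)); [generalize (COS_bound (B u)) (exp_pos (- A u)); nra|].
  apply Rle_trans with (exp (- (b * u ^ 2) + lam * u ^ 4)).
    apply exp_mono. generalize (A_lo u ltac:(lra)). unfold b. lra.
  rewrite exp_plus. unfold g.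
  assert (hy0 : 0 <= lam * u ^ 4) by (apply Rmult_le_pos; [lra|apply pow_le; lra]).
  assert (hy : lam * u ^ 4 <= lam / 4 * u ^ 2).
    replace (u ^ 4) with (u ^ 2 * u ^ 2) by ring.
    replace (lam / 4 * u ^ 2) with (lam * (/ 4 * u ^ 2)) by field.
    apply Rmult_le_compat_l; [lra|]. apply Rmult_le_compat_r; nra.
  replace (u ^ 8) with (u ^ 4 * u ^ 4) by ring.
  assert (et : exp (lam * u ^ 4) <= 1 + lam * u ^ 4 + (lam * u ^ 4) ^ 2 / 2 * exp (lam * u ^ 4)) by now apply exp_taylor2.
  assert (em : exp (- (b * u ^ 2)) * exp (lam * u ^ 4) <= exp (- (b' * u ^ 2))).
    rewrite <- exp_plus. apply exp_mono. unfold b'. lra.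
  apply Rle_trans with (exp (- (b * u ^ 2)) * (1 + lam * u ^ 4 + (lam * u ^ 4) ^ 2 / 2 * exp (lam * u ^ 4))).
    apply Rmult_le_compat_l; [apply Rlt_le, exp_pos|trivial].
  apply Rle_trans with (exp (- (b * u ^ 2)) + lam * (u ^ 4 * exp (- (b * u ^ 2))) + (lam * u ^ 4) ^ 2 / 2 * (exp (- (b * u ^ 2)) * exp (lam * u ^ 4))).
    apply Req_le; ring.
  apply Rplus_le_compat_l.
  replace (lam ^ 2 / 2 * (u ^ 4 * u ^ 4 * exp (- (b' * u ^ 2)))) with ((lam * u ^ 4) ^ 2 / 2 * exp (- (b' * u ^ 2))) by field.
  apply Rmult_le_compat_l; trivial. nra.
assert (P2 : RInt g 0 (1 / 2) <= Gb b (1 / 2) * (1 + lam * (3 / (4 * b ^ 2))) + lam ^ 2 / 2 * (105 / (16 * b' ^ 4)) * Gb b' (1 / 2)).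
  assert (e0 : ex_RInt (fun u => exp (- (b * u ^ 2))) 0 (1 / 2)) by (apply ex_RInt_ex_derive; intros t; auto_derive; trivial).
  assert (e1 : ex_RInt (fun u => u ^ 4 * exp (- (b * u ^ 2))) 0 (1 / 2)) by (apply ex_RInt_ex_derive; intros t; auto_derive; trivial).
  assert (e2 : ex_RInt (fun u => u ^ 8 * exp (- (b' * u ^ 2))) 0 (1 / 2)) by (apply ex_RInt_ex_derive; intros t; auto_derive; trivial).
  assert (E : RInt g 0 (1 / 2) = Gb b (1 / 2) + lam * RInt (fun u => u ^ 4 * exp (- (b * u ^ 2))) 0 (1 / 2)
     + lam ^ 2 / 2 * RInt (fun u => u ^ 8 * exp (- (b' * u ^ 2))) 0 (1 / 2)).
    apply (is_RInt_unique (V := R_CompleteNormedModule)). unfold g.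
    apply (is_RInt_plus (V := R_NormedModule) (fun u => exp (- (b * u ^ 2)) + lam * (u ^ 4 * exp (- (b * u ^ 2))))).
      apply (is_RInt_plus (V := R_NormedModule) (fun u => exp (- (b * u ^ 2)))).
        now apply (RInt_correct (V := R_CompleteNormedModule)).
      apply (is_RInt_scal (V := R_NormedModule) (fun u => u ^ 4 * exp (- (b * u ^ 2)))).
      now apply (RInt_correct (V := R_CompleteNormedModule)).
    apply (is_RInt_scal (V := R_NormedModule) (fun u => u ^ 8 * exp (- (b' * u ^ 2)))).
    now apply (RInt_correct (V := R_CompleteNormedModule)).
  rewrite E.
  assert (h4 := RInt_u4_le b (1 / 2) Hb ltac:(lra)). assert (h8 := RInt_u8_le b' (1 / 2) Hb' ltac:(lra)).
  assert (0 < lam ^ 2) by (apply pow_lt; lra).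
  apply (Rmult_le_compat_l lam) in h4; [|lra].
  apply (Rmult_le_compat_l (lam ^ 2 / 2)) in h8; [|lra]. lra.
destruct (Gb_bounds b (1 / 2) Hb ltac:(lra)) as [_ G1].
destruct (Gb_bounds b' (1 / 2) Hb' ltac:(lra)) as [_ G1'].
assert (C2 := RInt_Chasles (V := R_CompleteNormedModule) f 0 (1 / 2) U (exf _ _) (exf _ _)).
change (RInt f 0 (1 / 2) + RInt f (1 / 2) U = RInt f 0 U) in C2.
assert (T2 := tail_small).
assert (R1 := sqrt_ratio_le b (13 / 100) Hb ltac:(lra)).
assert (R1' := sqrt_ratio_le b' (16 / 100 * lam) Hb' ltac:(lra)).
set (K := sqrt (PI / lam) / 2) in *.
assert (HK : 0 < K).
  unfold K. assert (0 < sqrt (PI / lam)) by (apply sqrt_lt_R0, Rdiv_lt_0_compat; lra). lra.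
set (x := / lam).
assert (Hx : 0 < x <= / 86).
  unfold x. split; [apply Rinv_0_lt_compat; lra|apply Rinv_le_contravar; lra].
assert (Ex : lam * x = 1) by (unfold x; field; lra).
assert (R2 : sqrt (PI / b) / 2 <= (1 + 13 / 100 * x) * K).
  unfold K, x. enough (lam <= (1 + 13 / 100 / lam) ^ 2 * b) by (specialize (R1 H); unfold Rdiv in *; lra).
  unfold b. replace ((1 + 13 / 100 / lam) ^ 2 * (lam - 255 / 1000)) with
    (lam + 5 / 1000 + (169 / 10000 - 663 / 10000) / lam - 169 * 255 / 10000000 / lam ^ 2) by (field; lra).
  assert (hxx : / lam ^ 2 = x * x) by (unfold x; field; lra). unfold Rdiv. rewrite hxx. fold x. nra.
assert (R2' : sqrt (PI / b') / 2 <= 116 / 100 * K).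
  unfold K. enough (lam <= (1 + 16 / 100 * lam / lam) ^ 2 * b').
    specialize (R1' H). replace (1 + 16 / 100 * lam / lam) with (116 / 100) in R1' by (field; lra). lra.
  replace (1 + 16 / 100 * lam / lam) with (116 / 100) by (field; lra). unfold b', b. lra.
assert (hz : / b <= 1003 / 1000 * x).
  apply (Rmult_le_reg_r b); trivial. rewrite Rinv_l by lra. unfold b. nra.
assert (hz' : / b' <= 1000 / 747 * x).
  apply (Rmult_le_reg_r b'); trivial. rewrite Rinv_l by lra. unfold b', b. nra.
assert (hz0 : 0 < / b) by now apply Rinv_0_lt_compat.
assert (hz0' : 0 < / b') by now apply Rinv_0_lt_compat.
assert (S1 : lam * (3 / (4 * b ^ 2)) <= 756 / 1000 * x).
  replace (lam * (3 / (4 * b ^ 2))) with (3 / 4 * lam * (/ b) ^ 2) by (field; lra).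
  apply Rle_trans with (3 / 4 * lam * (1003 / 1000 * x) ^ 2).
    apply Rmult_le_compat_l; [lra|]. apply pow_incr; lra.
  replace (3 / 4 * lam * (1003 / 1000 * x) ^ 2) with (3 / 4 * (1003 / 1000) ^ 2 * x * (lam * x)) by ring.
  rewrite Ex. lra.
assert (S2 : lam ^ 2 / 2 * (105 / (16 * b' ^ 4)) <= 123 / 1000 * x).
  replace (lam ^ 2 / 2 * (105 / (16 * b' ^ 4))) with (105 / 32 * lam ^ 2 * (/ b') ^ 4) by (field; lra).
  apply Rle_trans with (105 / 32 * lam ^ 2 * (1000 / 747 * x) ^ 4).
    apply Rmult_le_compat_l; [nra|]. apply pow_incr; lra.
  replace (105 / 32 * lam ^ 2 * (1000 / 747 * x) ^ 4) with (105 / 32 * (1000 / 747) ^ 4 * x * x * (lam * x) ^ 2) by ring.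
  rewrite Ex. nra.
assert (S0 : 0 <= lam * (3 / (4 * b ^ 2))).
  apply Rmult_le_pos; [lra|]. apply Rdiv_le_0_compat; [lra|]. assert (0 < b ^ 2) by now apply pow_lt. lra.
assert (S0' : 0 <= lam ^ 2 / 2 * (105 / (16 * b' ^ 4))).
  apply Rmult_le_pos; [nra|]. apply Rdiv_le_0_compat; [lra|]. assert (0 < b' ^ 4) by now apply pow_lt. lra.
assert (Q1 : Gb b (1 / 2) * (1 + lam * (3 / (4 * b ^ 2))) <= (1 + 13 / 100 * x) * K * (1 + 756 / 1000 * x)).
  assert (0 <= (1 + 13 / 100 * x) * K) by (apply Rmult_le_pos; lra).
  apply Rle_trans with ((1 + 13 / 100 * x) * K * (1 + lam * (3 / (4 * b ^ 2)))).
    apply Rmult_le_compat_r; lra.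
  apply Rmult_le_compat_l; lra.
assert (Q2 : lam ^ 2 / 2 * (105 / (16 * b' ^ 4)) * Gb b' (1 / 2) <= 123 / 1000 * x * (116 / 100 * K)).
  apply Rle_trans with (lam ^ 2 / 2 * (105 / (16 * b' ^ 4)) * (116 / 100 * K)).
    apply Rmult_le_compat_l; lra.
  apply Rmult_le_compat_r; lra.
unfold Rdiv in T2 |- *. fold x in T2 |- *. fold K in T2 |- *.
assert (Q3 : (1 + 13 / 100 * x) * K * (1 + 756 / 1000 * x) + 123 / 1000 * x * (116 / 100 * K) + 3 * / 100 * x * K <= (1 + 3 * / 2 * x) * K).
  replace ((1 + 13 / 100 * x) * K * (1 + 756 / 1000 * x) + 123 / 1000 * x * (116 / 100 * K) + 3 * / 100 * x * K)
    with (((1 + 13 / 100 * x) * (1 + 756 / 1000 * x) + 123 / 1000 * x * (116 / 100) + 3 * / 100 * x) * K) by ring.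
  apply Rmult_le_compat_r; [lra|]. nra.
assert (EK : sqrt (PI * / lam) * / 2 = K) by reflexivity. rewrite ?EK in *.
lra.
Qed.

End Abstract_integral.

(** * Large n *)

Lemma exp_HN_Rmod a N u : 0 < a -> exp (- HN a N (a * u)) = exp (- LamN N a) * Rmod a N (a * u).
Proof.
intros H. rewrite Rmod_HN by trivial. rewrite <- Rmult_assoc, <- exp_plus.
replace (- LamN N a + LamN N a) with 0 by ring. rewrite exp_0. ring.
Qed.

Section Large_n.
Variables (a lam : R) (n N : nat).
Hypothesis Ha : 0 < a <= 3 / 100.
Hypothesis Hlam : lam = PI ^ 2 / 4 / a.
Hypothesis Hlam86 : 86 <= lam.
Hypothesis Hn : INR n * a = lam.
Hypothesis HnN : (n <= N)%nat.
Hypothesis HL : Rabs (LamN N a - Lmod a) <= a / 10000.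
Hypothesis HM : forall k, (k <= 3)%nat ->
  let t := a ^ 2 / 1000 in
  a ^ S k * MN (S k) N a <=
    PI ^ 2 / 4 / a * (INR (fact (S k)) / (1 - INR (S k) * t) ^ S (S k)) - INR (fact k) / 2 + / 1000 /\
  PI ^ 2 / 4 / a * (INR (fact (S k)) / (1 + INR (S k) * t) ^ S (S k)) - INR (fact k) / 2 - / 1000
    <= a ^ S k * MN (S k) N a.
Let r := exp (- a).
Hypothesis HT : forall t,
  r * (1 + r) * (1 - cos t) / ((1 - r) * ((1 - r) ^ 2 + 2 * r * (1 - cos t))) - / 1000 <= HN a N t.

Let t0 := a ^ 2 / 1000.

Lemma t0_bounds : 0 < t0 <= / 1000000 /\ lam * t0 <= / 10000.
Proof.
generalize PI_bounds; intros HP.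
unfold t0. split; [split|].
- apply Rdiv_lt_0_compat; [apply pow_lt; lra|lra].
- assert (a ^ 2 <= (3 / 100) ^ 2) by (apply pow_incr; lra). lra.
- rewrite Hlam. replace (PI ^ 2 / 4 / a * (a ^ 2 / 1000)) with (PI ^ 2 * a / 4000) by (field; lra).
  assert (PI ^ 2 <= 10) by nra. nra.
Qed.

Lemma inv_pow_upper (c K : R) k : 0 < (1 - c * t0) ^ k -> 1 <= (1 + K * t0) * (1 - c * t0) ^ k ->
  / (1 - c * t0) ^ k <= 1 + K * t0.
Proof.
intros H0 H. apply (Rmult_le_reg_r ((1 - c * t0) ^ k)); trivial. rewrite Rinv_l; lra.
Qed.

(** [Lmod] predicts [k! * lam - (k - 1)! / 2] for [a ^ k * MN k N a]. The four moments leave 1/100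
    for the errors, or keep only the leading term where that is enough. *)
Lemma moment1 : lam - 51 / 100 <= a * MN 1 N a <= lam.
Proof.
destruct t0_bounds as [[h0 h1] h2]. generalize (HM 0 ltac:(lia)). cbv zeta. fold t0. rewrite <- Hlam.
rewrite pow_1. simpl fact. simpl INR. rewrite !Rmult_1_l. intros [U L].
split.
- eapply Rle_trans; [|exact L].
  assert (1 - 2 * t0 <= / (1 + t0) ^ 2).
    apply (Rmult_le_reg_r ((1 + t0) ^ 2)); [apply pow_lt; lra|]. rewrite Rinv_l by (apply pow_nonzero; lra). nra.
  unfold Rdiv. nra.
- eapply Rle_trans; [exact U|].
  assert (/ (1 - 1 * t0) ^ 2 <= 1 + 3 * t0).
    apply inv_pow_upper; [apply pow_lt; lra|]. nra.
  rewrite Rmult_1_l in H. unfold Rdiv. nra.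
Qed.

Lemma moment2 : 2 * lam - 51 / 100 <= a ^ 2 * MN 2 N a <= 2 * lam - 49 / 100.
Proof.
destruct t0_bounds as [[h0 h1] h2]. generalize (HM 1 ltac:(lia)). cbv zeta. fold t0. rewrite <- Hlam.
simpl fact. simpl INR. intros [U L].
split.
- eapply Rle_trans; [|exact L].
  assert (1 - 6 * t0 <= / (1 + (1 + 1) * t0) ^ 3).
    apply (Rmult_le_reg_r ((1 + (1 + 1) * t0) ^ 3)); [apply pow_lt; lra|]. rewrite Rinv_l by (apply pow_nonzero; lra).
    simpl. nra.
  unfold Rdiv. nra.
- eapply Rle_trans; [exact U|].
  assert (/ (1 - (1 + 1) * t0) ^ 3 <= 1 + 7 * t0).
    apply inv_pow_upper; [apply pow_lt; lra|]. simpl. nra.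
  unfold Rdiv. nra.
Qed.

Lemma one_minus_pow_ge x k : 0 <= x <= 1 -> 1 - INR k * x <= (1 - x) ^ k.
Proof.
intros Hx. induction k as [|k IH]; [simpl; lra|].
rewrite S_INR, <- tech_pow_Rmult. generalize (pos_INR k); intros hk.
assert ((1 - x) * (1 - INR k * x) <= (1 - x) * (1 - x) ^ k) by (apply Rmult_le_compat_l; lra). nra.
Qed.

Lemma moment3 : a ^ 3 * MN 3 N a <= 6 * lam.
Proof.
destruct t0_bounds as [[h0 h1] h2]. generalize (HM 2 ltac:(lia)). cbv zeta. fold t0. rewrite <- Hlam.
simpl fact. simpl INR. intros [U _].
eapply Rle_trans; [exact U|].
assert (/ (1 - (1 + 1 + 1) * t0) ^ 4 <= 1 + 13 * t0).
  apply inv_pow_upper; [apply pow_lt; lra|].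
  assert (h := one_minus_pow_ge ((1 + 1 + 1) * t0) 4 ltac:(lra)). simpl INR in h. nra.
unfold Rdiv. nra.
Qed.

Lemma moment4 : a ^ 4 * MN 4 N a <= 24 * lam.
Proof.
destruct t0_bounds as [[h0 h1] h2]. generalize (HM 3 ltac:(lia)). cbv zeta. fold t0. rewrite <- Hlam.
simpl fact. simpl INR. intros [U _].
eapply Rle_trans; [exact U|].
assert (/ (1 - (1 + 1 + 1 + 1) * t0) ^ 5 <= 1 + 21 * t0).
  apply inv_pow_upper; [apply pow_lt; lra|].
  assert (h := one_minus_pow_ge ((1 + 1 + 1 + 1) * t0) 5 ltac:(lra)). simpl INR in h. nra.
unfold Rdiv. nra.
Qed.

Let A u := HN a N (a * u).
Let B u := Aarg a N (a * u) - INR n * (a * u).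
Let U := 4 * lam / PI.

Lemma U_PI_a : a * U = PI.
Proof. unfold U. rewrite Hlam. generalize PI_RGT_0; intros. field. lra. Qed.

(** The factor [4 / PI ^ 2] is about 0.4053. *)
Lemma inv_a_lam : 4052 / 10000 * lam <= / a.
Proof.
generalize PI_bounds; intros HP. rewrite Hlam.
replace (4052 / 10000 * (PI ^ 2 / 4 / a)) with (4052 / 10000 * PI ^ 2 / 4 * / a) by (field; lra).
rewrite <- (Rmult_1_l (/ a)) at 2. apply Rmult_le_compat_r; [apply Rlt_le, Rinv_0_lt_compat; lra|]. nra.
Qed.

Lemma integral_bounds :
  (1 - 3 / 2 / lam) * (sqrt (PI / lam) / 2) <= RInt (fun u => exp (- A u) * cos (B u)) 0 U
   <= (1 + 3 / 2 / lam) * (sqrt (PI / lam) / 2).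
Proof.
assert (ha : 0 < a) by lra.
assert (dA : forall u, ex_derive (fun u => exp (- A u)) u).
  intros u. apply (ex_derive_ext (fun u => exp (- LamN N a) * Rmod a N (a * u))).
    intros t. symmetry. now apply exp_HN_Rmod.
  apply ex_derive_mult; [apply ex_derive_const|].
  apply (ex_derive_comp (Rmod a N) (fun u => a * u)); [now apply ex_derive_Rmod|]. auto_derive; trivial.
assert (dB : forall u, ex_derive B u).
  intros u. apply (ex_derive_minus (fun u => Aarg a N (a * u))).
    apply (ex_derive_comp (Aarg a N) (fun u => a * u)); [now apply ex_derive_Aarg|]. auto_derive; trivial.
  auto_derive; trivial.
assert (A_up : forall u, 0 <= u -> A u <= (lam - 245 / 1000) * u ^ 2).
  intros u Hu. destruct (HN_bounds a N (a * u) ha ltac:(nra)) as [_ h]. eapply Rle_trans; [exact h|].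
  replace (MN 2 N a * (a * u) ^ 2 / 2) with (a ^ 2 * MN 2 N a / 2 * u ^ 2) by field.
  apply Rmult_le_compat_r; [nra|]. generalize moment2; lra.
assert (A_lo : forall u, 0 <= u -> (lam - 255 / 1000) * u ^ 2 - lam * u ^ 4 <= A u).
  intros u Hu. destruct (HN_bounds a N (a * u) ha ltac:(nra)) as [h _]. eapply Rle_trans; [|exact h].
  replace (MN 2 N a * (a * u) ^ 2 / 2) with (a ^ 2 * MN 2 N a / 2 * u ^ 2) by field.
  replace (MN 4 N a * (a * u) ^ 4 / 24) with (a ^ 4 * MN 4 N a / 24 * u ^ 4) by field.
  assert (0 <= u ^ 2) by nra. assert (0 <= u ^ 4) by now apply pow_le.
  generalize moment2 moment4; nra.
assert (B_up : forall u, 0 <= u -> Rabs (B u) <= 51 / 100 * u + lam * u ^ 3).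
  intros u Hu. destruct (Aarg_bounds a N (a * u) ha ltac:(nra)) as [h1 h2]. unfold B.
  replace (INR n * (a * u)) with (lam * u) by (rewrite <- Hn; ring).
  replace (MN 1 N a * (a * u)) with (a * MN 1 N a * u) in * by ring.
  replace (MN 3 N a * (a * u) ^ 3 / 6) with (a ^ 3 * MN 3 N a / 6 * u ^ 3) in * by field.
  assert (0 <= u ^ 3) by now apply pow_le.
  generalize moment1 moment3; intros. apply Rabs_le. split; nra.
assert (far : forall p q u, q <= u <= U -> 0 <= q <= 1 -> 0 <= p < 1 ->
   p <= 2 * (97 / 100) * (q ^ 2 / 2 - / 10000) * (1 - p) -> p * (4052 / 10000 * lam) - / 1000 <= A u).
  intros p q u Hu Hq Hp H. eapply Rle_trans; [|apply HT].
  assert (g := geom_kernel_lower a (a * u) p q Ha ltac:(split; [nra|rewrite <- U_PI_a; nra]) Hq Hp H). cbv zeta in g. fold r in g.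
  enough (p * (4052 / 10000 * lam) <= p / a) by lra.
  unfold Rdiv at 2. apply Rmult_le_compat_l; [lra|apply inv_a_lam].
assert (A_far : forall u, 7 / 10 <= u <= U -> 13 / 100 * lam <= A u).
  (* 322/1000 is slightly below [q^2 / (1 + q^2)] at [q = 7/10], and 492/1000 below slightly reduces
     its value 1/2 at [q = 1]. *)
  intros u Hu. generalize (far (322 / 1000) (7 / 10) u Hu ltac:(lra) ltac:(lra) ltac:(lra)). lra.
assert (A_vfar : forall u, 1 <= u <= U -> 19 / 100 * lam <= A u).
  intros u Hu. generalize (far (492 / 1000) 1 u Hu ltac:(lra) ltac:(lra) ltac:(lra)). lra.
split.
- now apply (integral_lower A B lam U).
- now apply (integral_upper A B lam U).
Qed.

Lemma overp_integral :
  INR (overp n) = exp (lam + LamN N a) * (a / PI) * RInt (fun u => exp (- A u) * cos (B u)) 0 U.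
Proof.
assert (ha : 0 < a) by lra. generalize PI_RGT_0; intros HP.
rewrite (overp_RInt a N n ha HnN). rewrite (Rmult_comm a), Hn, exp_plus.
set (F := fun t => Rmod a N t * cos (Aarg a N t - INR n * t)).
assert (exF : forall u v, ex_RInt F u v).
  intros; apply ex_RInt_ex_derive. intros t. unfold F. apply ex_derive_mult; [now apply ex_derive_Rmod|].
  generalize (ex_derive_Aarg a N t ha). intros. auto_derive; trivial.
assert (E := RInt_comp_lin F a 0 0 U (exF _ _)).
rewrite Rmult_0_r, !Rplus_0_r, U_PI_a in E. rewrite <- E.
rewrite (RInt_ext _ (fun u => a * exp (LamN N a) * (exp (- A u) * cos (B u)))).
  rewrite (RInt_scal (V := R_CompleteNormedModule)).
    unfold scal; simpl; unfold mult; simpl. field. lra.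
  apply ex_RInt_ex_derive. intros t.
  apply (ex_derive_ext (fun u => exp (- LamN N a) * Rmod a N (a * u) * cos (B u))).
    intros u. unfold A. now rewrite exp_HN_Rmod.
  apply ex_derive_mult.
    apply ex_derive_mult; [apply ex_derive_const|].
    apply (ex_derive_comp (Rmod a N) (fun u => a * u)); [now apply ex_derive_Rmod|]. auto_derive; trivial.
  apply (ex_derive_comp cos B); [auto_derive; trivial|].
  apply (ex_derive_minus (fun u => Aarg a N (a * u))).
    apply (ex_derive_comp (Aarg a N) (fun u => a * u)); [now apply ex_derive_Aarg|]. auto_derive; trivial.
  auto_derive; trivial.
intros u _. unfold scal; simpl; unfold mult; simpl. unfold F, A, B.
rewrite Rplus_0_r, Rmod_HN by trivial.
match goal with |- ?x = ?y => change (x = y :> R) end. ring.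
Qed.

(** The factor [sqrt (a / PI)], called [Q], appears once in [exp (Lmod a)] and once in the Gaussian
    integral, which with the Jacobian gives [(a / PI) ^ 2]. The integral uses 3/2 of the [PI / 2]
    allowed for the coefficient of [/ lam]; the rest covers [exp d]. *)
Lemma overp_bounds_large :
  (1 - PI / (2 * lam)) * exp (2 * lam) * (a / PI) ^ 2 / 2 <= INR (overp n) <=
  (1 + PI / (2 * lam)) * exp (2 * lam) * (a / PI) ^ 2 / 2.
Proof.
generalize PI_bounds; intros HP. assert (ha : 0 < a) by lra.
rewrite overp_integral.
destruct integral_bounds as [I1 I2]. set (J := RInt _ 0 U) in *.
set (d := LamN N a - Lmod a) in *. apply Rabs_le_between in HL.
assert (Hal : a <= 2468 / 1000 / lam).
  apply (Rmult_le_reg_r lam); [lra|]. replace (2468 / 1000 / lam * lam) with (2468 / 1000) by (field; lra).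
  rewrite Hlam. replace (a * (PI ^ 2 / 4 / a)) with (PI ^ 2 / 4) by (field; lra). nra.
assert (hq : 0 < a / PI) by (apply Rdiv_lt_0_compat; lra).
set (Q := sqrt (a / PI)). assert (hQ : 0 < Q) by now apply sqrt_lt_R0.
assert (hQ2 : Q * Q = a / PI) by (apply sqrt_sqrt; lra).
assert (E1 : exp (lam + LamN N a) = exp (2 * lam) * (Q / 2) * exp d).
  replace (lam + LamN N a) with (2 * lam + (/ 2 * ln (a / (4 * PI))) + d)
    by (unfold d, Lmod; rewrite Hlam; ring).
  rewrite !exp_plus. f_equal. f_equal.
  replace (a / (4 * PI)) with (Q / 2 * (Q / 2)).
    2:{ replace (Q / 2 * (Q / 2)) with (Q * Q / 4) by field. rewrite hQ2. field. lra. }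
  rewrite ln_mult by lra. replace (/ 2 * (ln (Q / 2) + ln (Q / 2))) with (ln (Q / 2)) by field.
  apply exp_ln; lra.
assert (E2 : sqrt (PI / lam) / 2 = Q).
  replace (PI / lam) with (Q * 2 * (Q * 2)).
    rewrite sqrt_square by lra. field.
  replace (Q * 2 * (Q * 2)) with (4 * (Q * Q)) by ring. rewrite hQ2, Hlam. field. lra.
rewrite E2 in I1, I2. rewrite E1.
assert (hx : 0 < / lam <= / 86) by (split; [apply Rinv_0_lt_compat; lra|apply Rinv_le_contravar; lra]).
assert (d1 : 1 - / lam / 1000 <= exp d).
  generalize (exp_ineq1_le d). unfold Rdiv in *. lra.
assert (d2 : exp d <= 1 + / lam / 1000).
  assert (e : exp d * exp (- d) = 1) by (rewrite <- exp_plus; replace (d + - d) with 0 by ring; apply exp_0).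
  generalize (exp_ineq1_le (- d)) (exp_pos d). intros.
  assert (hd : d <= 247 / 1000000 * / lam) by (unfold Rdiv in *; lra).
  unfold Rdiv. nra.
set (M := exp (2 * lam)) in *. assert (hM : 0 < M) by apply exp_pos.
assert (EF : forall z, z * M * (a / PI) ^ 2 / 2 = M * (a / PI) / 2 * (z * (Q * Q))).
  intros z. rewrite hQ2. field. lra.
rewrite !EF.
replace (M * (Q / 2) * exp d * (a / PI) * J) with (M * (a / PI) / 2 * (exp d * (Q * J))) by (field; lra).
assert (hC : 0 <= M * (a / PI) / 2) by (assert (0 < M * (a / PI)) by (apply Rmult_lt_0_compat; trivial); lra).
replace (PI / (2 * lam)) with (PI / 2 * / lam) by (field; lra).
unfold Rdiv in I1, I2, d1, d2. set (x := / lam) in *.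
assert (hJ : 0 <= J) by (eapply Rle_trans; [|exact I1]; apply Rmult_le_pos; lra).
assert (hQQ : 0 < Q * Q) by nra.
split; apply Rmult_le_compat_l; trivial.
- apply Rle_trans with ((1 - x * / 1000) * (Q * ((1 - 3 * / 2 * x) * Q))).
    replace ((1 - x * / 1000) * (Q * ((1 - 3 * / 2 * x) * Q))) with ((1 - x * / 1000) * (1 - 3 * / 2 * x) * (Q * Q)) by ring.
    apply Rmult_le_compat_r; [lra|]. nra.
  apply Rmult_le_compat; try lra.
    apply Rmult_le_pos; [lra|]. apply Rmult_le_pos; lra.
  apply Rmult_le_compat_l; lra.
- apply Rle_trans with ((1 + x * / 1000) * (Q * ((1 + 3 * / 2 * x) * Q))).
    apply Rmult_le_compat; [apply Rlt_le, exp_pos|apply Rmult_le_pos; lra|exact d2|].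
    apply Rmult_le_compat_l; lra.
  replace ((1 + x * / 1000) * (Q * ((1 + 3 * / 2 * x) * Q))) with ((1 + x * / 1000) * (1 + 3 * / 2 * x) * (Q * Q)) by ring.
  apply Rmult_le_compat_r; [lra|]. nra.
Qed.

End Large_n.

Lemma theorem_large n : (3000 <= n)%nat ->
    (1 / (8 * INR n) * (1 - 1 / sqrt (INR n)) * exp (PI * sqrt (INR n))
       <= INR (overp n)
     <= 1 / (8 * INR n) * (1 + 1 / sqrt (INR n)) * exp (PI * sqrt (INR n)))%R.
Proof.
intros Hn. generalize PI_bounds; intros HP.
assert (hn : 3000 <= INR n).
  apply le_INR in Hn. rewrite (INR_IZR_INZ 3000) in Hn. exact Hn.
set (q := sqrt (INR n)).
assert (hq2 : q * q = INR n) by (apply sqrt_sqrt; lra).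
(* [sqrt 3000] is about 54.772, which is what makes [lam] at least 86. *)
assert (hq : 5477 / 100 <= q).
  unfold q. rewrite <- (sqrt_square (5477 / 100)) by lra. apply sqrt_le_1_alt; lra.
set (a := PI / (2 * q)).
assert (Ha : 0 < a <= 3 / 100).
  unfold a. split; [apply Rdiv_lt_0_compat; lra|].
  apply (Rmult_le_reg_r (2 * q)); [lra|]. unfold Rdiv at 1. rewrite Rmult_assoc, Rinv_l; lra.
set (lam := PI * q / 2).
assert (Hlam : lam = PI ^ 2 / 4 / a) by (unfold lam, a; field; lra).
assert (Hlam86 : 86 <= lam) by (unfold lam; nra).
assert (Hna : INR n * a = lam) by (unfold a, lam; rewrite <- hq2; field; lra).
destruct (MN_near a ltac:(lra)) as [N1 H1].
destruct (geom_cos_lower a ltac:(lra)) as [N2 H2].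
set (N := (n + N1 + N2)%nat).
destruct (H1 N ltac:(unfold N; lia)) as [HL HM].
specialize (H2 N ltac:(unfold N; lia)).
destruct (overp_bounds_large a lam n N Ha Hlam Hlam86 Hna ltac:(unfold N; lia) HL HM H2) as [B1 B2].
replace (exp (PI * q)) with (exp (2 * lam)) by (f_equal; unfold lam; field).
replace (1 / q) with (PI / (2 * lam)) by (unfold lam; field; lra).
replace (1 / (8 * INR n)) with ((a / PI) ^ 2 / 2) by (unfold a; rewrite <- hq2; field; lra).
lra.
Qed.

(** * Gauss's recurrence *)

(** A bound for all the finite products at [q = 1/2]. Coefficients thus grow at most like [2 ^ n],
    and every power series below converges for [|q| <= 1/4]. *)
Definition cnt_cst := exp (PI ^ 2 / 4 / ln 2).

Lemma cnt_bound N n : Rabs (IZR (cnt N (Z.of_nat n))) <= cnt_cst * 2 ^ n.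
Proof.
assert (H : 0 < ln 2) by (rewrite <- ln_1; apply ln_increasing; lra).
rewrite <- (fcoef_cnt (ln 2)) by trivial.
eapply Rle_trans; [now apply fcoef_bound|].
assert (HN0 : HN (ln 2) N 0 = 0).
  unfold HN. induction N as [|N IH]; [reflexivity|]. rewrite ssum_S, IH, Rmult_0_r.
  unfold hlog. rewrite cos_0. unfold Rdiv. ring.
rewrite Rmod_HN, HN0, Ropp_0, exp_0, Rmult_1_r, Rmult_comm by trivial.
rewrite <- INR_IZR_INZ, (Rmult_comm (ln 2)), <- exp_pow, exp_ln by lra.
apply Rmult_le_compat_r; [apply pow_le; lra|]. now apply exp_mono, LamN_le.
Qed.

Lemma overp_cnt n N : (n <= N)%nat -> INR (overp n) = IZR (cnt N (Z.of_nat n)).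
Proof. intros H. now rewrite cnt_overp, INR_IZR_INZ. Qed.

Lemma half_bound C (f : nat -> R) q n : Rabs q <= / 4 -> Rabs (f n) <= C * 2 ^ n ->
  Rabs (f n * q ^ n) <= C * (/ 2) ^ n.
Proof.
intros Hq Hf. rewrite Rabs_mult, <- RPow_abs.
replace (/ 2) with (2 * / 4) by lra. rewrite Rpow_mult_distr, <- Rmult_assoc.
apply Rmult_le_compat; trivial; [apply Rabs_pos|apply pow_le, Rabs_pos|].
apply pow_incr. split; [apply Rabs_pos|trivial].
Qed.

Lemma CV_disk_half C f q : Rabs q <= / 4 -> (forall n, Rabs (f n) <= C * 2 ^ n) -> CV_disk f q.
Proof.
intros Hq Hf. unfold CV_disk.
apply (ex_series_le (V := R_CompleteNormedModule) _ (fun n => C * (/ 2) ^ n)).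
  intros n. unfold norm; simpl norm; unfold abs; simpl abs. rewrite Rabs_Rabsolu. now apply half_bound.
apply (ex_series_scal (V := R_NormedModule) C). apply ex_series_geom. rewrite Rabs_right; lra.
Qed.

Lemma radius_quarter f C : (forall n, Rabs (f n) <= C * 2 ^ n) -> Rbar_le (/ 4) (CV_radius f).
Proof.
intros H. apply Lub_Rbar_correct. apply (CV_disk_half C); trivial. rewrite Rabs_right; lra.
Qed.

Definition cntR N n := IZR (cnt N (Z.of_nat n)).

Lemma cnt_pseries N q : Rabs q <= / 4 -> PSeries (cntR N) q = oprod N q.
Proof.
intros Hq.
assert (EX : forall N, ex_pseries (cntR N) q).
  intros M. apply CV_disk_correct, (CV_disk_half cnt_cst); trivial. intros n; apply cnt_bound.
induction N as [|N IH].
  unfold oprod, PSeries; simpl sprod. rewrite Series_incr_1 by (apply ex_pseries_R, EX).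
  rewrite (Series_ext _ (fun _ => 0 * 0)), Series_scal_l; unfold cntR; intros; rewrite cnt_0; simpl; ring.
set (M := S N).
assert (h := one_minus_pow_pos q M ltac:(lra) ltac:(unfold M; lia)).
assert (E : PSeries (cntR M) q = q ^ M * PSeries (cntR M) q + PSeries (cntR N) q + q ^ M * PSeries (cntR N) q).
  rewrite <- !PSeries_incr_n, <- !PSeries_plus.
  - apply PSeries_ext. intros n. unfold PS_plus. rewrite !PS_incr_n_simplify. unfold plus; simpl plus.
    generalize (cnt_S N (Z.of_nat n)). fold M. unfold cntR. destruct (le_lt_dec M n) as [L|L].
      rewrite Nat2Z.inj_sub by trivial. intros E.
      rewrite <- !plus_IZR. f_equal. lia.
    rewrite !(cnt_neg _ (_ - _)) by lia. unfold zero; simpl. intros E.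
    rewrite !Rplus_0_r, Rplus_0_l. f_equal; lia.
  - apply ex_pseries_plus; trivial. now apply ex_pseries_incr_n.
  - now apply ex_pseries_incr_n.
  - now apply ex_pseries_incr_n.
  - trivial.
rewrite IH in E. unfold M at 2. rewrite oprod_S. fold M.
apply (Rmult_eq_reg_l (1 - q ^ M)); [|lra].
transitivity (oprod N q * (1 + q ^ M)); [lra|field; lra].
Qed.

Definition pR n := INR (overp n).

Lemma pR_bound n : Rabs (pR n) <= cnt_cst * 2 ^ n.
Proof. unfold pR. rewrite (overp_cnt n n) by lia. apply cnt_bound. Qed.

Lemma pseries_tail f q N : Rabs q <= / 4 -> (forall n, Rabs (f n) <= cnt_cst * 2 ^ n) ->
  Rabs (PSeries f q - sum_f_R0 (fun k => f k * q ^ k) N) <= cnt_cst * (/ 2) ^ N.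
Proof.
intros Hq Hf. unfold PSeries.
assert (X : ex_series (fun k => f k * q ^ k)) by now apply ex_pseries_R, CV_disk_correct, (CV_disk_half cnt_cst).
rewrite (Series_incr_n _ (S N)) by (trivial || lia). simpl Nat.pred.
set (s := sum_f_R0 _ _).
match goal with |- Rabs (s + Series ?g - s) <= _ => replace (s + Series g - s) with (Series g) by ring end.
assert (G : is_series (fun k => cnt_cst * (/ 2) ^ (S N + k)) (cnt_cst * (/ 2) ^ N)).
  apply (is_series_ext (fun k => cnt_cst * (/ 2) ^ (S N) * (/ 2) ^ k)).
    intros n; rewrite pow_add; apply Rmult_assoc.
  replace (cnt_cst * (/ 2) ^ N) with (cnt_cst * (/ 2) ^ S N * / (1 - / 2)).
    2:{ simpl. field. }
  apply (is_series_scal (V := R_NormedModule) (cnt_cst * (/ 2) ^ S N)). apply is_series_geom. rewrite Rabs_right; lra.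
rewrite <- (is_series_unique _ _ G).
eapply Rle_trans; [apply Series_Rabs|].
  apply (proj1 (ex_series_incr_n (fun k => Rabs (f k * q ^ k)) (S N))). now apply (CV_disk_half cnt_cst).
apply Series_le; [|eexists; exact G].
intros n; split; [apply Rabs_pos|now apply half_bound].
Qed.

(** Up to degree [N] the coefficients of the [N]-th product are already the final ones, so the
    difference consists of two tails of order [2 ^ (- N)]. *)
Lemma overp_pseries q : Rabs q <= / 4 -> is_lim_seq (fun N => oprod N q) (PSeries pR q).
Proof.
intros Hq.
assert (L : is_lim_seq (fun N => 2 * cnt_cst * (/ 2) ^ N) 0).
  replace (Finite 0) with (Rbar_mult (2 * cnt_cst) 0) by (simpl; f_equal; ring).
  apply is_lim_seq_mult'; [apply is_lim_seq_const|]. apply is_lim_seq_geom. rewrite Rabs_right; lra.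
assert (D : is_lim_seq (fun N => oprod N q - PSeries pR q) 0).
  apply is_lim_seq_abs_0. apply (is_lim_seq_le_le (fun _ => 0) _ (fun N => 2 * cnt_cst * (/ 2) ^ N)); trivial.
    2: apply is_lim_seq_const.
  intros N; split; [apply Rabs_pos|].
  rewrite <- cnt_pseries by trivial.
  generalize (pseries_tail (cntR N) q N Hq (fun n => cnt_bound N n)) (pseries_tail pR q N Hq pR_bound).
  rewrite (sum_eq (fun k => pR k * q ^ k) (fun k => cntR N k * q ^ k)).
    2:{ intros i Hi. unfold pR, cntR. now rewrite (overp_cnt i N). }
  set (s := sum_f_R0 _ _). intros h1 h2. apply Rabs_le_between in h1, h2. apply Rabs_le_between. lra.
apply (is_lim_seq_ext (fun N => (oprod N q - PSeries pR q) + PSeries pR q)); [intros; ring|].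
replace (Finite (PSeries pR q)) with (Rbar_plus 0 (PSeries pR q)) by (simpl; f_equal; ring).
apply is_lim_seq_plus'; [trivial|apply is_lim_seq_const].
Qed.

Lemma overp_theta4 q : Rabs q <= / 4 -> PSeries pR q * theta4 q = 1.
Proof.
intros Hq. assert (H : Rabs q < 1) by lra.
assert (L : is_lim_seq (fun N => oprod N q * / oprod N q) (PSeries pR q * theta4 q)).
  apply is_lim_seq_mult'; [now apply overp_pseries|now apply oprod_lim].
apply is_lim_seq_unique in L. rewrite (Lim_seq_ext _ (fun _ => 1)), Lim_seq_const in L.
  now injection L.
intros n. apply Rinv_r. generalize (oprod_pos q n H); lra.
Qed.

Definition sgn (s : nat) : Z := if Nat.even s then 1%Z else (-1)%Z.
Definition tz (m : nat) : Z :=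
  if (Nat.sqrt m * Nat.sqrt m =? m)%nat then (2 * sgn (Nat.sqrt m))%Z else 0%Z.
(* [tz] is the coefficient of [q^m] in [theta4 q] for [m > 0] only: [tz 0 = 2]. *)
Definition tc (m : nat) : R := match m with O => 1 | _ => IZR (tz m) end.

Lemma sgn_S s : sgn (S s) = (- sgn s)%Z.
Proof. unfold sgn. rewrite Nat.even_succ, <- Nat.negb_even. now destruct (Nat.even s). Qed.

Lemma sgn_pow s : IZR (sgn s) = (-1) ^ s.
Proof.
induction s as [|s IH]; [reflexivity|]. rewrite sgn_S, opp_IZR, IH. simpl; ring.
Qed.

Lemma tc_sum q m : sum_f_R0 (fun k => tc k * q ^ k) m = 1 + 2 * ssum (thterm q) (Nat.sqrt m).
Proof.
induction m as [|m IH].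
  simpl. ring.
rewrite tech5, IH. change (tc (S m)) with (IZR (tz (S m))). unfold tz.
destruct (Nat.sqrt_succ_or m) as [E|E]; rewrite E.
  replace (S (Nat.sqrt m) * S (Nat.sqrt m) =? S m)%nat with true.
    rewrite ssum_S, mult_IZR, sgn_pow. unfold thterm.
    replace (q ^ S m) with (q ^ (S (Nat.sqrt m) * S (Nat.sqrt m))); [ring|]. f_equal.
    generalize (Nat.sqrt_spec (S m) ltac:(lia)) (Nat.sqrt_spec m ltac:(lia)). rewrite E. nia.
  symmetry; apply Nat.eqb_eq.
  generalize (Nat.sqrt_spec (S m) ltac:(lia)) (Nat.sqrt_spec m ltac:(lia)). rewrite E. nia.
generalize (Nat.sqrt_spec (S m) ltac:(lia)) (Nat.sqrt_spec m ltac:(lia)). rewrite E. intros.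
replace (Nat.sqrt m * Nat.sqrt m =? S m)%nat with false by (symmetry; apply Nat.eqb_neq; lia). ring.
Qed.

Lemma sqrt_eventually : filterlim Nat.sqrt eventually eventually.
Proof.
intros P [K HK]. exists (K * K)%nat. intros n Hn. apply HK.
rewrite <- (Nat.sqrt_square K). now apply Nat.sqrt_le_mono.
Qed.

Lemma theta4_pseries q : Rabs q < 1 -> PSeries tc q = theta4 q.
Proof.
intros Hq. apply is_series_unique.
enough (is_lim_seq (sum_n (fun k => tc k * q ^ k)) (theta4 q)) by trivial.
apply (is_lim_seq_ext (fun m => 1 + 2 * ssum (thterm q) (Nat.sqrt m))).
  intros m. rewrite sum_n_Reals; symmetry; apply tc_sum.
apply (is_lim_seq_subseq (fun N => 1 + 2 * ssum (thterm q) N) (theta4 q)); [apply sqrt_eventually|now apply theta4_lim].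
Qed.

Lemma tc_bound n : Rabs (tc n) <= 2.
Proof.
assert (forall s, IZR (sgn s) = 1 \/ IZR (sgn s) = -1) as H.
  intros s. unfold sgn. destruct (Nat.even s); auto.
destruct n as [|n]; unfold tc; [rewrite Rabs_R1; lra|]. unfold tz.
apply Rabs_le. destruct (_ =? _)%nat; [rewrite mult_IZR; destruct (H (Nat.sqrt (S n))) as [-> | ->]; lra|lra].
Qed.

(** Compares the coefficients in [theta4 * F = 1] near 0. That the product series has a positive
    radius is read off from its convergence at 1/8. *)
Lemma overp_conv n : sum_f_R0 (fun k => tc k * pR (n - k)) n = if (n =? 0)%nat then 1 else 0.
Proof.
assert (Rt : Rbar_le (/ 4) (CV_radius tc)).
  apply (radius_quarter _ 2). intros m; generalize (tc_bound m) (pow_R1_Rle 2 m ltac:(lra)); lra.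
assert (Rp : Rbar_le (/ 4) (CV_radius pR)) by (apply (radius_quarter _ cnt_cst), pR_bound).
set (e := fun n : nat => if (n =? 0)%nat then 1 else 0).
change (PS_mult tc pR n = e n).
apply PSeries_ext_recip.
- assert (X : ex_pseries (PS_mult tc pR) (/ 8)).
    apply ex_pseries_mult; (eapply Rbar_lt_le_trans; [|eassumption]); simpl; rewrite Rabs_right; lra.
  apply Rbar_not_le_lt. intros L. apply (CV_disk_outside (PS_mult tc pR) (/ 8)).
    eapply Rbar_le_lt_trans; [exact L|]. simpl. rewrite Rabs_right; lra.
  apply (ex_series_lim_0 (fun n => PS_mult tc pR n * (/ 8) ^ n)). now apply ex_pseries_R.
- eapply Rbar_lt_le_trans; [|apply (radius_quarter e 1)]; [simpl; lra|].
  intros m. generalize (pow_R1_Rle 2 m ltac:(lra)). unfold e.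
  destruct (m =? 0)%nat; rewrite Rabs_right; lra.
- assert (H8 : 0 < / 8) by lra. exists (mkposreal _ H8). intros x Hx.
  change (Rabs (x - 0) < / 8) in Hx. rewrite Rminus_0_r in Hx.
  rewrite PSeries_mult; try (eapply Rbar_lt_le_trans; [|eassumption]; simpl; lra).
  rewrite theta4_pseries, Rmult_comm, overp_theta4 by lra. unfold PSeries. symmetry.
  rewrite Series_incr_1.
    rewrite (Series_ext _ (fun _ => 0 * 0)), Series_scal_l; intros; unfold e; simpl; ring.
  apply ex_pseries_R, CV_disk_correct, (CV_disk_half 1); [lra|].
  intros m. generalize (pow_R1_Rle 2 m ltac:(lra)). unfold e.
  destruct (m =? 0)%nat; rewrite Rabs_right; lra.
Qed.

(** Latest value first, so that the recurrence reads the list from its head and a new value is added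
    by [cons]. *)
Fixpoint plist (n : nat) : list Z :=
  match n with O => nil | S m => cons (Z.of_nat (overp m)) (plist m) end.

Fixpoint Dz (l : list Z) (j : nat) : Z :=
  match l with nil => 0 | cons x l' => x * tz j + Dz l' (S j) end%Z.

(* [alt l 0 2] is the sum of [(-1)^(k+1) x_(k^2)] over [l = x_1, x_2, ...]: [c] entries remain to be
   skipped before the next square [k^2], and [s = 2 k] is the number to skip after it. *)
Fixpoint alt (l : list Z) (c s : nat) : Z :=
  match l with
  | nil => 0
  | cons x l' => match c with O => x - alt l' s (S (S s)) | S c' => alt l' c' s end
  end%Z.

Lemma Dz_plist n j :
  IZR (Dz (plist (S n)) j) = sum_f_R0 (fun k => IZR (tz (k + j)) * pR (n - k)) n.
Proof.
revert j; induction n as [|n IH]; intros j.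
  cbn [plist Dz sum_f_R0]. rewrite Z.add_0_r, mult_IZR, <- INR_IZR_INZ. unfold pR. simpl. ring.
rewrite decomp_sum by lia. simpl Nat.pred.
change (Dz (plist (S (S n))) j) with (Z.of_nat (overp (S n)) * tz j + Dz (plist (S n)) (S j))%Z.
rewrite plus_IZR, IH, mult_IZR, <- INR_IZR_INZ, (sum_eq _ (fun i => IZR (tz (S i + j)) * pR (S n - S i))).
  simpl (0 + j)%nat. rewrite Nat.sub_0_r. unfold pR at 2. ring.
intros i _. f_equal. f_equal. f_equal. lia.
Qed.

(** The condition on [c] places the index [k * k - c] strictly above [(k - 1) ^ 2], so [k * k] is
    the next square and the entries before it have weight 0. After it, [2 * k] entries precede the
    following square. *)
Lemma Dz_alt l k c : (0 < k)%nat -> (c + 2 <= 2 * k)%nat ->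
  Dz l (k * k - c) = (2 * sgn k * alt l c (2 * k))%Z.
Proof.
revert k c; induction l as [|x l IH]; intros k c Hk Hc; [simpl; ring|].
cbn [Dz alt]. destruct c as [|c].
  rewrite Nat.sub_0_r. replace (S (k * k)) with (S k * S k - 2 * k)%nat by lia.
  rewrite IH by lia. unfold tz. rewrite Nat.sqrt_square, Nat.eqb_refl, sgn_S.
  replace (2 * S k)%nat with (S (S (2 * k))) by lia. ring.
replace (S (k * k - S c)) with (k * k - c)%nat by nia. rewrite IH by lia.
replace (tz (k * k - S c)) with 0%Z; [ring|]. unfold tz.
rewrite (proj2 (Nat.eqb_neq _ _)); trivial. intros E.
assert (Nat.sqrt (k * k - S c) = (k - 1))%nat.
  apply Nat.sqrt_unique. nia.
nia.
Qed.

Lemma overp_alt n : (0 < n)%nat -> Z.of_nat (overp n) = (2 * alt (plist n) 0 2)%Z.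
Proof.
intros Hn. destruct n as [|n]; [lia|].
generalize (overp_conv (S n)). rewrite decomp_sum by lia. simpl (S n =? 0)%nat. cbv iota. simpl Nat.pred.
intros E. assert (E' : pR (S n) + IZR (Dz (plist (S n)) 1) = 0).
  rewrite <- E, Dz_plist. rewrite Nat.sub_0_r. simpl (tc 0). rewrite Rmult_1_l. f_equal.
  apply sum_eq. intros i _. rewrite Nat.add_1_r. reflexivity.
rewrite (Dz_alt _ 1 0) in E' by lia.
unfold pR in E'. rewrite INR_IZR_INZ, <- plus_IZR in E'. apply eq_IZR in E'.
change (2 * 1)%nat with 2%nat in E'. change (sgn 1) with (-1)%Z in E'. lia.
Qed.

(** * Small n by computation *)

Lemma ln2_bounds : 0.693147 < ln 2 < 0.693148.
Proof.
generalize (artanh_bounds (/ 3) 7 ltac:(lra)).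
replace ((1 + / 3) / (1 - / 3)) with 2 by field.
unfold artanh_sum. cbn [ssum]. simpl INR. simpl pow. simpl Nat.mul. lra.
Qed.

(** The number [2 ^ (1/128)]. Its powers locate [exp (PI * sqrt n)] within steps of 0.54 percent,
    fine enough since [1 / sqrt n] exceeds 1.8 percent for [n < 3000]; 128 of them suffice, as the
    others differ by powers of 2. *)
Definition two_root := exp (ln 2 / 128).

Lemma two_root_pow k j : two_root ^ (128 * k + j) = 2 ^ k * two_root ^ j.
Proof.
rewrite pow_add, pow_mult. f_equal. f_equal. unfold two_root. rewrite exp_pow.
replace (INR 128 * (ln 2 / 128)) with (ln 2); [apply exp_ln; lra|].
rewrite (INR_IZR_INZ 128). simpl (Z.of_nat 128). field.
Qed.

(* [2 ^ 30 * 2 ^ (1 / 128)] rounded down. *)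
Definition al : Z := 1079572135.

Lemma pow_le_reg x y n : 0 <= y -> x ^ S n <= y ^ S n -> x <= y.
Proof.
intros Hy H. destruct (Rle_lt_dec x y) as [L|L]; trivial.
exfalso. apply (Rlt_irrefl (y ^ S n)). eapply Rlt_le_trans; [|exact H].
clear H. induction n as [|n IH]; [lra|]. rewrite <- !(tech_pow_Rmult _ (S n)).
apply Rmult_le_0_lt_compat; trivial. now apply pow_le.
Qed.

(** Checked on 128th powers, where the middle term becomes [2 ^ 3841], with
    [3841 = 30 * 128 + 1]. *)
Lemma al_bounds : IZR al <= 2 ^ 30 * two_root <= IZR (al + 1).
Proof.
assert (T : (2 ^ 30 * two_root) ^ 128 = IZR (2 ^ 3841)).
  rewrite Rpow_mult_distr. generalize (two_root_pow 1 0).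
  rewrite Nat.mul_1_r, Nat.add_0_r. intros ->.
  rewrite <- pow_mult, Rmult_1_r, pow_1, Rmult_comm, tech_pow_Rmult.
  rewrite (pow_IZR 2). f_equal.
assert (0 < two_root) by apply exp_pos.
split; apply (pow_le_reg _ _ 127).
- nra.
- rewrite T, pow_IZR. apply IZR_le, Z.leb_le. vm_cast_no_check (eq_refl true).
- apply IZR_le. unfold al; lia.
- rewrite T, pow_IZR. apply IZR_le, Z.leb_le. vm_cast_no_check (eq_refl true).
Qed.

Fixpoint table (f : Z -> Z) (len : nat) (c : Z) : list Z :=
  match len with O => nil | S k => cons c (table f k (f c)) end.

Definition step_lo c := (c * al / 2 ^ 30)%Z.
Definition step_hi c := (c * (al + 1) / 2 ^ 30 + 1)%Z.

Lemma table_lo len c j : (0 <= c)%Z -> IZR (List.nth j (table step_lo len c) 0%Z) <= IZR c * two_root ^ j.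
Proof.
assert (Ht : 0 < two_root) by apply exp_pos.
revert c j; induction len as [|len IH]; intros c j Hc; apply IZR_le in Hc as Hc'.
  destruct j; simpl List.nth; (apply Rmult_le_pos; [lra|apply pow_le; lra]).
destruct j as [|j]; simpl List.nth; [simpl; lra|].
assert (Hal : (0 <= step_lo c)%Z) by (apply Z.div_pos; unfold al; lia).
eapply Rle_trans; [now apply IH|]. rewrite <- tech_pow_Rmult, <- Rmult_assoc.
apply Rmult_le_compat_r; [apply pow_le; lra|].
assert (E : (step_lo c * 2 ^ 30 <= c * al)%Z).
  unfold step_lo. rewrite Z.mul_comm. apply Z.mul_div_le. lia.
apply IZR_le in E. rewrite !mult_IZR in E. change (IZR (2 ^ 30)) with (IZR 1073741824) in E.
generalize (proj1 al_bounds). replace (2 ^ 30) with (IZR 1073741824) by (simpl; lra). nra.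
Qed.

Lemma table_hi len c j : (0 <= c)%Z -> (j < len)%nat ->
  IZR c * two_root ^ j <= IZR (List.nth j (table step_hi len c) 0%Z).
Proof.
assert (Ht : 0 < two_root) by apply exp_pos.
revert c j; induction len as [|len IH]; intros c j Hc Hj; [lia|]. apply IZR_le in Hc as Hc'.
destruct j as [|j]; simpl List.nth; [simpl; lra|].
assert (Hal : (0 <= c * (al + 1) / 2 ^ 30)%Z) by (apply Z.div_pos; unfold al; lia).
eapply Rle_trans; [|apply IH; [unfold step_hi; lia|lia]]. rewrite <- tech_pow_Rmult, <- Rmult_assoc.
apply Rmult_le_compat_r; [apply pow_le; lra|].
assert (E : (c * (al + 1) <= step_hi c * 2 ^ 30)%Z).
  unfold step_hi. generalize (Z.mul_succ_div_gt (c * (al + 1)) (2 ^ 30) ltac:(lia)). lia.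
apply IZR_le in E. rewrite !mult_IZR in E. change (IZR (2 ^ 30)) with (IZR 1073741824) in E.
generalize (proj2 al_bounds). replace (2 ^ 30) with (IZR 1073741824) by (simpl; lra). nra.
Qed.

(* [c_lo / 16 <= (128 * PI / ln 2) ^ 2 <= c_hi / 16] *)
Definition c_lo : Z := 5385024.
Definition c_hi : Z := 5385041.

(** [J] is a lower estimate of [128 * PI * sqrt n / ln 2], the exponent of [exp (PI * sqrt n)] in
    base [2 ^ (1/128)]. Its remainder modulo 128 is looked up in the table and its quotient is a
    power of 2. *)
Definition exp_lo (tab : list Z) (n : Z) : Z :=
  let J := Z.sqrt (c_lo * n / 16) in
  (List.nth (Z.to_nat (J mod 128)) tab 0 * 2 ^ (J / 128))%Z.
Definition exp_hi (tab : list Z) (n : Z) : Z :=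
  let J := (Z.sqrt (c_hi * n / 16) + 1)%Z in
  (List.nth (Z.to_nat (J mod 128)) tab 0 * 2 ^ (J / 128))%Z.

Lemma two_root_split J : (0 <= J)%Z ->
  IZR (2 ^ (J / 128)) * two_root ^ Z.to_nat (J mod 128) = exp (IZR J * (ln 2 / 128)).
Proof.
intros HJ.
assert (H1 := Z.div_pos J 128 HJ ltac:(lia)). assert (H2 := Z.mod_pos_bound J 128 ltac:(lia)).
rewrite <- (Z2Nat.id (J / 128)) at 1 by trivial.
rewrite <- pow_IZR, <- two_root_pow. unfold two_root. rewrite exp_pow. f_equal. f_equal.
rewrite INR_IZR_INZ. f_equal.
rewrite Nat2Z.inj_add, Nat2Z.inj_mul, !Z2Nat.id by lia. symmetry. rewrite Z.add_comm, Z.add_comm.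
apply Z.div_mod. lia.
Qed.

Lemma exp_lo_arith x s : 0 <= x -> 0 <= s -> 16 * (x * x) <= 5385024 * (s * s) ->
  x * (ln 2 / 128) <= PI * s.
Proof.
intros Hx Hs H.
(* 580.1414 is just above [sqrt c_lo / 4], and its product with [ln 2 / 128] is still below [PI]. *)
assert (x <= 5801414 / 10000 * s) by (apply Rsqr_incr_0_var; unfold Rsqr; nra).
generalize PI_bounds ln2_bounds; nra.
Qed.

Lemma exp_hi_arith x s : 0 <= x -> 0 <= s -> 5385041 * (s * s) <= 16 * (x * x) ->
  PI * s <= x * (ln 2 / 128).
Proof.
intros Hx Hs H.
assert (58014226 / 100000 * s <= x) by (apply Rsqr_incr_0_var; unfold Rsqr; nra).
generalize PI_bounds ln2_bounds; nra.
Qed.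

Lemma exp_lo_le n : IZR (exp_lo (table step_lo 128 (2 ^ 16)) (Z.of_nat n)) <= 65536 * exp (PI * sqrt (INR n)).
Proof.
unfold exp_lo. set (J := Z.sqrt _). set (x := (c_lo * Z.of_nat n / 16)%Z) in *.
assert (Hx : (0 <= x)%Z) by (apply Z.div_pos; unfold c_lo; lia).
assert (HJ : (0 <= J)%Z) by apply Z.sqrt_nonneg.
assert (HJ2 : (16 * (J * J) <= c_lo * Z.of_nat n)%Z).
  generalize (Z.sqrt_spec x Hx) (Z.mul_div_le (c_lo * Z.of_nat n) 16 ltac:(lia)). cbv zeta; fold J; fold x. lia.
rewrite mult_IZR. assert (HP : 0 < IZR (2 ^ (J / 128))).
  apply IZR_lt, Z.pow_pos_nonneg; [lia|]. apply Z.div_pos; lia.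
eapply Rle_trans.
  apply Rmult_le_compat_r; [lra|]. apply table_lo. lia.
change (IZR (2 ^ 16)) with 65536. rewrite Rmult_assoc. apply Rmult_le_compat_l; [lra|].
rewrite Rmult_comm, two_root_split by trivial. apply exp_mono.
apply IZR_le in HJ, HJ2. rewrite !mult_IZR, <- INR_IZR_INZ in HJ2. change (IZR c_lo) with 5385024 in HJ2.
generalize PI_bounds ln2_bounds (sqrt_pos (INR n)) (sqrt_sqrt (INR n) (pos_INR n)).
set (s := sqrt (INR n)). intros HPI Hl Hs Es. rewrite <- Es in HJ2.
apply exp_lo_arith; trivial.
Qed.

Lemma exp_hi_ge n : 65536 * exp (PI * sqrt (INR n)) <= IZR (exp_hi (table step_hi 128 (2 ^ 16)) (Z.of_nat n)).
Proof.
unfold exp_hi. set (J := (Z.sqrt _ + 1)%Z). set (x := (c_hi * Z.of_nat n / 16)%Z) in *.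
assert (Hx : (0 <= x)%Z) by (apply Z.div_pos; unfold c_hi; lia).
assert (HJ : (0 <= J)%Z) by (unfold J; generalize (Z.sqrt_nonneg x); lia).
assert (HJ2 : (c_hi * Z.of_nat n <= 16 * (J * J))%Z).
  generalize (Z.sqrt_spec x Hx) (Z.mul_succ_div_gt (c_hi * Z.of_nat n) 16 ltac:(lia)). cbv zeta; fold x. unfold J. lia.
rewrite mult_IZR. assert (HP : 0 < IZR (2 ^ (J / 128))).
  apply IZR_lt, Z.pow_pos_nonneg; [lia|]. apply Z.div_pos; lia.
eapply Rle_trans.
2:{ apply Rmult_le_compat_r; [lra|]. apply table_hi; [lia|].
    generalize (Z.mod_pos_bound J 128 ltac:(lia)). lia. }
change (IZR (2 ^ 16)) with 65536. rewrite Rmult_assoc. apply Rmult_le_compat_l; [lra|].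
rewrite (Rmult_comm (two_root ^ _)), two_root_split by trivial. apply exp_mono.
apply IZR_le in HJ, HJ2. rewrite !mult_IZR, <- INR_IZR_INZ in HJ2. change (IZR c_hi) with 5385041 in HJ2.
generalize PI_bounds ln2_bounds (sqrt_pos (INR n)) (sqrt_sqrt (INR n) (pos_INR n)).
set (s := sqrt (INR n)). intros HPI Hl Hs Es. rewrite <- Es in HJ2.
apply exp_hi_arith; trivial.
Qed.

(* [r >= 2^8 sqrt n], so [256 / r <= 1 / sqrt n]; the tables hold multiples of [2^16]. *)
Definition check (tl th : list Z) (n p : Z) : bool :=
  let r := (Z.sqrt (n * 2 ^ 16) + 1)%Z in
  let P := (8 * n * p * r * 2 ^ 16)%Z in
  andb (P <=? (r + 256) * exp_lo tl n)%Z ((r - 256) * exp_hi th n <=? P)%Z.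

Fixpoint check_from (tl th : list Z) (len : nat) (n : Z) (l : list Z) : bool :=
  match len with
  | O => true
  | S k => let p := (2 * alt l 0 2)%Z in
           if check tl th n p then check_from tl th k (n + 1) (cons p l) else false
  end.

Lemma check_from_correct tl th len n : (0 < n)%nat ->
  check_from tl th len (Z.of_nat n) (plist n) = true ->
  forall m, (n <= m < n + len)%nat -> check tl th (Z.of_nat m) (Z.of_nat (overp m)) = true.
Proof.
revert n; induction len as [|len IH]; intros n Hn H m Hm; [lia|].
cbn [check_from] in H. rewrite <- overp_alt in H by trivial.
destruct (check _ _ _ _) eqn:E; [|discriminate].
destruct (Nat.eq_dec m n) as [->|Hmn]; trivial.
apply (IH (S n)); [lia| |lia]. rewrite Nat2Z.inj_succ. exact H.
Qed.

Lemma check_small :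
  check_from (table step_lo 128 (2 ^ 16)) (table step_hi 128 (2 ^ 16)) 2999 1 (cons 1%Z nil) = true.
Proof. vm_cast_no_check (eq_refl true). Qed.

Lemma theorem_small n : (0 < n < 3000)%nat ->
  (1 / (8 * INR n) * (1 - 1 / sqrt (INR n)) * exp (PI * sqrt (INR n))
       <= INR (overp n)
     <= 1 / (8 * INR n) * (1 + 1 / sqrt (INR n)) * exp (PI * sqrt (INR n)))%R.
Proof.
intros Hn.
assert (H0 : plist 1 = cons 1%Z nil).
  simpl plist. rewrite <- (cnt_overp 0 0) by lia. now rewrite cnt_0.
generalize (check_from_correct (table step_lo 128 (2 ^ 16)) (table step_hi 128 (2 ^ 16)) 2999 1 ltac:(lia)).
rewrite H0. intros C. specialize (C check_small n ltac:(lia)). unfold check in C.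
apply andb_prop in C. destruct C as [C1 C2]. apply Z.leb_le, IZR_le in C1, C2.
set (r := (Z.sqrt (Z.of_nat n * 2 ^ 16) + 1)%Z) in *.
assert (Hr : (Z.of_nat n * 65536 <= r * r)%Z).
  generalize (Z.sqrt_spec (Z.of_nat n * 2 ^ 16) ltac:(lia)). cbv zeta. unfold r. lia.
assert (Hr0 : (0 <= r)%Z) by (unfold r; generalize (Z.sqrt_nonneg (Z.of_nat n * 2 ^ 16)); lia).
apply IZR_le in Hr, Hr0. rewrite !mult_IZR, <- INR_IZR_INZ in Hr.
rewrite !mult_IZR, plus_IZR, <- !INR_IZR_INZ in C1. rewrite !mult_IZR, minus_IZR, <- !INR_IZR_INZ in C2.
change (IZR (2 ^ 16)) with 65536 in C1, C2.
generalize (exp_lo_le n) (exp_hi_ge n).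
set (A := IZR (exp_lo _ _)) in *. set (B := IZR (exp_hi _ _)) in *. set (X := exp _).
assert (hn : 1 <= INR n) by (apply (le_INR 1); lia).
rewrite <- (sqrt_sqrt (INR n)) in Hr by lra.
assert (hs : 1 <= sqrt (INR n)) by (rewrite <- sqrt_1; now apply sqrt_le_1_alt).
set (s := sqrt (INR n)) in *. set (p := INR (overp n)) in *. set (rr := IZR r) in *.
intros HA HB.
assert (HX : 0 < X) by apply exp_pos.
assert (hrs : 256 * s <= rr) by nra.
(* The check was made with [256 / rr] in place of [1 / s], hence with a narrower interval. *)
assert (hinv : 256 / rr <= 1 / s).
  apply (Rmult_le_reg_r (rr * s)); [nra|]. field_simplify; lra.
assert (hk : 0 < 8 * INR n * rr * 65536) by nra.
assert (E1 : (1 / (8 * INR n) * (1 - 256 / rr) * X) * (8 * INR n * rr * 65536) = (rr - 256) * (65536 * X)).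
  field. lra.
assert (E2 : (1 / (8 * INR n) * (1 + 256 / rr) * X) * (8 * INR n * rr * 65536) = (rr + 256) * (65536 * X)).
  field. lra.
assert (hn' : 0 <= 1 / (8 * INR n)) by (apply Rdiv_le_0_compat; lra).
split.
- apply Rle_trans with (1 / (8 * INR n) * (1 - 256 / rr) * X).
    apply Rmult_le_compat_r; [lra|]. apply Rmult_le_compat_l; lra.
  apply (Rmult_le_reg_r _ _ _ hk). rewrite E1.
  apply Rle_trans with ((rr - 256) * B); [apply Rmult_le_compat_l; lra|]. lra.
- apply Rle_trans with (1 / (8 * INR n) * (1 + 256 / rr) * X).
    2:{ apply Rmult_le_compat_r; [lra|]. apply Rmult_le_compat_l; lra. }
  apply (Rmult_le_reg_r _ _ _ hk). rewrite E2.
  apply Rle_trans with ((rr + 256) * A); [lra|apply Rmult_le_compat_l; lra].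
Qed.

Theorem theorem3p6 :
  forall n : nat, (0 < n)%nat ->
    (1 / (8 * INR n) * (1 - 1 / sqrt (INR n)) * exp (PI * sqrt (INR n))
       <= INR (overp n)
     <= 1 / (8 * INR n) * (1 + 1 / sqrt (INR n)) * exp (PI * sqrt (INR n)))%R.
Proof.
intros n Hn. destruct (le_lt_dec 3000 n) as [H|H].
- now apply theorem_large.
- apply theorem_small; lia.
Qed.
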